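(* Let $X$ be a finite set, $\omega:X\to\mathfrak h^*$ a function, and $R=(R_{xy}^{ab})_{x,y,a,b\in X}$ a matrix with entries in $M_{\mathfrak h^*}$ such that $R_{xy}^{ab}=0$ if $\omega(x)+\omega(y)\neq\omega(a)+\omega(b)$. Let $A_R$ be the associated $\mathfrak h$-bialgebroid (see context). The following two conditions are equivalent: (i) There exists a pairing $A_R^{\mathrm{cop}}\times A_R\to D_{\mathfrak h}$ defined by $$\langle L_{ij},L_{kl}\rangle=R_{ik}^{jl}\,T_{-\omega(i)-\omega(k)}.$$ (ii) $R$ satisfies the quantum dynamical Yang--Baxter equation $$R^{12}(\lambda-h^{(3)})R^{13}(\lambda)R^{23}(\lambda-h^{(1)})=R^{23}(\lambda)R^{13}(\lambda-h^{(2)})R^{12}(\lambda).$$ Moreover, this pairing is automatically a cobraiding on $A_R$.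
   Context: Basics. $\mathfrak h^*$ is a finite-dimensional complex vector space, $M_{\mathfrak h^*}$ is the field of meromorphic functions on it, and $(T_\alpha f)(\lambda)=f(\lambda+\alpha)$ for $\alpha\in\mathfrak h^*$. An $\mathfrak h$-prealgebra is a complex vector space $A=\bigoplus_{\alpha,\beta\in\mathfrak h^*}A_{\alpha\beta}$ with two left actions (moment maps) $\mu_l,\mu_r:M_{\mathfrak h^*}\to\mathrm{End}_{\mathbb C}(A)$ preserving the bigrading and with commuting images; homomorphisms are linear maps preserving moment maps and bigrading. Right actions are defined by $\mu_l(f)a=a\mu_l(T_\alpha f)$, $\mu_r(f)a=a\mu_r(T_\beta f)$ for $a\in A_{\alpha\beta}$. $A\widetilde\otimes B$ is $\bigoplus_{\alpha\beta\gamma}A_{\alpha\gamma}\otimes_{\mathbb C}B_{\gamma\beta}$ modulo $\mu_r(f)a\otimes b=a\otimes\mu_l(f)b$, with bigrading $A_{\alpha\beta}\widetilde\otimes B_{\beta\gamma}\subseteq(A\widetilde\otimes B)_{\alpha\gamma}$ and moment maps $\mu_l(f)(a\otimes b)=\mu_l(f)a\otimes b$, $\mu_r(f)(a\otimes b)=a\otimes\mu_r(f)b$. An $\mathfrak h$-algebra is an $\mathfrak h$-prealgebra that is a unital associative algebra with $A_{\alpha\beta}A_{\gamma\delta}\subseteq A_{\alpha+\gamma,\beta+\delta}$, where $\mu_l,\mu_r$ are viewed as algebra embeddings $M_{\mathfrak h^*}\to A_{00}$, $\mu_l(f)=\mu_l(f)1$ etc., and the relations $\mu_l(f)a=a\mu_l(T_\alpha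 f)$, $\mu_r(f)a=a\mu_r(T_\beta f)$ ($a\in A_{\alpha\beta}$, $f\in M_{\mathfrak h^*}$) hold in the algebra. $D_{\mathfrak h}$ is the algebra of difference operators $\sum_i f_iT_{\beta_i}$ (finite sums) on $M_{\mathfrak h^*}$; it is an $\mathfrak h$-algebra with $fT_{-\beta}\in(D_{\mathfrak h})_{\beta\beta}$ (so $(D_{\mathfrak h})_{\alpha\beta}=0$ for $\alpha\ne\beta$) and both moment maps $f\mapsto f=fT_0$. There are canonical isomorphisms $A\simeq A\widetilde\otimes D_{\mathfrak h}\simeq D_{\mathfrak h}\widetilde\otimes A$, $x\simeq x\otimes T_{-\beta}\simeq T_{-\alpha}\otimes x$, $x\in A_{\alpha\beta}$. An $\mathfrak h$-coalgebroid is an $\mathfrak h$-prealgebra with prealgebra homomorphisms $\Delta:A\to A\widetilde\otimes A$ and $\varepsilon:A\to D_{\mathfrak h}$ satisfying coassociativity and $(\varepsilon\otimes\mathrm{id})\Delta=(\mathrm{id}\otimes\varepsilon)\Delta=\mathrm{id}$ under the canonical identifications. An $\mathfrak h$-bialgebroid is an $\mathfrak h$-algebra and $\mathfrak h$-coalgebroid with $\Delta,\varepsilon$ $\mathfrak h$-algebra homomorphisms (product on $A\widetilde\otimes A$: $(a\otimes b)(c\otimes d)=ac\otimes bd$). Opposite. $A^{\mathrm{cop}}$ equals $A$ as an associative algebra, with $A^{\mathrm{cop}}_{\alpha\beta}=A_{\beta\alpha}$, $\mu_l^{A^{\mathrm{cop}}}=\mu_r^A$, $\mu_r^{A^{\mathrm{cop}}}=\mu_l^A$,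 $\Delta^{A^{\mathrm{cop}}}=\sigma\circ\Delta^A$ with $\sigma(x\otimes y)=y\otimes x$, $\varepsilon^{A^{\mathrm{cop}}}=\varepsilon^A$. Pairing. A pairing of $\mathfrak h$-bialgebroids $A,B$ is a $\mathbb C$-bilinear map $\langle\cdot,\cdot\rangle:A\times B\to D_{\mathfrak h}$ with $\langle A_{\alpha\beta},B_{\gamma\delta}\rangle\subseteq(D_{\mathfrak h})_{\alpha+\delta,\beta+\gamma}$; $\langle\mu_l(f)a,b\rangle=\langle a,\mu_l(f)b\rangle=f\circ\langle a,b\rangle$; $\langle a\mu_r(f),b\rangle=\langle a,b\mu_r(f)\rangle=\langle a,b\rangle\circ f$; $\langle ab,c\rangle=\sum_i\langle a,c_i'\rangle T_{\beta_i}\langle b,c_i''\rangle$ if $\Delta(c)=\sum_ic_i'\otimes c_i''$, $c_i''\in B_{\beta_i\gamma}$; $\langle a,bc\rangle=\sum_i\langle a_i',b\rangle T_{\beta_i}\langle a_i'',c\rangle$ if $\Delta(a)=\sum_ia_i'\otimes a_i''$, $a_i''\in A_{\beta_i\gamma}$; $\langle a,1\rangle=\varepsilon(a)$, $\langle1,b\rangle=\varepsilon(b)$. Cobraiding. A cobraiding on an $\mathfrak h$-bialgebroid $A$ is a pairing on $A^{\mathrm{cop}}\times A$ such that for all $a,b\in A$, with $\Delta^A(a)=\sum_ia_i'\otimes a_i''$, $\Delta^A(b)=\sum_jb_j'\otimes b_j''$, $$\sum_{ij}\mu_l(\langle a_i',b_j'\rangle1)\,a_i''b_j''=\sum_{ij}\mu_r(\langle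 a_i'',b_j''\rangle1)\,b_j'a_i',$$ where $\langle\cdot,\cdot\rangle1\in M_{\mathfrak h^*}$ is the action of the difference operator on the constant function $1$. The bialgebroid $A_R$. It is generated by $\{L_{xy}\}_{x,y\in X}$ and two copies of $M_{\mathfrak h^*}$ (elements written $f(\lambda)$ and $f(\mu)$), embedded as subalgebras, with relations $f(\lambda)L_{xy}=L_{xy}f(\lambda+\omega(x))$, $f(\mu)L_{xy}=L_{xy}f(\mu+\omega(y))$, $f(\lambda)g(\mu)=g(\mu)f(\lambda)$, and $$\sum_{xy}R_{ac}^{xy}(\lambda)L_{xb}L_{yd}=\sum_{xy}R_{xy}^{bd}(\mu)L_{cy}L_{ax},\qquad a,b,c,d\in X.$$ Bigrading: $L_{xy}\in A_{\omega(x),\omega(y)}$, $f(\lambda),f(\mu)\in A_{00}$; moment maps $\mu_l(f)=f(\lambda)$, $\mu_r(f)=f(\mu)$; $\Delta(L_{ab})=\sum_xL_{ax}\otimes L_{xb}$, $\Delta(f(\lambda))=f(\lambda)\otimes1$, $\Delta(f(\mu))=1\otimes f(\mu)$; $\varepsilon(L_{ab})=\delta_{ab}T_{-\omega(a)}$, $\varepsilon(f(\lambda))=\varepsilon(f(\mu))=f$. QDYB notation. Let $V$ be the complex vector space with basis $\{v_x\}_{x\in X}$, graded by $v_x\in V_{\omega(x)}$; $R$ is identified with the meromorphic function $R(\lambda)(v_a\otimes v_b)=\sum_{xy}R_{xy}^{ab}(\lambda)v_x\otimes v_y$ with values in weight-preserving endomorphisms of $V\otimes V$. In the equation (an identity of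 meromorphic functions with values in $\mathrm{End}(V\otimes V\otimes V)$) upper indices indicate tensor factors and $h^{(i)}$ the weight of the $i$-th factor, e.g. $R^{12}(\lambda-h^{(3)})(u\otimes v\otimes w)=(R(\lambda-\mu)(u\otimes v))\otimes w$ for $w\in V_\mu$. *)

(* Defs.v *)
From HB Require Import structures.
From mathcomp Require Import all_boot all_order all_algebra.
From mathcomp Require Import complex.
From mathcomp Require Import boolp classical_sets functions reals topology.
From mathcomp Require Import normedtype derive.

Set Implicit Arguments.
Unset Strict Implicit.
Unset Printing Implicit Defensive.

Import Order.TTheory GRing.Theory Num.Theory.
Import numFieldNormedType.Exports.

Local Open Scope classical_set_scope.
Local Open Scope ring_scope.
Local Open Scope complex_scope.
Local Open Scope quotient_scope.

Section Meromorphic.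
Context {R : realType} (V : vectType R[i]).
Local Notation C := R[i].

(* V stands for the dual h^* throughout.
   A finite-dimensional space carries no topology in MathComp; openness,
   density and complex differentiability are read off in linear coordinates. *)
Definition coords : normedModType C := 'rV[C]_(\dim {:V}).

Definition of_coords (x : coords) : V :=
  \sum_(i < \dim {:V}) x 0 i *: (vbasis {:V})`_i.

Definition to_coords (v : V) : coords := \row_i coord (vbasis {:V}) i v.

Lemma of_coordsK : cancel of_coords to_coords.
Proof.
move=> x; apply/rowP => i; rewrite mxE.
by rewrite coord_sum_free //; exact: basis_free (vbasisP _).
Qed.

Lemma to_coordsK : cancel to_coords of_coords.
Proof.
move=> v; rewrite [RHS](coord_vbasis (memvf v)).
by apply: eq_bigr => i _; rewrite mxE.
Qed.

Lemma of_coordsD x y : of_coords (x + y) = of_coords x + of_coords y.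
Proof.
by rewrite -big_split; apply: eq_bigr => i _; rewrite /= mxE scalerDl.
Qed.

Definition vopen (U : set V) := open (of_coords @^-1` U).
Definition vdense (U : set V) := dense (of_coords @^-1` U).

Definition holomorphic_on (U : set V) (g : V -> C) :=
  forall x, U (of_coords x) ->
    differentiable (g \o of_coords : coords -> C^o) x.

(* Local quotients g / h with h not identically zero on any nonempty open
   subset; the values of f at zeros of h are irrelevant. *)
Definition meromorphic (f : V -> C) := forall v : V,
  exists (U : set V) (g h : V -> C),
    [/\ vopen U /\ U v, holomorphic_on U g, holomorphic_on U h,
        (forall W, vopen W -> W `<=` U -> W !=set0 ->
           exists w, W w /\ h w != 0)
      & forall w, U w -> h w != 0 -> f w = g w / h w].

Lemma vopenI U W : vopen U -> vopen W -> vopen (U `&` W).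
Proof. by move=> oU oW; rewrite /vopen preimage_setI; exact: openI. Qed.

Lemma vopenT : vopen setT.
Proof. by rewrite /vopen preimage_setT; exact: openT. Qed.

Lemma vdenseT : vdense setT.
Proof. by rewrite /vdense preimage_setT => O O0 _; rewrite setIT. Qed.

Lemma vdenseI U W : vopen U -> vdense U -> vdense W -> vdense (U `&` W).
Proof. by move=> oU dU dW; rewrite /vdense preimage_setI; exact: denseI. Qed.

Lemma of_coords_shift (W : set V) a :
  of_coords @^-1` [set v | W (v + a)] =
  (fun x => x + to_coords a) @^-1` (of_coords @^-1` W).
Proof. by apply/funext => x /=; rewrite of_coordsD to_coordsK. Qed.

Lemma continuous_translate (c : coords) : continuous (fun x : coords => x + c).
Proof. move=> x; apply: (@cvgD _ coords _ (nbhs x) _ id (cst c) x c).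
  exact: cvg_id.
exact: cvg_cst. Qed.

Lemma vopen_shift U a : vopen U -> vopen [set v | U (v + a)].
Proof.
rewrite /vopen of_coords_shift => oU.
by apply: open_comp oU => x _; exact: continuous_translate.
Qed.

Lemma vdense_shift U a : vdense U -> vdense [set v | U (v + a)].
Proof.
move=> dU O [x Ox] oO.
pose O' := (fun x : coords => x - to_coords a) @^-1` O.
have oO' : open O'.
  by apply: open_comp oO => y _; exact: continuous_translate.
have [|y [O'y Uy]] := dU O' _ oO'.
  by exists (x + to_coords a); rewrite /O' /= addrK.
exists (y - to_coords a); split => //=.
by rewrite -[X in _ + X]to_coordsK -of_coordsD subrK.
Qed.

Lemma holo_sub U W g : W `<=` U -> holomorphic_on U g -> holomorphic_on W g.
Proof. by move=> WU hg x /WU; exact: hg. Qed.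

Lemma holoD U g h : holomorphic_on U g -> holomorphic_on U h ->
  holomorphic_on U (fun v => g v + h v).
Proof. by move=> hg hh x Ux; exact: (differentiableD (hg x Ux) (hh x Ux)). Qed.

Lemma holoM U g h : holomorphic_on U g -> holomorphic_on U h ->
  holomorphic_on U (fun v => g v * h v).
Proof. by move=> hg hh x Ux; exact: (differentiableM (hg x Ux) (hh x Ux)). Qed.

Lemma holo_cst U c : holomorphic_on U (fun=> c).
Proof.
by move=> x _; exact: (@differentiable_cst _ coords C^o (c : C^o) x).
Qed.

Lemma holo_shift U g a : holomorphic_on U g ->
  holomorphic_on [set v | U (v + a)] (fun v => g (v + a)).
Proof.
move=> hg x Ux.
have -> : ((fun v => g (v + a)) \o of_coords : coords -> C^o) =
    (g \o of_coords : coords -> C^o) \o (id + cst (to_coords a)).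
  by apply/funext => y /=; rewrite of_coordsD to_coordsK.
have di : differentiable (id : coords -> coords) x.
  by apply: (@ex_diff C coords coords); exact: (@is_diff_id C coords).
have da := @differentiable_cst C coords coords (to_coords a) x.
apply: differentiable_comp; first exact: (differentiableD di da).
by apply: hg; move: Ux => /=; rewrite of_coordsD to_coordsK.
Qed.

Lemma vopen_neq0 W h : vopen W -> holomorphic_on W h ->
  vopen [set w | W w /\ h w != 0].
Proof.
move=> oW hh; rewrite /vopen openE => x [/= Wx hx].
have /differentiable_continuous cx := hh x Wx.
have n0 : nbhs ((h \o of_coords : coords -> C^o) x) [set z | z != 0].
  apply: open_nbhs_nbhs; split=> //=.
  rewrite (_ : [set z | z != 0] = ~` [set 0 : C^o]); last first.
    by apply/seteqP; split => z /= /eqP.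
  apply: closed_openC; apply: accessible_closed_set1.
  by apply: hausdorff_accessible; exact: norm_hausdorff.
have := cx _ n0; rewrite /= nbhs_filterE => hn0.
have Wn : nbhs x (of_coords @^-1` W) by exact: open_nbhs_nbhs.
by apply: filterS2 Wn hn0 => y.
Qed.
End Meromorphic.

Section MeromorphicRing.
Context {R : realType} (V : vectType R[i]).
Local Notation C := R[i].

Lemma mero_holo (g : V -> C) : holomorphic_on setT g -> meromorphic g.
Proof.
move=> hg v; exists [set: V], g, (fun=> 1 : C).
have oT : vopen [set: V] by exact: vopenT.
split; [by []|by []|exact: holo_cst| |].
- by move=> W _ _ [w Ww]; exists w; split=> //; exact: oner_neq0.
- by move=> w _ _; rewrite divr1.
Qed.

Lemma mero_cst (c : C) : meromorphic (fun _ : V => c).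
Proof. by apply: mero_holo; exact: holo_cst. Qed.

Lemma mero_den (U W : set V) (h k : V -> C) :
  vopen U -> holomorphic_on U h ->
  (forall Z, vopen Z -> Z `<=` U -> Z !=set0 -> exists w, Z w /\ h w != 0) ->
  (forall Z, vopen Z -> Z `<=` W -> Z !=set0 -> exists w, Z w /\ k w != 0) ->
  forall Z, vopen Z -> Z `<=` U `&` W -> Z !=set0 ->
    exists w, Z w /\ h w * k w != 0.
Proof.
move=> oU hh nh nk Z oZ ZUW Z0.
have ZU : Z `<=` U by move=> z /ZUW[].
have [w [Zw hw]] := nh _ oZ ZU Z0.
have [|||z [[Zz hz] kz]] := nk [set w | Z w /\ h w != 0].
- by apply: vopen_neq0 oZ _; exact: holo_sub hh.
- by move=> z [/ZUW[]].
- by exists w.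
by exists z; split=> //; rewrite mulf_neq0.
Qed.

Lemma meroD (f1 f2 : V -> C) : meromorphic f1 -> meromorphic f2 ->
  meromorphic (fun v => f1 v + f2 v).
Proof.
move=> m1 m2 v.
have [U1 [g1 [h1 [[o1 Uv1] hg1 hh1 n1 e1]]]] := m1 v.
have [U2 [g2 [h2 [[o2 Uv2] hg2 hh2 n2 e2]]]] := m2 v.
exists (U1 `&` U2), (fun v => g1 v * h2 v + g2 v * h1 v),
  (fun v => h1 v * h2 v).
have s1 : U1 `&` U2 `<=` U1 by move=> ? [].
have s2 : U1 `&` U2 `<=` U2 by move=> ? [].
split; [by split=> //; exact: vopenI| | | |].
- by apply: holoD; apply: holoM;
    do [exact: holo_sub hg1|exact: holo_sub hg2
       |exact: holo_sub hh1|exact: holo_sub hh2].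
- by apply: holoM; [exact: holo_sub hh1|exact: holo_sub hh2].
- exact: (mero_den o1 hh1 n1 n2).
- move=> w [U1w U2w]; rewrite mulf_eq0 negb_or => /andP[h1w h2w].
  by rewrite e1// e2// addf_div.
Qed.

Lemma meroM (f1 f2 : V -> C) : meromorphic f1 -> meromorphic f2 ->
  meromorphic (fun v => f1 v * f2 v).
Proof.
move=> m1 m2 v.
have [U1 [g1 [h1 [[o1 Uv1] hg1 hh1 n1 e1]]]] := m1 v.
have [U2 [g2 [h2 [[o2 Uv2] hg2 hh2 n2 e2]]]] := m2 v.
exists (U1 `&` U2), (fun v => g1 v * g2 v), (fun v => h1 v * h2 v).
have s1 : U1 `&` U2 `<=` U1 by move=> ? [].
have s2 : U1 `&` U2 `<=` U2 by move=> ? [].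
split; [by split=> //; exact: vopenI| | | |].
- by apply: holoM; [exact: holo_sub hg1|exact: holo_sub hg2].
- by apply: holoM; [exact: holo_sub hh1|exact: holo_sub hh2].
- exact: (mero_den o1 hh1 n1 n2).
- move=> w [U1w U2w]; rewrite mulf_eq0 negb_or => /andP[h1w h2w].
  by rewrite e1// e2// mulf_div.
Qed.

Lemma mero_shift (f : V -> C) a :
  meromorphic f -> meromorphic (fun v => f (v + a)).
Proof.
move=> m v; have [U [g [h [[oU Uv] hg hh n e]]]] := m (v + a).
exists [set v | U (v + a)], (fun v => g (v + a)), (fun v => h (v + a)).
split; [by split=> //; exact: vopen_shift| | | |].
- exact: holo_shift.
- exact: holo_shift.
- move=> W oW WU [w Ww].
  have [|||z [Wz hz]] := n [set v | W (v - a)].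
  + exact: (vopen_shift (a := - a)).
  + by move=> z /WU /=; rewrite subrK.
  + by exists (w + a); rewrite /= addrK.
  by exists (z - a); rewrite subrK.
- by move=> w Uw hw; exact: e.
Qed.

Record merofun := Merofun { merofun_val :> V -> C;
                            merofunP : meromorphic merofun_val }.
HB.instance Definition _ := gen_eqMixin merofun.
HB.instance Definition _ := gen_choiceMixin merofun.

(* Representatives are identified when they agree on a dense open set. *)
Definition mero_eq (f g : merofun) : bool :=
  `[< exists D : set V, [/\ vopen D, vdense D & forall v, D v -> f v = g v] >].

Lemma mero_eq_pt (f g : merofun) : (forall v, f v = g v) -> mero_eq f g.
Proof.
move=> fg; apply/asboolP; exists setT.
by split; [exact: vopenT|exact: vdenseT|].
Qed.

Lemma mero_eq_refl : reflexive mero_eq.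
Proof. by move=> f; exact: mero_eq_pt. Qed.

Lemma mero_eq_sym : symmetric mero_eq.
Proof.
by move=> f g; apply/asboolP/asboolP => -[D [oD dD fg]]; exists D;
  split=> // v /fg.
Qed.

Lemma mero_eq_app2 (op : C -> C -> C) (f f' g g' h h' : merofun) :
  (forall v, h v = op (f v) (g v)) -> (forall v, h' v = op (f' v) (g' v)) ->
  mero_eq f f' -> mero_eq g g' -> mero_eq h h'.
Proof.
move=> hE hE' /asboolP[D [oD dD e]] /asboolP[D' [oD' dD' e']].
apply/asboolP; exists (D `&` D').
split; [exact: vopenI|exact: vdenseI|].
by move=> v [Dv Dv']; rewrite hE hE' e// e'.
Qed.

Lemma mero_eq_trans : transitive mero_eq.
Proof.
move=> g f h /asboolP[D [oD dD e]] /asboolP[D' [oD' dD' e']].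
apply/asboolP; exists (D `&` D').
split; [exact: vopenI|exact: vdenseI|].
by move=> v [Dv Dv']; rewrite e// e'.
Qed.

Canonical mero_equiv := EquivRel mero_eq mero_eq_refl mero_eq_sym mero_eq_trans.

Definition mero := {eq_quot mero_equiv}.
HB.instance Definition _ := Choice.on mero.
HB.instance Definition _ := EqQuotient.on mero.

Definition merofun_cst c := Merofun (mero_cst c).
Definition merofun_add (f g : merofun) := Merofun (meroD (merofunP f) (merofunP g)).
Definition merofun_mul (f g : merofun) := Merofun (meroM (merofunP f) (merofunP g)).
Definition merofun_shift a (f : merofun) := Merofun (mero_shift a (merofunP f)).

Definition mero_const (c : C) : mero := \pi_mero (merofun_cst c).
Definition mero_add (f g : mero) : mero := \pi_mero (merofun_add (repr f) (repr g)).
Definition mero_mul (f g : mero) : mero := \pi_mero (merofun_mul (repr f) (repr g)).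
Definition mero_opp (f : mero) : mero := mero_mul (mero_const (-1)) f.
Definition mero_scale (c : C) (f : mero) : mero := mero_mul (mero_const c) f.

(* [mshift a f] is T_a f, i.e. the function v |-> f (v + a). *)
Definition mshift (a : V) (f : mero) : mero := \pi_mero (merofun_shift a (repr f)).

Lemma mero_addE f g : mero_add (\pi f) (\pi g) = \pi_mero (merofun_add f g).
Proof.
apply/eqmodP; apply: (@mero_eq_app2 +%R) => //; apply/eqmodP; exact: reprK.
Qed.

Lemma mero_mulE f g : mero_mul (\pi f) (\pi g) = \pi_mero (merofun_mul f g).
Proof.
apply/eqmodP; apply: (@mero_eq_app2 *%R) => //; apply/eqmodP; exact: reprK.
Qed.

Lemma mshiftE a f : mshift a (\pi f) = \pi_mero (merofun_shift a f).
Proof.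
apply/eqmodP; have /eqmodP/asboolP[D [oD dD e]] := reprK (\pi_mero f).
apply/asboolP; exists [set v | D (v + a)].
by split; [exact: vopen_shift|exact: vdense_shift|move=> v; exact: e].
Qed.

Lemma meroP (P : mero -> Prop) : (forall f, P (\pi f)) -> forall f, P f.
Proof. by move=> H f; rewrite -[f]reprK. Qed.

Local Ltac mero_ext := apply/eqmodP; apply: mero_eq_pt => v /=.

Lemma mero_addA : associative mero_add.
Proof.
elim/meroP=> f; elim/meroP=> g; elim/meroP=> h; rewrite !mero_addE.
by mero_ext; rewrite addrA.
Qed.

Lemma mero_addC : commutative mero_add.
Proof.
by elim/meroP=> f; elim/meroP=> g; rewrite !mero_addE; mero_ext; rewrite addrC.
Qed.

Lemma mero_add0 : left_id (mero_const 0) mero_add.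
Proof. by elim/meroP=> f; rewrite mero_addE; mero_ext; rewrite add0r. Qed.

Lemma mero_addN : left_inverse (mero_const 0) mero_opp mero_add.
Proof.
elim/meroP=> f; rewrite /mero_opp mero_mulE mero_addE.
by mero_ext; rewrite mulN1r addNr.
Qed.

HB.instance Definition _ :=
  GRing.isZmodule.Build mero mero_addA mero_addC mero_add0 mero_addN.

Lemma mero_mulA : associative mero_mul.
Proof.
elim/meroP=> f; elim/meroP=> g; elim/meroP=> h; rewrite !mero_mulE.
by mero_ext; rewrite mulrA.
Qed.

Lemma mero_mulC : commutative mero_mul.
Proof.
by elim/meroP=> f; elim/meroP=> g; rewrite !mero_mulE; mero_ext; rewrite mulrC.
Qed.

Lemma mero_mul1 : left_id (mero_const 1) mero_mul.
Proof. by elim/meroP=> f; rewrite mero_mulE; mero_ext; rewrite mul1r. Qed.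

Lemma mero_mulDl : left_distributive mero_mul mero_add.
Proof.
elim/meroP=> f; elim/meroP=> g; elim/meroP=> h.
by rewrite mero_addE !mero_mulE mero_addE; mero_ext; rewrite mulrDl.
Qed.

Lemma mero_1neq0 : mero_const 1 != 0 :> mero.
Proof.
apply/eqP => /eqmodP/asboolP[D [oD dD e]].
have [||x [_ Dx]] := dD setT; [by exists 0|exact: openT|].
by have /eqP := e _ Dx; rewrite oner_eq0.
Qed.

HB.instance Definition _ := GRing.Zmodule_isComNzRing.Build mero
  mero_mulA mero_mulC mero_mul1 mero_mulDl mero_1neq0.

Lemma mero_cstM a b : mero_const (a * b) = mero_const a * mero_const b.
Proof. by rewrite /GRing.mul /= mero_mulE; mero_ext. Qed.

Lemma mero_cstD a b : mero_const (a + b) = mero_const a + mero_const b.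
Proof. by rewrite /GRing.add /= mero_addE; mero_ext. Qed.

Lemma mero_scaleA a b f : mero_scale a (mero_scale b f) = mero_scale (a * b) f.
Proof. by rewrite /mero_scale mero_cstM mero_mulA. Qed.

Lemma mero_scale1 : left_id 1 mero_scale.
Proof. exact: mero_mul1. Qed.

Lemma mero_scaleDr : right_distributive mero_scale +%R.
Proof. by move=> c f g; exact: (mulrDr (mero_const c)). Qed.

Lemma mero_scaleDl f : {morph mero_scale^~ f : a b / a + b}.
Proof. by move=> a b; rewrite /mero_scale mero_cstD; exact: mulrDl. Qed.

HB.instance Definition _ := GRing.Zmodule_isLmodule.Build C mero
  mero_scaleA mero_scale1 mero_scaleDr mero_scaleDl.

Lemma mero_scaleAl (c : C) (f g : mero) : c *: (f * g) = (c *: f) * g.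
Proof. exact: (mulrA (mero_const c)). Qed.

HB.instance Definition _ := GRing.Lmodule_isLalgebra.Build C mero mero_scaleAl.
HB.instance Definition _ := GRing.Lalgebra_isComAlgebra.Build C mero.

Lemma mero_piD f g : \pi_mero f + \pi_mero g = \pi_mero (merofun_add f g).
Proof. exact: mero_addE. Qed.

Lemma mero_piM f g : \pi_mero f * \pi_mero g = \pi_mero (merofun_mul f g).
Proof. exact: mero_mulE. Qed.

Lemma mshiftD a (f g : mero) : mshift a (f + g) = mshift a f + mshift a g.
Proof.
move: f g; elim/meroP=> f; elim/meroP=> g.
by rewrite mero_piD !mshiftE mero_piD; mero_ext.
Qed.

Lemma mshiftM a (f g : mero) : mshift a (f * g) = mshift a f * mshift a g.
Proof.
move: f g; elim/meroP=> f; elim/meroP=> g.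
by rewrite mero_piM !mshiftE mero_piM; mero_ext.
Qed.

Lemma mshift_cst a c : mshift a (mero_const c) = mero_const c.
Proof. by rewrite mshiftE; mero_ext. Qed.

Lemma mshift1 a : mshift a 1 = 1.
Proof. exact: mshift_cst. Qed.

Lemma mshiftZ a c (f : mero) : mshift a (c *: f) = c *: mshift a f.
Proof.
by rewrite {1}/GRing.scale /= /mero_scale (mshiftM a (mero_const c)) mshift_cst.
Qed.

Lemma mshift_zero a : mshift a 0 = 0.
Proof. exact: (mshift_cst a 0). Qed.

Lemma mshift0 f : mshift 0 f = f.
Proof. by elim/meroP: f => f; rewrite mshiftE; mero_ext; rewrite addr0. Qed.

Lemma mshift_add a b f : mshift a (mshift b f) = mshift (a + b) f.
Proof. by elim/meroP: f => f; rewrite !mshiftE; mero_ext; rewrite addrA. Qed.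
End MeromorphicRing.

Section DifferenceOperators.
Context {R : realType} (V : vectType R[i]).
Local Notation C := R[i].
Local Notation M := (mero V).

Definition diffop (D : M -> M) := exists s : seq (M * V),
  D = fun g => \sum_(x <- s) x.1 * mshift x.2 g.

(* The algebra D_h, with composition as product. *)
Record Dh := DiffOp { Dh_fun :> M -> M; Dh_funP : diffop Dh_fun }.
HB.instance Definition _ := gen_eqMixin Dh.
HB.instance Definition _ := gen_choiceMixin Dh.

Lemma Dh_ext (D E : Dh) : (forall g, D g = E g) -> D = E.
Proof.
case: D E => [D hD] [E hE] /= DE; have eDE : D = E by apply/funext.
by subst E; congr DiffOp; exact: Prop_irrelevance.
Qed.

Lemma diffop_term (f : M) (a : V) : diffop (fun g => f * mshift a g).
Proof. by exists [:: (f, a)]; apply/funext => g; rewrite big_seq1. Qed.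

(* [Dterm f a] is f T_a. *)
Definition Dterm (f : M) (a : V) : Dh := DiffOp (diffop_term f a).

Lemma diffop_add (D E : Dh) : diffop (fun g => D g + E g).
Proof.
have [s Ds] := Dh_funP D; have [t Et] := Dh_funP E.
by exists (s ++ t); apply/funext => g; rewrite big_cat Ds Et.
Qed.

Lemma diffop_scale (c : C) (D : Dh) : diffop (fun g => c *: D g).
Proof.
have [s Ds] := Dh_funP D; exists [seq (c *: x.1, x.2) | x <- s].
apply/funext => g; rewrite Ds big_map scaler_sumr.
by apply: eq_bigr => x _; rewrite scalerAl.
Qed.

Lemma diffop_comp (D E : Dh) : diffop (fun g => D (E g)).
Proof.
have [s Ds] := Dh_funP D; have [t Et] := Dh_funP E.
exists [seq (x.1 * mshift x.2 y.1, x.2 + y.2) | x <- s, y <- t].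
apply/funext => g; rewrite Ds Et big_allpairs_dep.
apply: eq_bigr => x _; rewrite (big_morph _ (mshiftD x.2) (mshift_zero x.2)).
rewrite mulr_sumr; apply: eq_bigr => y _ /=.
by rewrite mshiftM mshift_add mulrA.
Qed.

Lemma DhB (D : Dh) :
  (forall g h, D (g + h) = D g + D h) /\ (forall c g, D (c *: g) = c *: D g).
Proof.
have [s ->] := Dh_funP D; split=> [g h|c g].
  by rewrite -big_split; apply: eq_bigr => x _; rewrite mshiftD mulrDr.
by rewrite scaler_sumr; apply: eq_bigr => x _; rewrite mshiftZ scalerAr.
Qed.

Definition Dh_add (D E : Dh) := DiffOp (diffop_add D E).
Definition Dh_scale c (D : Dh) := DiffOp (diffop_scale c D).
Definition Dh_mul (D E : Dh) := DiffOp (diffop_comp D E).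
Definition Dh_opp := Dh_scale (-1).
Definition Dh_zero := Dterm 0 0.
Definition Dh_one := Dterm 1 0.

Lemma Dh_addA : associative Dh_add.
Proof. by move=> D E F; apply: Dh_ext => g /=; rewrite addrA. Qed.
Lemma Dh_addC : commutative Dh_add.
Proof. by move=> D E; apply: Dh_ext => g /=; rewrite addrC. Qed.
Lemma Dh_add0 : left_id Dh_zero Dh_add.
Proof. by move=> D; apply: Dh_ext => g /=; rewrite mul0r add0r. Qed.
Lemma Dh_addN : left_inverse Dh_zero Dh_opp Dh_add.
Proof.
by move=> D; apply: Dh_ext => g /=; rewrite mul0r scaleN1r addNr.
Qed.
HB.instance Definition _ :=
  GRing.isZmodule.Build Dh Dh_addA Dh_addC Dh_add0 Dh_addN.

Lemma Dh_mulA : associative Dh_mul.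
Proof. by move=> D E F; exact: Dh_ext. Qed.
Lemma Dh_mul1l : left_id Dh_one Dh_mul.
Proof. by move=> D; apply: Dh_ext => g /=; rewrite mul1r mshift0. Qed.
Lemma Dh_mul1r : right_id Dh_one Dh_mul.
Proof. by move=> D; apply: Dh_ext => g /=; rewrite mul1r mshift0. Qed.
Lemma Dh_mulDl : left_distributive Dh_mul +%R.
Proof. by move=> D E F; exact: Dh_ext. Qed.
Lemma Dh_mulDr : right_distributive Dh_mul +%R.
Proof. by move=> D E F; apply: Dh_ext => g /=; rewrite (DhB D).1. Qed.
Lemma Dh_1neq0 : Dh_one != 0.
Proof.
apply/eqP => /(congr1 (fun D : Dh => D 1)) /= /eqP.
by rewrite mul0r mul1r mshift1 oner_eq0.
Qed.
HB.instance Definition _ := GRing.Zmodule_isNzRing.Build Dh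
  Dh_mulA Dh_mul1l Dh_mul1r Dh_mulDl Dh_mulDr Dh_1neq0.

Lemma Dh_scaleA a b D : Dh_scale a (Dh_scale b D) = Dh_scale (a * b) D.
Proof. by apply: Dh_ext => g /=; rewrite scalerA. Qed.
Lemma Dh_scale1 : left_id 1 Dh_scale.
Proof. by move=> D; apply: Dh_ext => g /=; rewrite scale1r. Qed.
Lemma Dh_scaleDr : right_distributive Dh_scale +%R.
Proof. by move=> c D E; apply: Dh_ext => g /=; rewrite scalerDr. Qed.
Lemma Dh_scaleDl D : {morph Dh_scale^~ D : a b / a + b}.
Proof. by move=> a b; apply: Dh_ext => g /=; rewrite scalerDl. Qed.
HB.instance Definition _ := GRing.Zmodule_isLmodule.Build C Dh
  Dh_scaleA Dh_scale1 Dh_scaleDr Dh_scaleDl.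

Lemma Dh_scaleAl (c : C) (D E : Dh) : c *: (D * E) = (c *: D) * E.
Proof. exact: Dh_ext. Qed.
HB.instance Definition _ := GRing.Lmodule_isLalgebra.Build C Dh Dh_scaleAl.
Lemma Dh_scaleAr (c : C) (D E : Dh) : c *: (D * E) = D * (c *: E).
Proof. by apply: Dh_ext => g /=; rewrite (DhB D).2. Qed.
HB.instance Definition _ := GRing.Lalgebra_isAlgebra.Build C Dh Dh_scaleAr.

(* f T_{-b} has bidegree (b, b), and (D_h)_{a,b} = 0 when a <> b. *)
Definition Dh_deg (a b : V) (D : Dh) : Prop :=
  if a == b then exists f : M, D = Dterm f (- b) else D = 0.
End DifferenceOperators.

Section Prealgebras.
Context {R : realType} (V : vectType R[i]).
Local Notation C := R[i].
Local Notation M := (mero V).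

(* Bidegrees and moment maps of an h-prealgebra; [pa_deg a b x] reads
   "x lies in A_{a,b}".  These records and the ones below hold the structure
   maps only: tensor products, opposites, pairings and cobraidings depend on
   nothing else, and A_R is constructed explicitly from its presentation. *)
Record hprealg_data := HPrealgData {
  pa_car :> lmodType C;
  pa_deg : V -> V -> pa_car -> Prop;
  pa_ml : M -> pa_car -> pa_car;
  pa_mr : M -> pa_car -> pa_car }.

(* A pure tensor x (x) y with x in A_{a,c} and y in B_{c,b}. *)
Record hpair (A B : hprealg_data) := HPair {
  hp_l : V; hp_m : V; hp_r : V;
  hp_1 : A; hp_2 : B;
  hp_1P : pa_deg hp_l hp_m hp_1;
  hp_2P : pa_deg hp_m hp_r hp_2 }.

Section Tensor.
Variables A B : hprealg_data.

(* Equality of formal C-linear combinations of pure tensors in the matrix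
   tensor product of A and B. *)
Inductive tens_rel : seq (C * hpair A B) -> seq (C * hpair A B) -> Prop :=
| tens_refl s : tens_rel s s
| tens_sym s t : tens_rel s t -> tens_rel t s
| tens_trans s t u : tens_rel s t -> tens_rel t u -> tens_rel s u
| tens_cat s s' t t' :
    tens_rel s s' -> tens_rel t t' -> tens_rel (s ++ t) (s' ++ t')
| tens_catC s t : tens_rel (s ++ t) (t ++ s)
| tens_coef0 p : tens_rel [:: (0, p)] [::]
| tens_coefD c d p : tens_rel [:: (c + d, p)] [:: (c, p); (d, p)]
| tens_Dl k a c b x x' y hx hx' hxx' hy :
    tens_rel [:: (k, @HPair A B a c b (x + x') y hxx' hy)]
             [:: (k, @HPair A B a c b x y hx hy);
                 (k, @HPair A B a c b x' y hx' hy)]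
| tens_Dr k a c b x y y' hx hy hy' hyy' :
    tens_rel [:: (k, @HPair A B a c b x (y + y') hx hyy')]
             [:: (k, @HPair A B a c b x y hx hy);
                 (k, @HPair A B a c b x y' hx hy')]
| tens_Zl k z a c b x y hx hzx hy :
    tens_rel [:: (k, @HPair A B a c b (z *: x) y hzx hy)]
             [:: (k * z, @HPair A B a c b x y hx hy)]
| tens_Zr k z a c b x y hx hy hzy :
    tens_rel [:: (k, @HPair A B a c b x (z *: y) hx hzy)]
             [:: (k * z, @HPair A B a c b x y hx hy)]
| tens_M k f a c b x y hx hfx hy hfy :
    tens_rel [:: (k, @HPair A B a c b (pa_mr f x) y hfx hy)]
             [:: (k, @HPair A B a c b x (pa_ml f y) hx hfy)].

Definition tens_relb s t : bool := `[< tens_rel s t >].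

Lemma tens_relb_refl : reflexive tens_relb.
Proof. by move=> s; apply/asboolP; exact: tens_refl. Qed.
Lemma tens_relb_sym : symmetric tens_relb.
Proof. by move=> s t; apply/asboolP/asboolP; exact: tens_sym. Qed.
Lemma tens_relb_trans : transitive tens_relb.
Proof.
move=> t s u /asboolP st /asboolP tu; apply/asboolP.
exact: tens_trans st tu.
Qed.

Definition tens_formal := seq (C * hpair A B).
HB.instance Definition _ := gen_eqMixin tens_formal.
HB.instance Definition _ := gen_choiceMixin tens_formal.

Canonical tens_equiv := EquivRel (tens_relb : rel tens_formal)
  tens_relb_refl tens_relb_sym tens_relb_trans.

Definition tens := {eq_quot tens_equiv}.
HB.instance Definition _ := Choice.on tens.
HB.instance Definition _ := EqQuotient.on tens.

Lemma tens_piP (s t : tens_formal) : tens_rel s t <-> \pi_tens s = \pi_tens t.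
Proof.
split=> [st|/eqmodP/asboolP//].
by apply/eqmodP; apply/asboolP.
Qed.

Lemma tens_reprP (s : tens_formal) : tens_rel (repr (\pi_tens s)) s.
Proof. by apply/tens_piP; rewrite reprK. Qed.

Lemma tensP (P : tens -> Prop) : (forall s, P (\pi s)) -> forall t, P t.
Proof. by move=> H t; rewrite -[t]reprK. Qed.

Definition fscale (k : C) (s : tens_formal) : tens_formal :=
  [seq (k * p.1, p.2) | p <- s].

Lemma tens_rel_scale k s t :
  tens_rel s t -> tens_rel (fscale k s) (fscale k t).
Proof.
elim=> {s t} /=.
- by move=> s; exact: tens_refl.
- by move=> s t _; exact: tens_sym.
- by move=> s t u _ st _; exact: tens_trans.
- by move=> s s' t t' _ ss' _ tt'; rewrite /fscale !map_cat; exact: tens_cat.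
- by move=> s t; rewrite /fscale !map_cat; exact: tens_catC.
- by move=> p; rewrite mulr0; exact: tens_coef0.
- by move=> c d p; rewrite mulrDr; exact: tens_coefD.
- by move=> *; exact: tens_Dl.
- by move=> *; exact: tens_Dr.
- by move=> *; rewrite mulrA; exact: tens_Zl.
- by move=> *; rewrite mulrA; exact: tens_Zr.
- by move=> *; exact: tens_M.
Qed.

Definition tens_add (s t : tens) : tens := \pi_tens (repr s ++ repr t).
Definition tens_scale (k : C) (s : tens) : tens := \pi_tens (fscale k (repr s)).
Definition tens_zero : tens := \pi_tens [::].

Lemma tens_addE s t : tens_add (\pi s) (\pi t) = \pi_tens (s ++ t).
Proof. by apply/tens_piP; apply: tens_cat; exact: tens_reprP. Qed.

Lemma tens_scaleE k s : tens_scale k (\pi s) = \pi_tens (fscale k s).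
Proof. by apply/tens_piP; apply: tens_rel_scale; exact: tens_reprP. Qed.

Lemma tens_addA : associative tens_add.
Proof.
by elim/tensP=> s; elim/tensP=> t; elim/tensP=> u; rewrite !tens_addE catA.
Qed.

Lemma tens_addC : commutative tens_add.
Proof.
elim/tensP=> s; elim/tensP=> t; rewrite !tens_addE.
by apply/tens_piP; exact: tens_catC.
Qed.

Lemma tens_add0 : left_id tens_zero tens_add.
Proof. by elim/tensP=> s; rewrite /tens_zero tens_addE. Qed.

Lemma fscaleD a b s : tens_rel (fscale (a + b) s) (fscale a s ++ fscale b s).
Proof.
elim: s => [|[k p] s IH]; first exact: tens_refl.
have e : tens_rel [:: ((a + b) * k, p)] [:: (a * k, p); (b * k, p)].
  by rewrite mulrDl; exact: tens_coefD.
apply: tens_trans (tens_cat e IH) _.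
have H := tens_cat (tens_catC [:: (b * k, p)] (fscale a s))
  (tens_refl (fscale b s)).
have := tens_cat (tens_refl [:: (a * k, p)]) H.
by rewrite -!catA /=.
Qed.

Lemma fscale0 s : tens_rel (fscale 0 s) [::].
Proof.
elim: s => [|[k p] s IH]; first exact: tens_refl.
by rewrite /= mul0r; exact: (tens_cat (tens_coef0 p) IH).
Qed.

Lemma fscale1 s : fscale 1 s = s.
Proof. by rewrite -[RHS]map_id; apply: eq_map => -[k p]; rewrite /= mul1r. Qed.

Lemma tens_addN : left_inverse tens_zero (tens_scale (-1)) tens_add.
Proof.
elim/tensP=> s; rewrite tens_scaleE tens_addE -[X in _ ++ X]fscale1.
apply/tens_piP; apply: tens_trans (tens_sym (fscaleD _ _ s)) _.
by rewrite addNr; exact: fscale0.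
Qed.

HB.instance Definition _ :=
  GRing.isZmodule.Build tens tens_addA tens_addC tens_add0 tens_addN.

Lemma tens_scaleA a b t : tens_scale a (tens_scale b t) = tens_scale (a * b) t.
Proof.
elim/tensP: t => s; rewrite !tens_scaleE /fscale -map_comp.
by congr (\pi_tens _); apply: eq_map => -[k p]; rewrite /= mulrA.
Qed.

Lemma tens_scale1 : left_id 1 tens_scale.
Proof. by elim/tensP=> s; rewrite tens_scaleE fscale1. Qed.

Lemma tens_scaleDr : right_distributive tens_scale +%R.
Proof.
move=> k; elim/tensP=> s; elim/tensP=> t.
by rewrite /GRing.add /= tens_addE !tens_scaleE tens_addE /fscale map_cat.
Qed.

Lemma tens_scaleDl t : {morph tens_scale^~ t : a b / a + b}.
Proof.
elim/tensP: t => s a b; rewrite !tens_scaleE [RHS]tens_addE.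
by apply/tens_piP; exact: fscaleD.
Qed.

HB.instance Definition _ := GRing.Zmodule_isLmodule.Build C tens
  tens_scaleA tens_scale1 tens_scaleDr tens_scaleDl.

Definition pure (p : hpair A B) : tens := \pi_tens [:: (1, p)].

Lemma tens_piE (s : tens_formal) : \pi_tens s = \sum_(p <- s) p.1 *: pure p.2.
Proof.
elim: s => [|[k p] s IH]; first by rewrite big_nil.
rewrite big_cons -IH /= [k *: _]tens_scaleE [RHS]tens_addE /=.
by rewrite mulr1.
Qed.

Definition balanced (W : lmodType C) (phi : hpair A B -> W) : Prop :=
  [/\ forall a c b x x' y hx hx' hxx' hy,
        phi (@HPair A B a c b (x + x') y hxx' hy) =
        phi (@HPair A B a c b x y hx hy) + phi (@HPair A B a c b x' y hx' hy),
      forall a c b x y y' hx hy hy' hyy',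
        phi (@HPair A B a c b x (y + y') hx hyy') =
        phi (@HPair A B a c b x y hx hy) + phi (@HPair A B a c b x y' hx hy'),
      forall z a c b x y hx hzx hy,
        phi (@HPair A B a c b (z *: x) y hzx hy) =
        z *: phi (@HPair A B a c b x y hx hy),
      forall z a c b x y hx hy hzy,
        phi (@HPair A B a c b x (z *: y) hx hzy) =
        z *: phi (@HPair A B a c b x y hx hy)
    & forall f a c b x y hx hfx hy hfy,
        phi (@HPair A B a c b (pa_mr f x) y hfx hy) =
        phi (@HPair A B a c b x (pa_ml f y) hx hfy)].

Definition tlift (W : lmodType C) (phi : hpair A B -> W) (t : tens) : W :=
  \sum_(p <- repr t) p.1 *: phi p.2.

Lemma tlift_rel (W : lmodType C) (phi : hpair A B -> W) s t :
  balanced phi -> tens_rel s t ->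
  \sum_(p <- s) p.1 *: phi p.2 = \sum_(p <- t) p.1 *: phi p.2.
Proof.
move=> [Dl Dr Zl Zr Mlr]; elim=> {s t} //=.
- by move=> s t u _ -> _ ->.
- by move=> s s' t t' _ e _ e'; rewrite !big_cat /= e e'.
- by move=> s t; rewrite !big_cat /= addrC.
- by move=> p; rewrite big_seq1 big_nil scale0r.
- by move=> c d p; rewrite big_seq1 big_cons big_seq1 scalerDl.
- by move=> *; rewrite big_seq1 big_cons big_seq1 -scalerDr -Dl.
- by move=> *; rewrite big_seq1 big_cons big_seq1 -scalerDr -Dr.
- by move=> *; rewrite !big_seq1 /= -scalerA; congr (_ *: _); exact: Zl.
- by move=> *; rewrite !big_seq1 /= -scalerA; congr (_ *: _); exact: Zr.
- by move=> *; rewrite !big_seq1; congr (_ *: _); exact: Mlr.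
Qed.

Lemma tlift_funD (W : lmodType C) (chi phi psi : hpair A B -> W) t :
  (forall p, chi p = phi p + psi p) -> tlift chi t = tlift phi t + tlift psi t.
Proof.
by move=> e; rewrite -big_split; apply: eq_bigr => p _; rewrite e scalerDr.
Qed.

Lemma tlift_funZ (W : lmodType C) k (chi phi : hpair A B -> W) t :
  (forall p, chi p = k *: phi p) -> tlift chi t = k *: tlift phi t.
Proof.
move=> e; rewrite scaler_sumr; apply: eq_bigr => p _.
by rewrite e !scalerA mulrC.
Qed.

Lemma tlift_pi (W : lmodType C) (phi : hpair A B -> W) s :
  balanced phi -> tlift phi (\pi s) = \sum_(p <- s) p.1 *: phi p.2.
Proof. by move=> bphi; apply: tlift_rel => //; exact: tens_reprP. Qed.

Lemma tlift_pure (W : lmodType C) (phi : hpair A B -> W) p :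
  balanced phi -> tlift phi (pure p) = phi p.
Proof. by move=> bphi; rewrite tlift_pi// big_seq1 scale1r. Qed.

Lemma tliftD (W : lmodType C) (phi : hpair A B -> W) s t :
  balanced phi -> tlift phi (s + t) = tlift phi s + tlift phi t.
Proof.
move=> bphi; elim/tensP: s => s; elim/tensP: t => t.
by rewrite {1}/GRing.add /= tens_addE !tlift_pi// big_cat.
Qed.

Lemma tliftZ (W : lmodType C) (phi : hpair A B -> W) k t :
  balanced phi -> tlift phi (k *: t) = k *: tlift phi t.
Proof.
move=> bphi; elim/tensP: t => t.
rewrite {1}/GRing.scale /= tens_scaleE !tlift_pi// big_map scaler_sumr.
by apply: eq_bigr => p _; rewrite scalerA.
Qed.

Lemma pure_balanced : balanced pure.
Proof.
split.
- by move=> *; rewrite [RHS]tens_addE; apply/tens_piP; exact: tens_Dl.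
- by move=> *; rewrite [RHS]tens_addE; apply/tens_piP; exact: tens_Dr.
- move=> z a c b x y hx hzx hy; rewrite [RHS]tens_scaleE; apply/tens_piP.
  by have := tens_Zl 1 hx hzx hy; rewrite mulrC.
- move=> z a c b x y hx hy hzy; rewrite [RHS]tens_scaleE; apply/tens_piP.
  by have := tens_Zr 1 hx hy hzy; rewrite mulrC.
- by move=> *; apply/tens_piP; exact: tens_M.
Qed.
End Tensor.
End Prealgebras.

Section Bialgebroids.
Context {R : realType} (V : vectType R[i]).
Local Notation C := R[i].
Local Notation M := (mero V).

(* Here the moment maps are viewed as maps M -> A_{00}. *)
Record halg_data := HAlgData {
  ha_alg :> algType C;
  ha_deg : V -> V -> ha_alg -> Prop;
  ha_ml : M -> ha_alg;
  ha_mr : M -> ha_alg }.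

Definition halg_pre (A : halg_data) : hprealg_data V :=
  HPrealgData (@ha_deg A) (fun f x => ha_ml A f * x) (fun f x => ha_mr A f * x).

Local Notation "A ⊗ B" := (tens (halg_pre A) (halg_pre B))
  (at level 40, left associativity).

Record hbialg_data := HBialgData {
  hb_alg :> halg_data;
  hb_Delta : hb_alg -> hb_alg ⊗ hb_alg;
  hb_eps : hb_alg -> Dh V }.

Definition halg_cop (A : halg_data) : halg_data :=
  @HAlgData (ha_alg A) (fun a b => @ha_deg A b a) (ha_mr A) (ha_ml A).

Section Flip.
Variables A B : halg_data.

Definition hpair_flip (p : hpair (halg_pre A) (halg_pre B)) :
    hpair (halg_pre (halg_cop B)) (halg_pre (halg_cop A)) :=
  @HPair _ _ (halg_pre (halg_cop B)) (halg_pre (halg_cop A))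
    (hp_r p) (hp_m p) (hp_l p) (hp_2 p) (hp_1 p) (hp_2P p) (hp_1P p).

(* The map x (x) y |-> y (x) x; see [flip_pure]. *)
Definition flip : A ⊗ B -> halg_cop B ⊗ halg_cop A :=
  tlift (fun p => pure (hpair_flip p)).

Lemma flip_balanced : balanced (fun p => pure (hpair_flip p)).
Proof.
have [Dl Dr Zl Zr Mlr] :=
  pure_balanced (halg_pre (halg_cop B)) (halg_pre (halg_cop A)).
split=> *; [exact: Dr|exact: Dl|exact: Zr|exact: Zl|].
by symmetry; exact: Mlr.
Qed.

Lemma flip_pure p : flip (pure p) = pure (hpair_flip p).
Proof. exact/tlift_pure/flip_balanced. Qed.

Lemma flipD s t : flip (s + t) = flip s + flip t.
Proof. exact/tliftD/flip_balanced. Qed.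

Lemma flipZ k t : flip (k *: t) = k *: flip t.
Proof. exact/tliftZ/flip_balanced. Qed.
End Flip.

Definition hb_cop (A : hbialg_data) : hbialg_data :=
  @HBialgData (halg_cop A) (fun x => flip (hb_Delta x)) (@hb_eps A).

(* An equation Delta(c) = sum_i c_i' (x) c_i'' is a list of pure tensors with
   sum Delta(c); [hp_m i] is the degree b_i with c_i'' in B_{b_i,g}. *)
Record is_pairing (A B : hbialg_data) (pg : A -> B -> Dh V) : Prop := {
  pairing_linl : forall k a a' b, pg (k *: a + a') b = k *: pg a b + pg a' b;
  pairing_linr : forall k a b b', pg a (k *: b + b') = k *: pg a b + pg a b';
  pairing_deg : forall al be ga de a b,
    ha_deg al be a -> ha_deg ga de b -> Dh_deg (al + de) (be + ga) (pg a b);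
  pairing_mll : forall f a b, pg (ha_ml A f * a) b = Dterm f 0 * pg a b;
  pairing_mlr : forall f a b, pg a (ha_ml B f * b) = Dterm f 0 * pg a b;
  pairing_mrl : forall f a b, pg (a * ha_mr A f) b = pg a b * Dterm f 0;
  pairing_mrr : forall f a b, pg a (b * ha_mr B f) = pg a b * Dterm f 0;
  pairing_mull : forall a b c s, hb_Delta c = \sum_(i <- s) pure i ->
    pg (a * b) c =
    \sum_(i <- s) pg a (hp_1 i) * Dterm 1 (hp_m i) * pg b (hp_2 i);
  pairing_mulr : forall a b c s, hb_Delta a = \sum_(i <- s) pure i ->
    pg a (b * c) =
    \sum_(i <- s) pg (hp_1 i) b * Dterm 1 (hp_m i) * pg (hp_2 i) c;
  pairing_1r : forall a, pg a 1 = hb_eps a;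
  pairing_1l : forall b, pg 1 b = hb_eps b }.

Definition is_cobraiding (A : hbialg_data) (pg : hb_cop A -> A -> Dh V) :=
  is_pairing pg /\
  forall (a b : A) s t,
    hb_Delta a = \sum_(i <- s) pure i -> hb_Delta b = \sum_(j <- t) pure j ->
    \sum_(i <- s) \sum_(j <- t)
      ha_ml A (pg (hp_1 i) (hp_1 j) 1) * (hp_2 i * hp_2 j) =
    \sum_(i <- s) \sum_(j <- t)
      ha_mr A (pg (hp_2 i) (hp_2 j) 1) * (hp_1 j * hp_1 i).
End Bialgebroids.

Section PresentedAlgebra.
Context {R : realType} (V : vectType R[i]) (X : finType) (w : X -> V).
Local Notation C := R[i].
Local Notation M := (mero V).
(* [Rm x y a b] is the entry with lower indices x, y and upper indices a, b. *)
Variable Rm : X -> X -> X -> X -> M.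

(* Noncommutative polynomials in the generators L_xy, f(lambda), f(mu). *)
Inductive ar_term :=
| TL of X & X
| Tl of M
| Tm of M
| T0
| T1
| Tadd of ar_term & ar_term
| Tmul of ar_term & ar_term
| Tscale of C & ar_term.

Local Notation Tsum F :=
  (\big[Tadd/T0]_(x : X) \big[Tadd/T0]_(y : X) F x y).

(* The least congruence for which the quotient is a unital associative
   C-algebra, [Tl] and [Tm] are unital C-algebra morphisms, and the last four
   constructors (the relations of A_R) hold. *)
Inductive ar_rel : ar_term -> ar_term -> Prop :=
| ar_refl t : ar_rel t t
| ar_sym t u : ar_rel t u -> ar_rel u t
| ar_trans t u v : ar_rel t u -> ar_rel u v -> ar_rel t v
| ar_add t t' u u' :
    ar_rel t t' -> ar_rel u u' -> ar_rel (Tadd t u) (Tadd t' u')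
| ar_mul t t' u u' :
    ar_rel t t' -> ar_rel u u' -> ar_rel (Tmul t u) (Tmul t' u')
| ar_scale k t t' : ar_rel t t' -> ar_rel (Tscale k t) (Tscale k t')
| ar_addA t u v : ar_rel (Tadd t (Tadd u v)) (Tadd (Tadd t u) v)
| ar_addC t u : ar_rel (Tadd t u) (Tadd u t)
| ar_add0 t : ar_rel (Tadd T0 t) t
| ar_scale0 t : ar_rel (Tscale 0 t) T0
| ar_scale1 t : ar_rel (Tscale 1 t) t
| ar_scaleA k l t : ar_rel (Tscale k (Tscale l t)) (Tscale (k * l) t)
| ar_scaleDl k l t :
    ar_rel (Tscale (k + l) t) (Tadd (Tscale k t) (Tscale l t))
| ar_scaleDr k t u :
    ar_rel (Tscale k (Tadd t u)) (Tadd (Tscale k t) (Tscale k u))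
| ar_mulA t u v : ar_rel (Tmul t (Tmul u v)) (Tmul (Tmul t u) v)
| ar_mul1l t : ar_rel (Tmul T1 t) t
| ar_mul1r t : ar_rel (Tmul t T1) t
| ar_mulDl t u v : ar_rel (Tmul (Tadd t u) v) (Tadd (Tmul t v) (Tmul u v))
| ar_mulDr t u v : ar_rel (Tmul t (Tadd u v)) (Tadd (Tmul t u) (Tmul t v))
| ar_scaleAl k t u : ar_rel (Tscale k (Tmul t u)) (Tmul (Tscale k t) u)
| ar_scaleAr k t u : ar_rel (Tscale k (Tmul t u)) (Tmul t (Tscale k u))
| ar_lD f g : ar_rel (Tl (f + g)) (Tadd (Tl f) (Tl g))
| ar_lM f g : ar_rel (Tl (f * g)) (Tmul (Tl f) (Tl g))
| ar_lZ k f : ar_rel (Tl (k *: f)) (Tscale k (Tl f))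
| ar_l1 : ar_rel (Tl 1) T1
| ar_mD f g : ar_rel (Tm (f + g)) (Tadd (Tm f) (Tm g))
| ar_mM f g : ar_rel (Tm (f * g)) (Tmul (Tm f) (Tm g))
| ar_mZ k f : ar_rel (Tm (k *: f)) (Tscale k (Tm f))
| ar_m1 : ar_rel (Tm 1) T1
| ar_lL f x y : ar_rel (Tmul (Tl f) (TL x y))
                       (Tmul (TL x y) (Tl (mshift (w x) f)))
| ar_mL f x y : ar_rel (Tmul (Tm f) (TL x y))
                       (Tmul (TL x y) (Tm (mshift (w y) f)))
| ar_lm f g : ar_rel (Tmul (Tl f) (Tm g)) (Tmul (Tm g) (Tl f))
| ar_RLL a b c d : ar_rel
    (Tsum (fun x y => Tmul (Tl (Rm a c x y)) (Tmul (TL x b) (TL y d))))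
    (Tsum (fun x y => Tmul (Tm (Rm x y b d)) (Tmul (TL c y) (TL a x)))).

HB.instance Definition _ := gen_eqMixin ar_term.
HB.instance Definition _ := gen_choiceMixin ar_term.

Definition ar_relb t u : bool := `[< ar_rel t u >].
Lemma ar_relb_refl : reflexive ar_relb.
Proof. by move=> t; apply/asboolP; exact: ar_refl. Qed.
Lemma ar_relb_sym : symmetric ar_relb.
Proof. by move=> t u; apply/asboolP/asboolP; exact: ar_sym. Qed.
Lemma ar_relb_trans : transitive ar_relb.
Proof.
by move=> u t v /asboolP tu /asboolP uv; apply/asboolP; exact: ar_trans uv.
Qed.
Canonical ar_equiv := EquivRel ar_relb ar_relb_refl ar_relb_sym ar_relb_trans.

Definition AR := {eq_quot ar_equiv}.
HB.instance Definition _ := Choice.on AR.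
HB.instance Definition _ := EqQuotient.on AR.

Lemma ar_piP t u : ar_rel t u <-> \pi_AR t = \pi_AR u.
Proof.
split=> [tu|/eqmodP/asboolP//].
by apply/eqmodP; apply/asboolP.
Qed.

Lemma ar_reprP t : ar_rel (repr (\pi_AR t)) t.
Proof. by apply/ar_piP; rewrite reprK. Qed.

Lemma arP (P : AR -> Prop) : (forall t, P (\pi t)) -> forall x, P x.
Proof. by move=> H x; rewrite -[x]reprK. Qed.

Definition AR_add (x y : AR) : AR := \pi_AR (Tadd (repr x) (repr y)).
Definition AR_mul (x y : AR) : AR := \pi_AR (Tmul (repr x) (repr y)).
Definition AR_scale k (x : AR) : AR := \pi_AR (Tscale k (repr x)).

Lemma AR_addE t u : AR_add (\pi t) (\pi u) = \pi_AR (Tadd t u).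
Proof. by apply/ar_piP; apply: ar_add; exact: ar_reprP. Qed.
Lemma AR_mulE t u : AR_mul (\pi t) (\pi u) = \pi_AR (Tmul t u).
Proof. by apply/ar_piP; apply: ar_mul; exact: ar_reprP. Qed.
Lemma AR_scaleE k t : AR_scale k (\pi t) = \pi_AR (Tscale k t).
Proof. by apply/ar_piP; apply: ar_scale; exact: ar_reprP. Qed.

Lemma AR_addA : associative AR_add.
Proof.
elim/arP=> t; elim/arP=> u; elim/arP=> v; rewrite !AR_addE.
by apply/ar_piP; exact: ar_addA.
Qed.
Lemma AR_addC : commutative AR_add.
Proof.
elim/arP=> t; elim/arP=> u; rewrite !AR_addE.
by apply/ar_piP; exact: ar_addC.
Qed.
Lemma AR_add0 : left_id (\pi_AR T0) AR_add.
Proof.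
by elim/arP=> t; rewrite AR_addE; apply/ar_piP; exact: ar_add0.
Qed.
Lemma AR_addN : left_inverse (\pi_AR T0) (AR_scale (-1)) AR_add.
Proof.
elim/arP=> t; rewrite AR_scaleE AR_addE; apply/ar_piP.
have e : ar_rel (Tscale (-1 + 1) t) T0 by rewrite addNr; exact: ar_scale0.
apply: ar_trans e; apply: ar_sym; apply: ar_trans (ar_scaleDl _ _ _) _.
by apply: ar_add; [exact: ar_refl|exact: ar_scale1].
Qed.
HB.instance Definition _ :=
  GRing.isZmodule.Build AR AR_addA AR_addC AR_add0 AR_addN.

Lemma AR_mulA : associative AR_mul.
Proof.
elim/arP=> t; elim/arP=> u; elim/arP=> v; rewrite !AR_mulE.
by apply/ar_piP; exact: ar_mulA.
Qed.
Lemma AR_mul1l : left_id (\pi_AR T1) AR_mul.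
Proof.
by elim/arP=> t; rewrite AR_mulE; apply/ar_piP; exact: ar_mul1l.
Qed.
Lemma AR_mul1r : right_id (\pi_AR T1) AR_mul.
Proof.
by elim/arP=> t; rewrite AR_mulE; apply/ar_piP; exact: ar_mul1r.
Qed.
Lemma AR_mulDl : left_distributive AR_mul AR_add.
Proof.
elim/arP=> t; elim/arP=> u; elim/arP=> v.
rewrite AR_addE !AR_mulE AR_addE.
by apply/ar_piP; exact: ar_mulDl.
Qed.
Lemma AR_mulDr : right_distributive AR_mul AR_add.
Proof.
elim/arP=> t; elim/arP=> u; elim/arP=> v.
rewrite AR_addE !AR_mulE AR_addE.
by apply/ar_piP; exact: ar_mulDr.
Qed.

(* L |-> 0, f(lambda), f(mu) |-> f shows that A_R is not the zero ring. *)
Fixpoint ar_aug (t : ar_term) : M :=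
  match t with
  | TL _ _ => 0
  | Tl f => f
  | Tm f => f
  | T0 => 0
  | T1 => 1
  | Tadd t u => ar_aug t + ar_aug u
  | Tmul t u => ar_aug t * ar_aug u
  | Tscale k t => k *: ar_aug t
  end.

Lemma ar_aug_rel t u : ar_rel t u -> ar_aug t = ar_aug u.
Proof.
have sum0 (F : X -> X -> ar_term) : (forall x y, ar_aug (F x y) = 0) ->
    ar_aug (Tsum F) = 0.
  move=> F0; elim/big_rec: _ => //= x t' _ ->; rewrite addr0.
  by elim/big_rec: _ => //= y t'' _ ->; rewrite F0 addr0.
elim=> {t u} //=.
- by move=> t u v _ -> _ ->.
- by move=> t t' u u' _ -> _ ->.
- by move=> t t' u u' _ -> _ ->.
- by move=> k t t' _ ->.
- by move=> *; rewrite addrA.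
- by move=> *; rewrite addrC.
- by move=> *; rewrite add0r.
- by move=> *; rewrite scale0r.
- by move=> *; rewrite scale1r.
- by move=> *; rewrite scalerA.
- by move=> *; rewrite scalerDl.
- by move=> *; rewrite scalerDr.
- by move=> *; rewrite mulrA.
- by move=> *; rewrite mul1r.
- by move=> *; rewrite mulr1.
- by move=> *; rewrite mulrDl.
- by move=> *; rewrite mulrDr.
- by move=> *; rewrite scalerAl.
- by move=> *; rewrite scalerAr.
- by move=> *; rewrite mulr0 mul0r.
- by move=> *; rewrite mulr0 mul0r.
- by move=> *; rewrite mulrC.
- by move=> *; rewrite !sum0 // => x y /=; rewrite !mulr0.
Qed.

Lemma AR_1neq0 : \pi_AR T1 != 0.
Proof.
apply/eqP => /ar_piP /ar_aug_rel /= /eqP; by rewrite oner_eq0.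
Qed.
HB.instance Definition _ := GRing.Zmodule_isNzRing.Build AR
  AR_mulA AR_mul1l AR_mul1r AR_mulDl AR_mulDr AR_1neq0.

Lemma AR_scaleA k l x : AR_scale k (AR_scale l x) = AR_scale (k * l) x.
Proof.
elim/arP: x => t; rewrite !AR_scaleE.
by apply/ar_piP; exact: ar_scaleA.
Qed.
Lemma AR_scale1 : left_id 1 AR_scale.
Proof.
by elim/arP=> t; rewrite AR_scaleE; apply/ar_piP; exact: ar_scale1.
Qed.
Lemma AR_scaleDr : right_distributive AR_scale AR_add.
Proof.
move=> k; elim/arP=> t; elim/arP=> u; rewrite AR_addE !AR_scaleE AR_addE.
by apply/ar_piP; exact: ar_scaleDr.
Qed.
Lemma AR_scaleDl x k l :
  AR_scale (k + l) x = AR_add (AR_scale k x) (AR_scale l x).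
Proof.
elim/arP: x => t; rewrite !AR_scaleE AR_addE.
by apply/ar_piP; exact: ar_scaleDl.
Qed.
HB.instance Definition _ := GRing.Zmodule_isLmodule.Build C AR
  AR_scaleA AR_scale1 AR_scaleDr AR_scaleDl.

Lemma AR_scaleAl k (x y : AR) : k *: (x * y) = (k *: x) * y.
Proof.
elim/arP: x => t; elim/arP: y => u.
rewrite /GRing.mul /GRing.scale /= AR_scaleE !AR_mulE AR_scaleE.
by apply/ar_piP; exact: ar_scaleAl.
Qed.
HB.instance Definition _ := GRing.Lmodule_isLalgebra.Build C AR AR_scaleAl.
Lemma AR_scaleAr k (x y : AR) : k *: (x * y) = x * (k *: y).
Proof.
elim/arP: x => t; elim/arP: y => u.
rewrite /GRing.mul /GRing.scale /= AR_scaleE !AR_mulE AR_scaleE.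
by apply/ar_piP; exact: ar_scaleAr.
Qed.
HB.instance Definition _ := GRing.Lalgebra_isAlgebra.Build C AR AR_scaleAr.
End PresentedAlgebra.

Arguments TL {R V X}. Arguments Tl {R V X}. Arguments Tm {R V X}.
Arguments T0 {R V X}. Arguments T1 {R V X}. Arguments Tadd {R V X}.
Arguments Tmul {R V X}. Arguments Tscale {R V X}.

Section AlgebraAR.
Context {R : realType} (V : vectType R[i]) (X : finType) (w : X -> V).
Local Notation C := R[i].
Local Notation M := (mero V).
Variable Rm : X -> X -> X -> X -> M.
Local Notation A := (AR w Rm).

Definition genL (x y : X) : A := \pi_A (TL x y).
Definition genl (f : M) : A := \pi_A (Tl f).
Definition genm (f : M) : A := \pi_A (Tm f).

Lemma AR_piD t u : \pi_A (Tadd t u) = \pi_A t + \pi_A u :> A.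
Proof. by symmetry; exact: AR_addE. Qed.
Lemma AR_piM t u : \pi_A (Tmul t u) = \pi_A t * \pi_A u :> A.
Proof. by symmetry; exact: AR_mulE. Qed.
Lemma AR_piZ k t : \pi_A (Tscale k t) = k *: \pi_A t :> A.
Proof. by symmetry; exact: AR_scaleE. Qed.
Lemma AR_pi0 : \pi_A T0 = 0 :> A. Proof. by []. Qed.
Lemma AR_pi1 : \pi_A T1 = 1 :> A. Proof. by []. Qed.

Lemma genlD f g : genl (f + g) = genl f + genl g.
Proof. by rewrite -AR_piD; apply/ar_piP; exact: ar_lD. Qed.
Lemma genlM f g : genl (f * g) = genl f * genl g.
Proof. by rewrite -AR_piM; apply/ar_piP; exact: ar_lM. Qed.
Lemma genlZ k f : genl (k *: f) = k *: genl f.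
Proof. by rewrite -AR_piZ; apply/ar_piP; exact: ar_lZ. Qed.
Lemma genl1 : genl 1 = 1.
Proof. by apply/ar_piP; exact: ar_l1. Qed.
Lemma genmD f g : genm (f + g) = genm f + genm g.
Proof. by rewrite -AR_piD; apply/ar_piP; exact: ar_mD. Qed.
Lemma genmM f g : genm (f * g) = genm f * genm g.
Proof. by rewrite -AR_piM; apply/ar_piP; exact: ar_mM. Qed.
Lemma genmZ k f : genm (k *: f) = k *: genm f.
Proof. by rewrite -AR_piZ; apply/ar_piP; exact: ar_mZ. Qed.
Lemma genm1 : genm 1 = 1.
Proof. by apply/ar_piP; exact: ar_m1. Qed.
Lemma genl0 : genl 0 = 0.
Proof. by rewrite -(scale0r 0) genlZ scale0r. Qed.
Lemma genm0 : genm 0 = 0.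
Proof. by rewrite -(scale0r 0) genmZ scale0r. Qed.

Lemma genl_L f x y : genl f * genL x y = genL x y * genl (mshift (w x) f).
Proof. by rewrite -!AR_piM; apply/ar_piP; exact: ar_lL. Qed.
Lemma genm_L f x y : genm f * genL x y = genL x y * genm (mshift (w y) f).
Proof. by rewrite -!AR_piM; apply/ar_piP; exact: ar_mL. Qed.
Lemma genl_m f g : genl f * genm g = genm g * genl f.
Proof. by rewrite -!AR_piM; apply/ar_piP; exact: ar_lm. Qed.

Lemma AR_RLL a b c d :
  \sum_x \sum_y genl (Rm a c x y) * (genL x b * genL y d) =
  \sum_x \sum_y genm (Rm x y b d) * (genL c y * genL a x).
Proof.
have piS (F : X -> X -> ar_term V X) :
  \pi_A (\big[Tadd/T0]_x \big[Tadd/T0]_y F x y) =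
  \sum_x \sum_y \pi_A (F x y) :> A.
  rewrite (big_morph _ AR_piD AR_pi0); apply: eq_bigr => x _.
  by rewrite (big_morph _ AR_piD AR_pi0).
have /ar_piP := ar_RLL w Rm a b c d.
rewrite !piS => e.
transitivity (\sum_x \sum_y
    \pi_A (Tmul (Tl (Rm a c x y)) (Tmul (TL x b) (TL y d))) : A).
  by apply: eq_bigr => x _; apply: eq_bigr => y _; rewrite !AR_piM.
by rewrite e; apply: eq_bigr => x _; apply: eq_bigr => y _; rewrite !AR_piM.
Qed.

Inductive AR_deg : V -> V -> A -> Prop :=
| AR_deg_L x y : AR_deg (w x) (w y) (genL x y)
| AR_deg_l f : AR_deg 0 0 (genl f)
| AR_deg_m f : AR_deg 0 0 (genm f)
| AR_deg_0 a b : AR_deg a b 0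
| AR_deg_lin a b k x y :
    AR_deg a b x -> AR_deg a b y -> AR_deg a b (k *: x + y)
| AR_deg_M a b c d x y :
    AR_deg a b x -> AR_deg c d y -> AR_deg (a + c) (b + d) (x * y).

Definition AR_halg : halg_data V := @HAlgData R V A AR_deg genl genm.

Lemma AR_deg_1 : AR_deg 0 0 1.
Proof. by rewrite -genl1; exact: AR_deg_l. Qed.
Lemma AR_deg_D a b x y : AR_deg a b x -> AR_deg a b y -> AR_deg a b (x + y).
Proof. by move=> hx hy; rewrite -[x]scale1r; exact: AR_deg_lin. Qed.
Lemma AR_deg_sum (I : Type) (s : seq I) (F : I -> A) a b :
  (forall i, AR_deg a b (F i)) -> AR_deg a b (\sum_(i <- s) F i).
Proof.
move=> hF; elim/big_rec: _ => [|i y _]; first exact: AR_deg_0.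
exact: AR_deg_D.
Qed.

Lemma genl_comm f a b x : AR_deg a b x -> genl f * x = x * genl (mshift a f).
Proof.
move=> hx; elim: hx f => {a b x}.
- by move=> x y f; exact: genl_L.
- by move=> f g; rewrite -!genlM mshift0 mulrC.
- by move=> f g; rewrite mshift0 genl_m.
- by move=> a b f; rewrite mulr0 mul0r.
- move=> a b k x y _ IHx _ IHy f.
  by rewrite mulrDr mulrDl -scalerAr IHx IHy scalerAl.
- move=> a b c d x y _ IHx _ IHy f.
  by rewrite mulrA IHx -mulrA IHy mulrA mshift_add addrC.
Qed.

Lemma genm_comm f a b x : AR_deg a b x -> genm f * x = x * genm (mshift b f).
Proof.
move=> hx; elim: hx f => {a b x}.
- by move=> x y f; exact: genm_L.
- by move=> f g; rewrite mshift0 genl_m.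
- by move=> f g; rewrite -!genmM mshift0 mulrC.
- by move=> a b f; rewrite mulr0 mul0r.
- move=> a b k x y _ IHx _ IHy f.
  by rewrite mulrDr mulrDl -scalerAr IHx IHy scalerAl.
- move=> a b c d x y _ IHx _ IHy f.
  by rewrite mulrA IHx -mulrA IHy mulrA mshift_add addrC.
Qed.

Local Notation P := (halg_pre AR_halg).
Local Notation AA := (tens P P).
Local Notation mkp a c b x y hx hy := (@HPair R V P P a c b x y hx hy).

(* (x (x) y) (x' (x) y') = x x' (x) y y'. *)
Definition hpair_mul (p q : hpair P P) : hpair P P :=
  mkp (hp_l p + hp_l q) (hp_m p + hp_m q) (hp_r p + hp_r q)
    (hp_1 p * hp_1 q : A) (hp_2 p * hp_2 q : A)
    (AR_deg_M (hp_1P p) (hp_1P q)) (AR_deg_M (hp_2P p) (hp_2P q)).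

Definition tmul (s t : AA) : AA :=
  tlift (fun p => tlift (fun q => pure (hpair_mul p q)) t) s.

Lemma pure_ext (p q : hpair P P) :
  hp_l p = hp_l q -> hp_m p = hp_m q -> hp_r p = hp_r q ->
  hp_1 p = hp_1 q -> hp_2 p = hp_2 q -> pure p = pure q.
Proof.
case: p q => [a c b x y hx hy] [a' c' b' x' y' hx' hy'] /= ? ? ? ? ?; subst.
by rewrite (Prop_irrelevance hx hx') (Prop_irrelevance hy hy').
Qed.

Lemma pure_0l (p : hpair P P) : hp_1 p = 0 -> pure p = 0.
Proof.
case: p => [a c b x y hx hy] /= x0; subst x.
have [_ _ Zl _ _] := pure_balanced P P.
have h0 : pa_deg a c ((0 : C) *: (0 : P)) by rewrite scale0r.
rewrite -(scale0r (pure (mkp a c b 0 y hx hy))) -(Zl 0 _ _ _ _ _ _ h0).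
by apply: pure_ext; rewrite /= ?scale0r.
Qed.

Lemma pure_0r (p : hpair P P) : hp_2 p = 0 -> pure p = 0.
Proof.
case: p => [a c b x y hx hy] /= y0; subst y.
have [_ _ _ Zr _] := pure_balanced P P.
have h0 : pa_deg c b ((0 : C) *: (0 : P)) by rewrite scale0r.
rewrite -(scale0r (pure (mkp a c b x 0 hx hy))) -(Zr 0 _ _ _ _ _ _ _ h0).
by apply: pure_ext; rewrite /= ?scale0r.
Qed.

Lemma pure_add_l (p q r : hpair P P) :
  hp_l p = hp_l q -> hp_m p = hp_m q -> hp_r p = hp_r q -> hp_2 p = hp_2 q ->
  hp_l p = hp_l r -> hp_m p = hp_m r -> hp_r p = hp_r r -> hp_2 p = hp_2 r ->
  hp_1 p = hp_1 q + hp_1 r -> pure p = pure q + pure r.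
Proof.
case: p q r => [a c b x y hx hy] [a1 c1 b1 x1 y1 hx1 hy1].
move=> [a2 c2 b2 x2 y2 hx2 hy2] /= ? ? ? ? ? ? ? ? ?; subst.
have [Dl _ _ _ _] := pure_balanced P P.
rewrite (Dl _ _ _ _ _ _ hx1 hx2 hx hy); congr (_ + _);
  exact: pure_ext.
Qed.

Lemma pure_add_r (p q r : hpair P P) :
  hp_l p = hp_l q -> hp_m p = hp_m q -> hp_r p = hp_r q -> hp_1 p = hp_1 q ->
  hp_l p = hp_l r -> hp_m p = hp_m r -> hp_r p = hp_r r -> hp_1 p = hp_1 r ->
  hp_2 p = hp_2 q + hp_2 r -> pure p = pure q + pure r.
Proof.
case: p q r => [a c b x y hx hy] [a1 c1 b1 x1 y1 hx1 hy1].
move=> [a2 c2 b2 x2 y2 hx2 hy2] /= ? ? ? ? ? ? ? ? ?; subst.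
have [_ Dr _ _ _] := pure_balanced P P.
rewrite (Dr _ _ _ _ _ _ hx hy1 hy2 hy); congr (_ + _);
  exact: pure_ext.
Qed.

Lemma pure_scale_l k (p q : hpair P P) :
  hp_l p = hp_l q -> hp_m p = hp_m q -> hp_r p = hp_r q -> hp_2 p = hp_2 q ->
  hp_1 p = k *: hp_1 q -> pure p = k *: pure q.
Proof.
case: p q => [a c b x y hx hy] [a1 c1 b1 x1 y1 hx1 hy1] /= ? ? ? ? ?; subst.
have [_ _ Zl _ _] := pure_balanced P P.
by rewrite -(Zl k _ _ _ _ _ _ hx); exact: pure_ext.
Qed.

Lemma pure_scale_r k (p q : hpair P P) :
  hp_l p = hp_l q -> hp_m p = hp_m q -> hp_r p = hp_r q -> hp_1 p = hp_1 q ->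
  hp_2 p = k *: hp_2 q -> pure p = k *: pure q.
Proof.
case: p q => [a c b x y hx hy] [a1 c1 b1 x1 y1 hx1 hy1] /= ? ? ? ? ?; subst.
have [_ _ _ Zr _] := pure_balanced P P.
by rewrite -(Zr k _ _ _ _ _ _ _ hy); exact: pure_ext.
Qed.

Lemma pure_bal f (p q : hpair P P) x y :
  hp_l p = hp_l q -> hp_m p = hp_m q -> hp_r p = hp_r q ->
  hp_1 p = genm f * x -> hp_2 p = y -> hp_1 q = x -> hp_2 q = genl f * y ->
  pure p = pure q.
Proof.
case: p q => [a c b x1 y1 hx hy] [a1 c1 b1 x2 y2 hx2 hy2] /= ? ? ? ? ? ? ?.
subst; have [_ _ _ _ Mlr] := pure_balanced P P.
exact: (Mlr f _ _ _ _ _ hx2 hx hy hy2).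
Qed.

Lemma hpair_mul_balr p : balanced (fun q => pure (hpair_mul p q)).
Proof.
split=> [*|*|*|*|f a c b x y hx hfx hy hfy].
- by apply: pure_add_l => //=; rewrite mulrDr.
- by apply: pure_add_r => //=; rewrite mulrDr.
- by apply: pure_scale_l => //=; rewrite scalerAr.
- by apply: pure_scale_r => //=; rewrite scalerAr.
- apply: (@pure_bal (mshift (- hp_m p) f) _ _ (hp_1 p * x) (hp_2 p * y)) => //=.
    rewrite !mulrA (genm_comm _ (hp_1P p)) mshift_add subrr mshift0.
    by rewrite -!mulrA.
  rewrite !mulrA (genl_comm _ (hp_2P p)) mshift_add subrr mshift0.
  by rewrite -!mulrA.
Qed.

Lemma hpair_mul_ball (t : AA) :
  balanced (fun p => tlift (fun q => pure (hpair_mul p q)) t).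
Proof.
move: t; apply: tensP => t; split=> [*|*|*|*|f a c b x y hx hfx hy hfy];
  rewrite !tlift_pi; try exact: hpair_mul_balr.
- rewrite -big_split; apply: eq_bigr => q _; rewrite /= -scalerDr.
  by congr (_ *: _); apply: pure_add_l => //=; rewrite mulrDl.
- rewrite -big_split; apply: eq_bigr => q _; rewrite /= -scalerDr.
  by congr (_ *: _); apply: pure_add_r => //=; rewrite mulrDl.
- rewrite scaler_sumr; apply: eq_bigr => q _.
  rewrite scalerA [_ * q.1]mulrC -scalerA.
  by congr (_ *: _); apply: pure_scale_l => //=; rewrite scalerAl.
- rewrite scaler_sumr; apply: eq_bigr => q _.
  rewrite scalerA [_ * q.1]mulrC -scalerA.
  by congr (_ *: _); apply: pure_scale_r => //=; rewrite scalerAl.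
- apply: eq_bigr => q _; congr (_ *: _).
  by apply: (@pure_bal f _ _ (x * hp_1 q.2) (y * hp_2 q.2)) => //=;
    rewrite mulrA.
Qed.

Lemma tmul_pure p q : tmul (pure p) (pure q) = pure (hpair_mul p q).
Proof.
rewrite /tmul tlift_pure; last exact: hpair_mul_ball.
by rewrite tlift_pure //; exact: hpair_mul_balr.
Qed.

Lemma tmulDl s t u : tmul (s + t) u = tmul s u + tmul t u.
Proof. by apply: tliftD; exact: hpair_mul_ball. Qed.
Lemma tmulZl k s t : tmul (k *: s) t = k *: tmul s t.
Proof. by apply: tliftZ; exact: hpair_mul_ball. Qed.

Lemma tmulDr s t u : tmul s (t + u) = tmul s t + tmul s u.
Proof.
by apply: tlift_funD => p; apply: tliftD; exact: hpair_mul_balr.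
Qed.
Lemma tmulZr k s t : tmul s (k *: t) = k *: tmul s t.
Proof. by apply: tlift_funZ => p; apply: tliftZ; exact: hpair_mul_balr. Qed.
Lemma tmul0l s : tmul 0 s = 0.
Proof. by rewrite -{1}(scale0r (0 : AA)) tmulZl scale0r. Qed.
Lemma tmul0r s : tmul s 0 = 0.
Proof. by rewrite -{1}(scale0r (0 : AA)) tmulZr scale0r. Qed.

Lemma tmul_suml (I : Type) (r : seq I) (F : I -> AA) s :
  tmul (\sum_(i <- r) F i) s = \sum_(i <- r) tmul (F i) s.
Proof. exact: (big_morph (tmul^~ s) (fun a b => tmulDl a b s) (tmul0l s)). Qed.
Lemma tmul_sumr (I : Type) (r : seq I) (F : I -> AA) s :
  tmul s (\sum_(i <- r) F i) = \sum_(i <- r) tmul s (F i).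
Proof. exact: (big_morph (tmul s) (tmulDr s) (tmul0r s)). Qed.

Lemma tens_ind (Q : AA -> Prop) :
  Q 0 -> (forall k p t, Q t -> Q (k *: pure p + t)) -> forall t, Q t.
Proof.
move=> Q0 QD; apply: tensP => s; rewrite tens_piE.
by elim: s => [|p s IH]; rewrite ?big_nil ?big_cons //; exact: QD.
Qed.

Lemma tmulA s t u : tmul s (tmul t u) = tmul (tmul s t) u.
Proof.
elim/tens_ind: s => [|k p s IH]; first by rewrite !tmul0l.
rewrite !tmulDl !tmulZl IH; congr (_ *: _ + _) => {s IH}.
elim/tens_ind: t => [|l q t IH]; first by rewrite !(tmul0l, tmul0r).
rewrite !(tmulDl, tmulDr) !(tmulZl, tmulZr) IH; congr (_ *: _ + _) => {t IH}.
elim/tens_ind: u => [|m r u IH]; first by rewrite !tmul0r.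
rewrite !tmulDr !tmulZr IH; congr (_ *: _ + _).
by rewrite !tmul_pure; apply: pure_ext; rewrite /= ?addrA ?mulrA.
Qed.

Definition pure11 : AA := pure (mkp 0 0 0 1 1 AR_deg_1 AR_deg_1).

Lemma tmul1l s : tmul pure11 s = s.
Proof.
elim/tens_ind: s => [|k p s IH]; first by rewrite tmul0r.
rewrite tmulDr tmulZr IH tmul_pure; congr (_ *: _ + _).
by apply: pure_ext; rewrite /= ?add0r ?mul1r.
Qed.

Lemma tmul1r s : tmul s pure11 = s.
Proof.
elim/tens_ind: s => [|k p s IH]; first by rewrite tmul0l.
rewrite tmulDl tmulZl IH tmul_pure; congr (_ *: _ + _).
by apply: pure_ext; rewrite /= ?addr0 ?mulr1.
Qed.

Fixpoint ar_Delta (t : ar_term V X) : AA :=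
  match t with
  | TL x y => \sum_z
      pure (mkp (w x) (w z) (w y) (genL x z) (genL z y)
                (AR_deg_L x z) (AR_deg_L z y))
  | Tl f => pure (mkp 0 0 0 (genl f) 1 (AR_deg_l f) AR_deg_1)
  | Tm f => pure (mkp 0 0 0 1 (genm f) AR_deg_1 (AR_deg_m f))
  | T0 => 0
  | T1 => pure11
  | Tadd t u => ar_Delta t + ar_Delta u
  | Tmul t u => tmul (ar_Delta t) (ar_Delta u)
  | Tscale k t => k *: ar_Delta t
  end.

Fixpoint ar_eps (t : ar_term V X) : Dh V :=
  match t with
  | TL x y => if x == y then Dterm 1 (- w x) else 0
  | Tl f => Dterm f 0
  | Tm f => Dterm f 0
  | T0 => 0
  | T1 => 1
  | Tadd t u => ar_eps t + ar_eps u
  | Tmul t u => ar_eps t * ar_eps u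
  | Tscale k t => k *: ar_eps t
  end.

(* When R preserves weights these are compatible with the defining relations:
   see [AR_Delta_pi] and [AR_eps_pi]. *)
Definition AR_Delta (x : A) : AA := ar_Delta (repr x).
Definition AR_eps (x : A) : Dh V := ar_eps (repr x).

Definition AR_bialg : hbialg_data V := @HBialgData R V AR_halg AR_Delta AR_eps.
End AlgebraAR.

Section AlgebraARTheory.
Context {R : realType} (V : vectType R[i]) (X : finType) (w : X -> V).
Local Notation C := R[i].
Local Notation M := (mero V).
Variable Rm : X -> X -> X -> X -> M.
Local Notation A := (AR w Rm).
Local Notation P := (halg_pre (AR_halg w Rm)).
Local Notation AA := (tens P P).

Hypothesis hR :
  forall x y a b, w x + w y <> w a + w b -> Rm x y a b = 0.

Lemma DtermM (f g : M) (a b : V) :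
  Dterm f a * Dterm g b = Dterm (f * mshift a g) (a + b).
Proof. by apply: Dh_ext => h /=; rewrite mshiftM mshift_add mulrA. Qed.

Lemma DtermD (f g : M) (a : V) : Dterm (f + g) a = Dterm f a + Dterm g a.
Proof. by apply: Dh_ext => h /=; rewrite mulrDl. Qed.

Lemma DtermZ k (f : M) (a : V) : Dterm (k *: f) a = k *: Dterm f a.
Proof. by apply: Dh_ext => h /=; rewrite scalerAl. Qed.

Lemma Dterm0 (a : V) : Dterm (0 : M) a = 0.
Proof. by apply: Dh_ext => h /=; rewrite !mul0r. Qed.

Lemma Tsum_morph (W : zmodType) (phi : ar_term V X -> W) F :
  phi T0 = 0 -> (forall t u, phi (Tadd t u) = phi t + phi u) ->
  phi (\big[Tadd/T0]_(x : X) \big[Tadd/T0]_(y : X) F x y) =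
  \sum_x \sum_y phi (F x y).
Proof.
move=> p0 pD; rewrite (big_morph phi pD p0); apply: eq_bigr => x _.
by rewrite (big_morph phi pD p0).
Qed.

Lemma ar_eps_rel t u : ar_rel w Rm t u -> ar_eps w t = ar_eps w u.
Proof.
elim=> {t u} //=.
- by move=> t u v _ -> _ ->.
- by move=> t t' u u' _ -> _ ->.
- by move=> t t' u u' _ -> _ ->.
- by move=> k t t' _ ->.
- by move=> *; rewrite addrA.
- by move=> *; rewrite addrC.
- by move=> *; rewrite add0r.
- by move=> *; rewrite scale0r.
- by move=> *; rewrite scale1r.
- by move=> *; rewrite scalerA.
- by move=> *; rewrite scalerDl.
- by move=> *; rewrite scalerDr.
- by move=> *; rewrite mulrA.
- by move=> *; rewrite mul1r.
- by move=> *; rewrite mulr1.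
- by move=> *; rewrite mulrDl.
- by move=> *; rewrite mulrDr.
- by move=> *; rewrite scalerAl.
- by move=> *; rewrite scalerAr.
- by move=> *; rewrite DtermD.
- by move=> *; rewrite DtermM mshift0 addr0.
- by move=> *; rewrite DtermZ.
- by move=> *; rewrite DtermD.
- by move=> *; rewrite DtermM mshift0 addr0.
- by move=> *; rewrite DtermZ.
- move=> f x y; case: ifP => _; last by rewrite mulr0 mul0r.
  rewrite !DtermM addr0 add0r mshift1 mulr1 mul1r mshift_add addNr mshift0.
  by [].
- move=> f x y; case: eqP => [->|_]; last by rewrite mulr0 mul0r.
  rewrite !DtermM addr0 add0r mshift1 mulr1 mul1r mshift_add addNr mshift0.
  by [].
- by move=> f g; rewrite !DtermM !mshift0 mulrC.
- move=> a b c d; rewrite !Tsum_morph //=.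
  rewrite (bigD1 b) //= [X in _ + X]big1 ?addr0; last first.
    move=> x /negbTE xb; rewrite big1 // => y _.
    by rewrite xb mul0r mulr0.
  rewrite (bigD1 d) //= [X in _ + X]big1 ?addr0; last first.
    by move=> y /negbTE yd; rewrite yd !mulr0.
  rewrite [RHS](bigD1 a) //= [X in _ = _ + X]big1 ?addr0; last first.
    move=> x /negbTE xa; rewrite big1 // => y _.
    by rewrite [a == x]eq_sym xa !mulr0.
  rewrite [RHS](bigD1 c) //= [X in _ = _ + X]big1 ?addr0; last first.
    by move=> y /negbTE yc; rewrite [c == y]eq_sym yc mul0r mulr0.
  rewrite !eqxx !DtermM !mshift1 !mulr1 !mshift1 !mulr1 !add0r -!opprD.
  case: (EM (w a + w c = w b + w d)) => [e|ne].
    by rewrite [w c + _]addrC e.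
  by rewrite hR // !Dterm0.
Qed.

Definition tp a c b (x y : A) : AA :=
  if pselect (AR_deg a c x) is left hx then
    if pselect (AR_deg c b y) is left hy then
      pure (@HPair R V P P a c b x y hx hy) else 0 else 0.

Lemma tpE a c b (x y : A) (hx : AR_deg a c x) (hy : AR_deg c b y) :
  pure (@HPair R V P P a c b x y hx hy) = tp a c b x y.
Proof.
rewrite /tp; case: pselect => // hx'; case: pselect => // hy'.
exact: pure_ext.
Qed.

Lemma tp0l a c b (y : A) : tp a c b 0 y = 0.
Proof.
rewrite /tp; case: pselect => // hx; case: pselect => // hy.
exact: pure_0l.
Qed.

Lemma tp0r a c b (x : A) : tp a c b x 0 = 0.
Proof.
rewrite /tp; case: pselect => // hx; case: pselect => // hy.
exact: pure_0r.
Qed.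

Lemma tp_suml (I : Type) (s : seq I) (F : I -> A) a c b y :
  (forall i, AR_deg a c (F i)) -> AR_deg c b y ->
  tp a c b (\sum_(i <- s) F i) y = \sum_(i <- s) tp a c b (F i) y.
Proof.
move=> hF hy; elim: s => [|i s IH]; first by rewrite !big_nil tp0l.
rewrite !big_cons -IH.
have hs := AR_deg_sum s hF; have hi := hF i.
rewrite -(tpE (AR_deg_D hi hs) hy) -(tpE hi hy) -(tpE hs hy).
exact: pure_add_l.
Qed.

Lemma tp_sumr (I : Type) (s : seq I) (F : I -> A) a c b x :
  (forall i, AR_deg c b (F i)) -> AR_deg a c x ->
  tp a c b x (\sum_(i <- s) F i) = \sum_(i <- s) tp a c b x (F i).
Proof.
move=> hF hx; elim: s => [|i s IH]; first by rewrite !big_nil tp0r.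
rewrite !big_cons -IH.
have hs := AR_deg_sum s hF; have hi := hF i.
rewrite -(tpE hx (AR_deg_D hi hs)) -(tpE hx hi) -(tpE hx hs).
exact: pure_add_r.
Qed.

Local Notation L := (genL w Rm).
Local Notation l := (genl w Rm).
Local Notation m := (genm w Rm).

Lemma deg_LL x y z t : AR_deg (w x + w z) (w y + w t) (L x y * L z t).
Proof. by apply: AR_deg_M; exact: AR_deg_L. Qed.

Lemma deg_lLL f x y z t :
  AR_deg (w x + w z) (w y + w t) (l f * (L x y * L z t)).
Proof.
rewrite -[X in AR_deg X]add0r -[X in AR_deg _ X]add0r.
by apply: AR_deg_M; [exact: AR_deg_l|exact: deg_LL].
Qed.

Lemma deg_mLL f x y z t :
  AR_deg (w x + w z) (w y + w t) (m f * (L x y * L z t)).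
Proof.
rewrite -[X in AR_deg X]add0r -[X in AR_deg _ X]add0r.
by apply: AR_deg_M; [exact: AR_deg_m|exact: deg_LL].
Qed.

(* A summand with coefficient R_{xy}^{uv} may be given the degree
   w x + w y or w u + w v. *)
Lemma deg_lR a c x y b d :
  AR_deg (w a + w c) (w b + w d) (l (Rm a c x y) * (L x b * L y d)).
Proof.
case: (EM (w a + w c = w x + w y)) => [->|ne]; first exact: deg_lLL.
by rewrite hR // genl0 mul0r; exact: AR_deg_0.
Qed.

Lemma deg_mR x y b d c a :
  AR_deg (w a + w c) (w b + w d) (m (Rm x y b d) * (L c y * L a x)).
Proof.
case: (EM (w x + w y = w b + w d)) => [<-|ne].
  by rewrite [w a + _]addrC [w x + _]addrC; exact: deg_mLL.
by rewrite hR // genm0 mul0r; exact: AR_deg_0.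
Qed.

Lemma deg_LLr a b c d : AR_deg (w b + w a) (w d + w c) (L a c * L b d).
Proof. by rewrite addrC [w d + _]addrC; exact: deg_LL. Qed.

Lemma tmul_LL x y z t :
  tmul (ar_Delta w Rm (TL x y)) (ar_Delta w Rm (TL z t)) =
  \sum_u \sum_v tp (w x + w z) (w u + w v) (w y + w t)
     (L x u * L z v) (L u y * L v t).
Proof.
rewrite /= tmul_suml; apply: eq_bigr => u _.
rewrite tmul_sumr; apply: eq_bigr => v _.
rewrite tmul_pure -(tpE (deg_LL _ _ _ _) (deg_LL _ _ _ _)).
exact: pure_ext.
Qed.

Lemma tmul_lp f a c b x y (hx : AR_deg a c x) (hy : AR_deg c b y) :
  tmul (ar_Delta w Rm (Tl f)) (tp a c b x y) = tp a c b (l f * x) y.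
Proof.
have hfx : AR_deg a c (l f * x).
  rewrite -[a]add0r -[c]add0r; apply: AR_deg_M => //; exact: AR_deg_l.
rewrite -(tpE hx hy) /= tmul_pure -(tpE hfx hy).
by apply: pure_ext; rewrite /= ?add0r ?mul1r.
Qed.

Lemma tmul_mp f a c b x y (hx : AR_deg a c x) (hy : AR_deg c b y) :
  tmul (ar_Delta w Rm (Tm f)) (tp a c b x y) = tp a c b x (m f * y).
Proof.
have hfy : AR_deg c b (m f * y).
  rewrite -[b]add0r -[c]add0r; apply: AR_deg_M => //; exact: AR_deg_m.
rewrite -(tpE hx hy) /= tmul_pure -(tpE hx hfy).
by apply: pure_ext; rewrite /= ?add0r ?mul1r.
Qed.

Lemma exch4 (W : zmodType) (F : X -> X -> X -> X -> W) :
  \sum_x \sum_y \sum_u \sum_v F x y u v =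
  \sum_u \sum_v \sum_x \sum_y F x y u v.
Proof.
transitivity (\sum_x \sum_u \sum_y \sum_v F x y u v).
  by apply: eq_bigr => x _; exact: exchange_big.
rewrite exchange_big; apply: eq_bigr => u _ /=.
transitivity (\sum_x \sum_v \sum_y F x y u v).
  by apply: eq_bigr => x _; exact: exchange_big.
exact: exchange_big.
Qed.

Lemma ar_Delta_RLL a b c d :
  \sum_x \sum_y tmul (ar_Delta w Rm (Tl (Rm a c x y)))
    (tmul (ar_Delta w Rm (TL x b)) (ar_Delta w Rm (TL y d))) =
  \sum_x \sum_y tmul (ar_Delta w Rm (Tm (Rm x y b d)))
    (tmul (ar_Delta w Rm (TL c y)) (ar_Delta w Rm (TL a x))).
Proof.
pose al := w a + w c; pose be := w b + w d.
transitivity (\sum_x \sum_y \sum_u \sum_v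
    tp al (w u + w v) be (l (Rm a c x y) * (L x u * L y v))
      (L u b * L v d)).
  apply: eq_bigr => x _; apply: eq_bigr => y _.
  rewrite tmul_LL tmul_sumr; apply: eq_bigr => u _.
  rewrite tmul_sumr; apply: eq_bigr => v _.
  rewrite tmul_lp; [|exact: deg_LL|exact: deg_LL].
  case: (EM (w a + w c = w x + w y)) => [<-//|ne].
  by rewrite hR // genl0 mul0r !tp0l.
rewrite exch4.
transitivity (\sum_u \sum_v \sum_x \sum_y
    tp al (w x + w y) be (L c y * L a x)
      (l (Rm x y u v) * (L u b * L v d))).
  apply: eq_bigr => u _; apply: eq_bigr => v _.
  transitivity (tp al (w u + w v) be
      (\sum_x \sum_y l (Rm a c x y) * (L x u * L y v)) (L u b * L v d)).
    rewrite tp_suml; [|move=> x|exact: deg_LL].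
      apply: eq_bigr => x _; rewrite tp_suml //; [|exact: deg_LL].
      by move=> y; exact: deg_lR.
    by apply: AR_deg_sum => y; exact: deg_lR.
  rewrite AR_RLL tp_suml; [|move=> x|exact: deg_LL]; last first.
    by apply: AR_deg_sum => y; exact: deg_mR.
  apply: eq_bigr => x _; rewrite tp_suml; [|move=> y|exact: deg_LL].
    apply: eq_bigr => y _.
    case: (EM (w x + w y = w u + w v)) => [e|ne]; last first.
      by rewrite hR // genm0 genl0 !mul0r tp0l tp0r.
    have h1 := deg_mR x y u v c a.
    have h2 : AR_deg al (w x + w y) (L c y * L a x) by exact: deg_LLr.
    have h3 := deg_lLL (Rm x y u v) u b v d.
    rewrite -e in h1 h3 *.
    have h4 : AR_deg (w x + w y) be (L u b * L v d) by rewrite e; exact: deg_LL.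
    rewrite -(tpE h1 h4) -(tpE h2 h3).
    exact: (@pure_bal _ _ _ _ _ (Rm x y u v) _ _
              (L c y * L a x) (L u b * L v d)).
  exact: deg_mR.
rewrite exch4.
transitivity (\sum_x \sum_y \sum_u \sum_v
    tp al (w x + w y) be (L c y * L a x)
      (m (Rm u v b d) * (L y v * L x u))).
  apply: eq_bigr => x _; apply: eq_bigr => y _.
  have hcx : AR_deg al (w x + w y) (L c y * L a x) by exact: deg_LLr.
  transitivity (tp al (w x + w y) be (L c y * L a x)
      (\sum_u \sum_v l (Rm x y u v) * (L u b * L v d))).
    rewrite tp_sumr //; last by move=> u; apply: AR_deg_sum => v; exact: deg_lR.
    apply: eq_bigr => u _; rewrite tp_sumr // => v; exact: deg_lR.
  rewrite AR_RLL tp_sumr //; last first.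
    by move=> u; apply: AR_deg_sum => v; exact: deg_mR.
  by apply: eq_bigr => u _; rewrite tp_sumr // => v; exact: deg_mR.
rewrite exch4; apply: eq_bigr => u _; apply: eq_bigr => v _.
rewrite exchange_big tmul_LL tmul_sumr; apply: eq_bigr => y _.
rewrite tmul_sumr; apply: eq_bigr => x _.
rewrite tmul_mp; [|exact: deg_LL|exact: deg_LL].
rewrite [w c + _]addrC [w y + _]addrC [w v + _]addrC.
case: (EM (w u + w v = w b + w d)) => [->//|ne].
by rewrite hR // genm0 mul0r !tp0r.
Qed.

Lemma ar_Delta_rel t u :
  ar_rel w Rm t u -> ar_Delta w Rm t = ar_Delta w Rm u.
Proof.
have sumr (T : Type) (s : seq T) (F G : T -> AA) :
  (forall i, F i = G i) -> \sum_(i <- s) F i = \sum_(i <- s) G i.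
  by move=> e; apply: eq_bigr => i _.
elim=> {t u} /=.
- by [].
- by [].
- by move=> t u v _ -> _ ->.
- by move=> t t' u u' _ -> _ ->.
- by move=> t t' u u' _ -> _ ->.
- by move=> k t t' _ ->.
- by move=> *; rewrite addrA.
- by move=> *; rewrite addrC.
- by move=> *; rewrite add0r.
- by move=> *; rewrite scale0r.
- by move=> *; rewrite scale1r.
- by move=> *; rewrite scalerA.
- by move=> *; rewrite scalerDl.
- by move=> *; rewrite scalerDr.
- by move=> *; rewrite tmulA.
- by move=> *; rewrite tmul1l.
- by move=> *; rewrite tmul1r.
- by move=> *; rewrite tmulDl.
- by move=> *; rewrite tmulDr.
- by move=> *; rewrite tmulZl.
- by move=> *; rewrite tmulZr.
- by move=> f g; apply: pure_add_l => //=; exact: genlD.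
- move=> f g; rewrite tmul_pure.
  by apply: pure_ext; rewrite /= ?addr0 ?genlM ?mulr1.
- by move=> k f; apply: pure_scale_l => //=; exact: genlZ.
- by apply: pure_ext => //=; exact: genl1.
- by move=> f g; apply: pure_add_r => //=; exact: genmD.
- move=> f g; rewrite tmul_pure.
  by apply: pure_ext; rewrite /= ?addr0 ?genmM ?mulr1.
- by move=> k f; apply: pure_scale_r => //=; exact: genmZ.
- by apply: pure_ext => //=; exact: genm1.
- move=> f x y; rewrite tmul_sumr tmul_suml; apply: sumr => z.
  rewrite !tmul_pure; apply: pure_ext; rewrite /= ?addr0 ?add0r ?mulr1 ?mul1r //.
  exact: genl_L.
- move=> f x y; rewrite tmul_sumr tmul_suml; apply: sumr => z.
  rewrite !tmul_pure; apply: pure_ext; rewrite /= ?addr0 ?add0r ?mulr1 ?mul1r //.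
  exact: genm_L.
- move=> f g; rewrite !tmul_pure.
  by apply: pure_ext; rewrite /= ?addr0 ?mulr1 ?mul1r.
- move=> a b c d; rewrite !(@Tsum_morph _ (ar_Delta w Rm)) //=.
  exact: ar_Delta_RLL.
Qed.

Lemma AR_eps_pi t : AR_eps (\pi_A t) = ar_eps w t.
Proof. by apply: ar_eps_rel; exact: ar_reprP. Qed.

Lemma AR_Delta_pi t : AR_Delta (\pi_A t) = ar_Delta w Rm t.
Proof. by apply: ar_Delta_rel; exact: ar_reprP. Qed.

Lemma AR_epsL x y : AR_eps (L x y) = if x == y then Dterm 1 (- w x) else 0.
Proof. exact: AR_eps_pi. Qed.
Lemma AR_epsl f : AR_eps (l f) = Dterm f 0.
Proof. exact: AR_eps_pi. Qed.
Lemma AR_epsm f : AR_eps (m f) = Dterm f 0.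
Proof. exact: AR_eps_pi. Qed.
Lemma AR_eps1 : AR_eps (1 : A) = 1.
Proof. exact: (AR_eps_pi T1). Qed.
Lemma AR_epsP k (x y : A) : AR_eps (k *: x + y) = k *: AR_eps x + AR_eps y.
Proof.
move: x y; apply: arP => t; apply: arP => u.
by rewrite -AR_piZ -AR_piD !AR_eps_pi.
Qed.
Lemma AR_epsM (x y : A) : AR_eps (x * y) = AR_eps x * AR_eps y.
Proof.
by move: x y; apply: arP => t; apply: arP => u; rewrite -AR_piM !AR_eps_pi.
Qed.

Lemma AR_DeltaL x y : AR_Delta (L x y) =
  \sum_z tp (w x) (w z) (w y) (L x z) (L z y).
Proof.
rewrite /genL AR_Delta_pi /=; apply: eq_bigr => z _; exact: tpE.
Qed.
Lemma AR_Deltal f : AR_Delta (l f) = tp 0 0 0 (l f) 1.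
Proof. rewrite /genl AR_Delta_pi /=; exact: tpE. Qed.
Lemma AR_Deltam f : AR_Delta (m f) = tp 0 0 0 1 (m f).
Proof. rewrite /genm AR_Delta_pi /=; exact: tpE. Qed.
Lemma AR_Delta1 : AR_Delta (1 : A) = tp 0 0 0 1 1.
Proof. rewrite -AR_pi1 AR_Delta_pi /=; exact: tpE. Qed.
Lemma AR_DeltaP k (x y : A) :
  AR_Delta (k *: x + y) = k *: AR_Delta x + AR_Delta y.
Proof.
move: x y; apply: arP => t; apply: arP => u.
by rewrite -AR_piZ -AR_piD !AR_Delta_pi.
Qed.
Lemma AR_DeltaM (x y : A) : AR_Delta (x * y) = tmul (AR_Delta x) (AR_Delta y).
Proof.
by move: x y; apply: arP => t; apply: arP => u; rewrite -AR_piM !AR_Delta_pi.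
Qed.
End AlgebraARTheory.

Section YangBaxter.
Context {R : realType} (V : vectType R[i]) (X : finType) (w : X -> V).
Local Notation M := (mero V).
Variable Rm : X -> X -> X -> X -> M.

(* Matrices, in the basis v_x (x) v_y (x) v_z, of meromorphic functions with
   values in End(V (x) V (x) V): rows index outputs and columns inputs, so that
   R (v_a (x) v_b) = sum_xy R_xy^ab v_x (x) v_y. *)
Definition End3 := X * X * X -> X * X * X -> M.

Definition mul3 (P Q : End3) : End3 := fun i j => \sum_k P i k * Q k j.

(* [R12 s] is R^12(lambda + s(z)) on U (x) U (x) v_z; similarly for R13, R23.
   Thus s = 0 gives R^12(lambda) and s = - w gives R^12(lambda - h^(3)). *)
Definition R12 (s : X -> V) : End3 := fun '(x, y, z) '(a, b, c) =>
  if z == c then mshift (s c) (Rm x y a b) else 0.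
Definition R13 (s : X -> V) : End3 := fun '(x, y, z) '(a, b, c) =>
  if y == b then mshift (s b) (Rm x z a c) else 0.
Definition R23 (s : X -> V) : End3 := fun '(x, y, z) '(a, b, c) =>
  if x == a then mshift (s a) (Rm y z b c) else 0.

Definition QDYBE : Prop :=
  let h x := - w x in let o _ := 0 in
  mul3 (R12 h) (mul3 (R13 o) (R23 h)) =2 mul3 (R23 o) (mul3 (R13 h) (R12 o)).
End YangBaxter.

(* Main.v *)
(* Write mu_l(f), mu_r(f) for f(lambda), f(mu), and x' (x) x'' for Delta(x).
   Necessity of the Yang-Baxter equation: pair the RLL relation with a
   generator and evaluate at the constant function 1.

   For sufficiency, a pairing amounts to operators on A_R
     op a x = sum mu_r(<a, x''> 1) x',
   from which <a, x> g = eps(op a (x mu_r(g))) 1 is recovered.  They are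
   multiplicative in a, and op L_ij is a matrix homomorphism,
     op L_ij (x y) = sum_z op L_zj x * op L_iz y,
   so everything is determined on generators by
     op L_ij L_kl = sum_z mu_r(R_iz^jl) L_kz.
   Both consistency checks, that x |-> (op L_ij x)_ij respects the RLL relation
   and that the operators op L_ij satisfy it in turn, are the Yang-Baxter
   equation.  Because op a is multiplicative in a by construction, coassociativity
   is never needed.

   Cobraiding: A_R is spanned over mu_l, mu_r by coefficients of matrix
   corepresentations, namely words in the generators.  For a pair of
   corepresentations the cobraiding identity is an RLL relation with R replaced
   by the matrix of the pairing; it is stable under products in both slots and
   for generators it is the defining relation. *)
Require Import Defs.
From mathcomp Require Import all_boot all_order all_algebra.
From mathcomp Require Import complex boolp.
From mathcomp Require Import reals.

Set Implicit Arguments.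
Unset Strict Implicit.
Unset Printing Implicit Defensive.

Import GRing.Theory.
Local Open Scope ring_scope.
Local Open Scope complex_scope.
Local Open Scope quotient_scope.

(** * Sums under maps induced on the tensor product *)

Section TensorLift.
Context {R : realType} (V : vectType R[i]) (A B : hprealg_data V).
Variables (W : lmodType R[i]) (phi : hpair A B -> W).
Hypothesis bphi : balanced phi.

Lemma tlift0 : tlift phi 0 = 0.
Proof. by rewrite -(scale0r 0) tliftZ // scale0r. Qed.

Lemma tlift_sum (I : Type) (s : seq I) (F : I -> tens A B) :
  tlift phi (\sum_(i <- s) F i) = \sum_(i <- s) tlift phi (F i).
Proof. by apply: (big_morph _ _ tlift0) => x y; exact: tliftD. Qed.

Lemma tlift_sum_pure (s : seq (hpair A B)) :
  tlift phi (\sum_(p <- s) pure p) = \sum_(p <- s) phi p.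
Proof. by rewrite tlift_sum; apply: eq_bigr => p _; rewrite tlift_pure. Qed.
End TensorLift.

(** * Sums and degrees of difference operators *)

Section DifferenceOperatorSums.
Context {R : realType} (V : vectType R[i]).

Lemma Dh_sum (I : Type) (s : seq I) (F : I -> Dh V) g :
  (\sum_(i <- s) F i) g = \sum_(i <- s) F i g.
Proof.
elim: s => [|i s IH]; first by rewrite !big_nil /= mul0r.
by rewrite !big_cons -IH.
Qed.

Lemma Dh_degC p q (D : Dh V) : Dh_deg p q D -> Dh_deg q p D.
Proof. by rewrite /Dh_deg eq_sym; case: eqP => // ->. Qed.

(** Needed for the degree of the pairing, which on homogeneous elements is a counit value followed
    by some T_{-c}. *)
Lemma Dh_deg_shift c p q (D : Dh V) :
  Dh_deg p q D -> Dh_deg (p + c) (q + c) (D * Dterm 1 (- c)).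
Proof.
rewrite /Dh_deg (inj_eq (addIr c)).
case: eqP => _; last by move=> ->; rewrite mul0r.
by move=> [f ->]; exists f; rewrite DtermM mshift1 mulr1 opprD.
Qed.
End DifferenceOperatorSums.

(** * Induction over generators, and the Yang-Baxter equation in coordinates *)

Section Operators.
Context {R : realType} (V : vectType R[i]) (X : finType) (w : X -> V).
Variable Rm : X -> X -> X -> X -> mero V.
Local Notation C := R[i].
Local Notation M := (mero V).
Local Notation A := (AR w Rm).
Local Notation L := (genL w Rm).
Local Notation l := (genl w Rm).
Local Notation m := (genm w Rm).

(** Scalars need no case of their own: 0, 1 and multiplication by k come from constant functions
    f(lambda). *)
Lemma AR_ind (Q : A -> Prop) :
  (forall x y, Q (L x y)) -> (forall f, Q (l f)) -> (forall f, Q (m f)) ->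
  (forall x y, Q x -> Q y -> Q (x + y)) ->
  (forall x y, Q x -> Q y -> Q (x * y)) -> forall x, Q x.
Proof.
move=> QL Ql Qm QD QM; apply: arP; elim=> [x y|f|f|||t Qt u Qu|t Qt u Qu|k t Qt].
- exact: QL.
- exact: Ql.
- exact: Qm.
- by rewrite AR_pi0 -(genl0 w Rm).
- by rewrite AR_pi1 -(genl1 w Rm).
- by rewrite AR_piD; exact: QD.
- by rewrite AR_piM; exact: QM.
- rewrite AR_piZ -[_ *: _]mul1r -scalerAr scalerAl -(genl1 w Rm) -genlZ.
  exact: QM.
Qed.

Lemma genl_sum (I : Type) (s : seq I) (F : I -> M) :
  l (\sum_(i <- s) F i) = \sum_(i <- s) l (F i).
Proof. exact: (big_morph l (genlD w Rm) (genl0 w Rm)). Qed.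

Lemma genm_sum (I : Type) (s : seq I) (F : I -> M) :
  m (\sum_(i <- s) F i) = \sum_(i <- s) m (F i).
Proof. exact: (big_morph m (genmD w Rm) (genm0 w Rm)). Qed.

Lemma mshiftMn a (f : M) n : mshift a (f *+ n) = mshift a f *+ n.
Proof.
by elim: n => [|n IH]; rewrite ?mulr0n ?mshift_zero // !mulrS mshiftD IH.
Qed.

Lemma L_genm f x y : L x y * m f = m (mshift (- w y) f) * L x y.
Proof. by rewrite genm_L mshift_add subrr mshift0. Qed.

Lemma L_genl f x y : L x y * l f = l (mshift (- w x) f) * L x y.
Proof. by rewrite genl_L mshift_add subrr mshift0. Qed.

(* The (i,p,q),(j,b,d) entries of the two sides of the Yang-Baxter equation. *)
Definition ybe_lhs i p q j b d : M := \sum_x \sum_y \sum_z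
  mshift (- w q) (Rm i p z x) * (Rm z q j y * mshift (- w j) (Rm x y b d)).
Definition ybe_rhs i p q j b d : M := \sum_u \sum_v \sum_z
  Rm p q u v * (mshift (- w u) (Rm i v z d) * Rm z u j b).

Lemma sum_pair3 (W : nmodType) (F : X * X * X -> W) :
  \sum_k F k = \sum_x \sum_y \sum_z F (x, y, z).
Proof.
transitivity (\sum_(p : X * X) \sum_z F (p, z)).
  by rewrite pair_bigA; apply: eq_bigr => -[[x y] z] _.
by rewrite [RHS]pair_bigA; apply: eq_bigr => -[x y] _.
Qed.

Lemma sum_delta (W : nmodType) (I : finType) (i0 : I) (F : I -> W) :
  \sum_i F i *+ (i == i0) = F i0.
Proof.
rewrite (bigD1 i0) //= eqxx mulr1n big1 ?addr0 // => i /negbTE ->.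
by rewrite mulr0n.
Qed.

Lemma mulrIf (B : pzSemiRingType) (b : bool) (x y : B) :
  (if b then x else 0) * y = (x * y) *+ b.
Proof. by case: b; rewrite ?mul0r. Qed.

Lemma mul3_R12 s (Q : End3 V X) i p q k :
  mul3 (R12 Rm s) Q (i, p, q) k =
  \sum_x \sum_y mshift (s q) (Rm i p x y) * Q (x, y, q) k.
Proof.
rewrite /mul3 sum_pair3; apply: eq_bigr => x _; apply: eq_bigr => y _.
rewrite -[RHS](sum_delta q (fun z => mshift (s z) (Rm i p x y) * Q (x, y, z) k)).
by apply: eq_bigr => z _; rewrite /= mulrIf eq_sym.
Qed.

Lemma mul3_R13 s (Q : End3 V X) i p q k :
  mul3 (R13 Rm s) Q (i, p, q) k =
  \sum_x \sum_z mshift (s p) (Rm i q x z) * Q (x, p, z) k.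
Proof.
rewrite /mul3 sum_pair3; apply: eq_bigr => x _.
rewrite -[RHS](sum_delta p
  (fun y => \sum_z mshift (s y) (Rm i q x z) * Q (x, y, z) k)).
apply: eq_bigr => y _; rewrite -sumrMnl; apply: eq_bigr => z _.
by rewrite /= mulrIf eq_sym.
Qed.

Lemma mul3_R23 s (Q : End3 V X) i p q k :
  mul3 (R23 Rm s) Q (i, p, q) k =
  \sum_y \sum_z mshift (s i) (Rm p q y z) * Q (i, y, z) k.
Proof.
rewrite /mul3 sum_pair3.
rewrite -[RHS](sum_delta i
  (fun x => \sum_y \sum_z mshift (s x) (Rm p q y z) * Q (x, y, z) k)).
apply: eq_bigr => x _; rewrite -sumrMnl; apply: eq_bigr => y _.
rewrite -sumrMnl; apply: eq_bigr => z _.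
by rewrite /= mulrIf eq_sym.
Qed.

(** Each of the three factors is the identity on one tensor slot, so three Kronecker deltas reduce
    the six summations of the triple product to three. *)
Lemma QDYBE_entries :
  QDYBE w Rm <-> forall i p q j b d, ybe_lhs i p q j b d = ybe_rhs i p q j b d.
Proof.
have EL i p q j b d :
  mul3 (R12 Rm (fun x => - w x)) (mul3 (R13 Rm (fun=> 0))
    (R23 Rm (fun x => - w x))) (i, p, q) (j, b, d) = ybe_lhs i p q j b d.
  rewrite mul3_R12 /ybe_lhs.
  transitivity (\sum_z \sum_x \sum_y
    mshift (- w q) (Rm i p z x) * (Rm z q j y * mshift (- w j) (Rm x y b d))).
    apply: eq_bigr => z _; apply: eq_bigr => x _.
    rewrite mul3_R13 -mulr_sumr exchange_big; congr (_ * _).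
    apply: eq_bigr => y _.
    rewrite -[RHS](sum_delta j
      (fun k => Rm z q k y * mshift (- w k) (Rm x y b d))).
    apply: eq_bigr => k _; rewrite /= mshift0.
    by case: eqP => [->|_]; rewrite ?mulr0 ?mul0r.
  by rewrite exchange_big; apply: eq_bigr => x _; rewrite exchange_big.
have ER i p q j b d :
  mul3 (R23 Rm (fun=> 0)) (mul3 (R13 Rm (fun x => - w x))
    (R12 Rm (fun=> 0))) (i, p, q) (j, b, d) = ybe_rhs i p q j b d.
  rewrite mul3_R23 /ybe_rhs.
  apply: eq_bigr => u _; apply: eq_bigr => v _.
  rewrite mshift0 mul3_R13 -mulr_sumr; congr (_ * _).
  apply: eq_bigr => z _.
  rewrite -[RHS](sum_delta d (fun k => mshift (- w u) (Rm i v z k) * Rm z u j b)).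
  apply: eq_bigr => k _; rewrite /= mshift0.
  by case: eqP => [->|_]; rewrite ?mulr0 ?mul0r.
split=> [H i p q j b d|H]; first by rewrite -EL -ER; exact: H.
by rewrite /QDYBE; cbv zeta; case=> [[i p] q]; case=> [[j b] d]; rewrite EL ER.
Qed.
End Operators.

(** * Construction of the pairing from a solution of the Yang-Baxter equation *)

Section Construction.
Context {R : realType} (V : vectType R[i]) (X : finType) (w : X -> V).
Variable Rm : X -> X -> X -> X -> mero V.
Local Notation C := R[i].
Local Notation M := (mero V).
Local Notation A := (AR w Rm).
Local Notation L := (genL w Rm).
Local Notation l := (genl w Rm).
Local Notation m := (genm w Rm).
Hypothesis hR :
  forall x y a b, w x + w y <> w a + w b -> Rm x y a b = 0.
Hypothesis hYB :
  forall i p q j b d, ybe_lhs w Rm i p q j b d = ybe_rhs w Rm i p q j b d.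

(** The prescribed value of op L_ij on a term. The product rule follows the flipped coproduct, the
    sum of L_zj (x) L_iz. The shift on f(mu) appears because <L_ij, f(mu)> 1 has to be eps(L_ij)
    f. *)
Fixpoint ar_act (t : ar_term V X) (i j : X) : A :=
  match t with
  | TL x y => \sum_z m (Rm i z j y) * L x z
  | Tl f => l f *+ (i == j)
  | Tm f => m (mshift (- w i) f) *+ (i == j)
  | T0 => 0
  | T1 => 1 *+ (i == j)
  | Tadd t u => ar_act t i j + ar_act u i j
  | Tmul t u => \sum_z ar_act t z j * ar_act u i z
  | Tscale k t => k *: ar_act t i j
  end.

Lemma sum_mul_deltal (i : X) (F G : X -> A) :
  \sum_z F z *+ (z == i) * G z = F i * G i.
Proof.
rewrite -(sum_delta i (fun z => F z * G z)).
by apply: eq_bigr => z _; rewrite mulrnAl.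
Qed.

Lemma sum_mul_deltar (i : X) (F G : X -> A) :
  \sum_z F z * (G z *+ (i == z)) = F i * G i.
Proof.
rewrite -(sum_delta i (fun z => F z * G z)).
by apply: eq_bigr => z _; rewrite mulrnAr eq_sym.
Qed.

(* R_{ab}^{cd} vanishes unless the weights match, so two shifts agreeing in that
   case are interchangeable next to it. *)
Lemma shift_Rm f a b c d (e e' : V) :
  e + (w c + w d) = e' + (w a + w b) ->
  Rm a b c d * mshift e f = Rm a b c d * mshift e' f.
Proof.
move=> ee; case: (EM (w a + w b = w c + w d)) => [h|/hR ->];
  last by rewrite !mul0r.
by move: ee; rewrite h => /addIr ->.
Qed.

(** Moving the second coefficient to the left past L_xu shifts it by -w u; this produces the
    dynamical shift in [ybe_rhs]. *)
Lemma act_LL i j x y b d :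
  ar_act (Tmul (TL x b) (TL y d)) i j =
  \sum_u \sum_v m (\sum_z Rm z u j b * mshift (- w u) (Rm i v z d)) *
     (L x u * L y v).
Proof.
rewrite /=; under eq_bigr do rewrite mulr_suml; rewrite exchange_big.
apply: eq_bigr => u _; under eq_bigr do rewrite mulr_sumr; rewrite exchange_big.
apply: eq_bigr => v _; rewrite genm_sum mulr_suml; apply: eq_bigr => z _ /=.
by rewrite -mulrA [L x u * (_ * _)]mulrA L_genm genmM -!mulrA.
Qed.

Lemma act_RLL i j a b c d :
  \sum_x \sum_y l (Rm a c x y) * ar_act (Tmul (TL x b) (TL y d)) i j =
  \sum_x \sum_y m (mshift (- w j) (Rm x y b d)) *
     ar_act (Tmul (TL c y) (TL a x)) i j.
Proof.
transitivity (\sum_u \sum_v \sum_p \sum_q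
  m ((\sum_z Rm z u j b * mshift (- w u) (Rm i v z d)) * Rm p q u v) *
  (L c q * L a p)).
  transitivity (\sum_u \sum_v
    m (\sum_z Rm z u j b * mshift (- w u) (Rm i v z d)) *
    \sum_x \sum_y l (Rm a c x y) * (L x u * L y v)).
    transitivity (\sum_x \sum_y \sum_u \sum_v
      m (\sum_z Rm z u j b * mshift (- w u) (Rm i v z d)) *
        (l (Rm a c x y) * (L x u * L y v))).
      apply: eq_bigr => x _; apply: eq_bigr => y _.
      rewrite act_LL mulr_sumr; apply: eq_bigr => u _.
      rewrite mulr_sumr; apply: eq_bigr => v _.
      by rewrite mulrA genl_m -mulrA.
    rewrite exch4; apply: eq_bigr => u _; apply: eq_bigr => v _.
    by rewrite mulr_sumr; apply: eq_bigr => x _; rewrite mulr_sumr.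
  apply: eq_bigr => u _; apply: eq_bigr => v _.
  rewrite AR_RLL mulr_sumr; apply: eq_bigr => p _.
  by rewrite mulr_sumr; apply: eq_bigr => q _; rewrite mulrA -genmM.
rewrite exch4.
transitivity (\sum_p \sum_q m (ybe_rhs w Rm i p q j b d) * (L c q * L a p)).
  apply: eq_bigr => p _; apply: eq_bigr => q _.
  rewrite /ybe_rhs genm_sum mulr_suml; apply: eq_bigr => u _.
  rewrite genm_sum mulr_suml; apply: eq_bigr => v _; congr (m _ * _).
  rewrite mulr_suml; apply: eq_bigr => z _.
  by rewrite mulrC [Rm z u j b * _]mulrC.
transitivity (\sum_x \sum_y \sum_p \sum_q
  m (mshift (- w j) (Rm x y b d) *
     \sum_z Rm z q j y * mshift (- w q) (Rm i p z x)) * (L c q * L a p)).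
  rewrite exch4; apply: eq_bigr => p _; apply: eq_bigr => q _.
  rewrite -hYB /ybe_lhs genm_sum mulr_suml; apply: eq_bigr => x _.
  rewrite genm_sum mulr_suml; apply: eq_bigr => y _; congr (m _ * _).
  rewrite mulr_sumr; apply: eq_bigr => z _.
  by rewrite mulrCA [RHS]mulrCA; congr (_ * _); rewrite mulrC.
apply: eq_bigr => x _; apply: eq_bigr => y _.
rewrite act_LL [RHS]mulr_sumr exchange_big; apply: eq_bigr => q _.
by rewrite [RHS]mulr_sumr; apply: eq_bigr => p _; rewrite genmM -mulrA.
Qed.

Lemma ar_act_rel t u : ar_rel w Rm t u -> ar_act t = ar_act u.
Proof.
move=> tu; apply/funext => i; apply/funext => j; elim: tu i j => {t u}.
- by [].
- by move=> t u _ IH i j.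
- by move=> t u v _ IH _ IH' i j; rewrite IH.
- by move=> t t' u u' _ IH _ IH' i j /=; rewrite IH IH'.
- by move=> t t' u u' _ IH _ IH' i j /=; apply: eq_bigr => z _; rewrite IH IH'.
- by move=> k t t' _ IH i j /=; rewrite IH.
- by move=> *; rewrite /= addrA.
- by move=> *; rewrite /= addrC.
- by move=> *; rewrite /= add0r.
- by move=> *; rewrite /= scale0r.
- by move=> *; rewrite /= scale1r.
- by move=> *; rewrite /= scalerA.
- by move=> *; rewrite /= scalerDl.
- by move=> *; rewrite /= scalerDr.
- move=> t u v i j /=; under eq_bigr do rewrite mulr_sumr.
  rewrite exchange_big; apply: eq_bigr => y _.
  by rewrite mulr_suml; apply: eq_bigr => z _; rewrite mulrA.
- by move=> t i j /=; rewrite sum_mul_deltal mul1r.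
- by move=> t i j /=; rewrite sum_mul_deltar mulr1.
- move=> t u v i j /=; rewrite -big_split.
  by apply: eq_bigr => z _; rewrite mulrDl.
- move=> t u v i j /=; rewrite -big_split.
  by apply: eq_bigr => z _; rewrite mulrDr.
- move=> k t u i j /=; rewrite scaler_sumr.
  by apply: eq_bigr => z _; rewrite scalerAl.
- move=> k t u i j /=; rewrite scaler_sumr.
  by apply: eq_bigr => z _; rewrite scalerAr.
- by move=> f g i j; rewrite /= genlD mulrnDl.
- by move=> f g i j; rewrite /= sum_mul_deltal mulrnAr genlM.
- by move=> k f i j; rewrite /= genlZ scalerMnr.
- by move=> i j; rewrite /= genl1.
- by move=> f g i j; rewrite /= mshiftD genmD mulrnDl.
- move=> f g i j; rewrite /= sum_mul_deltal mulrnAr mshiftM genmM.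
  by case: eqP => [->|]; rewrite ?mulr0.
- by move=> k f i j; rewrite /= mshiftZ genmZ scalerMnr.
- by move=> i j; rewrite /= mshift1 genm1.
- move=> f x y i j; rewrite /= sum_mul_deltal sum_mul_deltar mulr_sumr mulr_suml.
  apply: eq_bigr => z _.
  by rewrite mulrA genl_m -!mulrA genl_L.
- move=> f x y i j; rewrite /= sum_mul_deltal sum_mul_deltar mulr_sumr mulr_suml.
  apply: eq_bigr => z _.
  (* The two shifts of f are -w j and -w z - w i + w y; they agree wherever R_iz^jy is nonzero. *)
  rewrite -[RHS]mulrA L_genm !mulrA -!genmM !mshift_add; congr (m _ * _).
  rewrite mulrC; apply: shift_Rm.
  by rewrite addKr -opprD addrAC [w z + _]addrC addNr add0r.
- move=> f g i j; rewrite /= !sum_mul_deltal !mulrnAr.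
  by case: eqP => [->|]; rewrite ?mulr0n ?genl_m.
- move=> a b c d i j.
  rewrite !(Tsum_morph (phi := fun t => ar_act t i j)) //.
  transitivity (\sum_x \sum_y
      l (Rm a c x y) * ar_act (Tmul (TL x b) (TL y d)) i j).
    apply: eq_bigr => x _; apply: eq_bigr => y _; exact: sum_mul_deltal.
  rewrite act_RLL.
  apply: eq_bigr => x _; apply: eq_bigr => y _; symmetry.
  exact: sum_mul_deltal.
Qed.
Definition act (i j : X) (x : A) : A := ar_act (repr x) i j.

Lemma act_pi i j t : act i j (\pi_A t) = ar_act t i j.
Proof. by rewrite /act (ar_act_rel (ar_reprP w Rm t)). Qed.

Lemma act_L i j x y : act i j (L x y) = \sum_z m (Rm i z j y) * L x z.
Proof. exact: act_pi. Qed.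
Lemma act_l i j f : act i j (l f) = l f *+ (i == j).
Proof. exact: act_pi. Qed.
Lemma act_m i j f : act i j (m f) = m (mshift (- w i) f) *+ (i == j).
Proof. exact: act_pi. Qed.

Lemma actM i j (x y : A) : act i j (x * y) = \sum_z act z j x * act i z y.
Proof.
move: x y; apply: arP => t; apply: arP => u; rewrite -AR_piM !act_pi /=.
by apply: eq_bigr => z _; rewrite !act_pi.
Qed.

Lemma actP i j k (x y : A) : act i j (k *: x + y) = k *: act i j x + act i j y.
Proof.
by move: x y; apply: arP => t; apply: arP => u; rewrite -AR_piZ -AR_piD !act_pi.
Qed.

Lemma actD i j : {morph act i j : x y / x + y}.
Proof. by move=> x y; rewrite -[x]scale1r actP !scale1r. Qed.
Lemma act0 i j : act i j 0 = 0.
Proof. by rewrite -(genl0 w Rm) act_l genl0 mul0rn. Qed.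
Lemma act_sum i j (I : Type) (s : seq I) (F : I -> A) :
  act i j (\sum_(k <- s) F k) = \sum_(k <- s) act i j (F k).
Proof. exact: (big_morph _ (actD i j) (act0 i j)). Qed.

Lemma actMn i j x n : act i j (x *+ n) = act i j x *+ n.
Proof. by elim: n => [|n IH]; rewrite ?act0 // !mulrS actD IH. Qed.

Lemma act_lM i j f x : act i j (l f * x) = l f * act i j x.
Proof.
by rewrite actM; under eq_bigr do rewrite act_l; rewrite sum_mul_deltal.
Qed.
Lemma act_mM i j f x : act i j (m f * x) = m (mshift (- w j) f) * act i j x.
Proof.
by rewrite actM; under eq_bigr do rewrite act_m; rewrite sum_mul_deltal.
Qed.
Lemma act_Ml i j f x : act i j (x * l f) = act i j x * l f.
Proof.
by rewrite actM; under eq_bigr do rewrite act_l; rewrite sum_mul_deltar.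
Qed.
Lemma act_Mm i j f x : act i j (x * m f) = act i j x * m (mshift (- w i) f).
Proof.
by rewrite actM; under eq_bigr do rewrite act_m; rewrite sum_mul_deltar.
Qed.

(** * The RLL relation for the operators, and their extension to all of A_R *)

Lemma act_act_L x b y d k e : act x b (act y d (L k e)) =
  \sum_v m (\sum_u mshift (- w b) (Rm y u d e) * Rm x v b u) * L k v.
Proof.
rewrite act_L act_sum.
under eq_bigr do rewrite act_mM act_L mulr_sumr.
rewrite exchange_big; apply: eq_bigr => v _; rewrite genm_sum mulr_suml.
by apply: eq_bigr => u _; rewrite genmM mulrA.
Qed.

Lemma act_act_M x b y d (t u : A) : act x b (act y d (t * u)) =
  \sum_s \sum_z act s b (act z d t) * act x s (act y z u).
Proof.
rewrite actM act_sum exchange_big; apply: eq_bigr => z _; exact: actM.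
Qed.

Lemma sum_delta2 (W : nmodType) (a b : X) (F : X -> X -> W) :
  \sum_x \sum_y F x y *+ (x == a) *+ (y == b) = F a b.
Proof.
rewrite -(sum_delta a (fun x => F x b)); apply: eq_bigr => x _.
exact: (sum_delta b (fun y => F x y *+ (x == a))).
Qed.

Lemma rotate_sum3 (W : nmodType) (F : X -> X -> X -> W) :
  \sum_y \sum_u \sum_x F x y u = \sum_x \sum_y \sum_u F x y u.
Proof.
rewrite [RHS]exchange_big; apply: eq_bigr => y _; exact: exchange_big.
Qed.

Lemma sum_coef_L (F : X -> X -> X -> M) k :
  \sum_x \sum_y \sum_v m (F x y v) * L k v =
  \sum_v m (\sum_x \sum_y F x y v) * L k v.
Proof.
under [RHS]eq_bigr do rewrite genm_sum mulr_suml.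
under [RHS]eq_bigr do under eq_bigr do rewrite genm_sum mulr_suml.
by rewrite [RHS]exchange_big; apply: eq_bigr => x _; exact: exchange_big.
Qed.

(** The RLL relation after applying op, which sends f(lambda) to right and f(mu) to left
    multiplication by f(mu). Both sides are compatible with products in [x0], so generators suffice;
    on L_ke it is the Yang-Baxter equation. *)
Lemma act_act_RLL a b c d x0 :
  \sum_x \sum_y act x b (act y d x0) * m (Rm a c x y) =
  \sum_x \sum_y m (Rm x y b d) * act c y (act a x x0).
Proof.
move: x0 a b c d; apply: AR_ind => [k e|f|f|t u IHt IHu|t u IHt IHu] a b c d.
- transitivity (\sum_v m (ybe_lhs w Rm a c v b d e) * L k v).
    transitivity (\sum_x \sum_y \sum_v m (mshift (- w v) (Rm a c x y) *
        \sum_u mshift (- w b) (Rm y u d e) * Rm x v b u) * L k v).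
      apply: eq_bigr => x _; apply: eq_bigr => y _.
      rewrite act_act_L mulr_suml; apply: eq_bigr => v _.
      by rewrite -mulrA L_genm mulrA -genmM mulrC.
    rewrite sum_coef_L; apply: eq_bigr => v _; congr (m _ * _).
    rewrite /ybe_lhs rotate_sum3; apply: eq_bigr => x _; apply: eq_bigr => y _.
    by rewrite mulr_sumr; apply: eq_bigr => u _; congr (_ * _); rewrite mulrC.
  under eq_bigr do rewrite hYB.
  transitivity (\sum_x \sum_y \sum_v m (Rm x y b d *
      \sum_u mshift (- w y) (Rm a u x e) * Rm c v y u) * L k v).
    rewrite sum_coef_L; apply: eq_bigr => v _; congr (m _ * _).
    rewrite /ybe_rhs rotate_sum3; apply: eq_bigr => x _; apply: eq_bigr => y _.
    rewrite mulr_sumr; apply: eq_bigr => u _.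
    by rewrite mulrCA [RHS]mulrCA; congr (_ * _); rewrite mulrC.
  apply: eq_bigr => x _; apply: eq_bigr => y _.
  rewrite act_act_L mulr_sumr; apply: eq_bigr => v _.
  by rewrite genmM mulrA.
- transitivity (l f * m (Rm a c b d)).
    rewrite -(sum_delta2 b d (fun x y => l f * m (Rm a c x y))).
    apply: eq_bigr => x _; apply: eq_bigr => y _.
    by rewrite act_l actMn act_l !mulrnAl.
  rewrite genl_m -(sum_delta2 a c (fun x y => m (Rm x y b d) * l f)).
  apply: eq_bigr => x _; apply: eq_bigr => y _.
  by rewrite act_l actMn act_l !mulrnAr eq_sym [c == y]eq_sym mulrnAC.
- transitivity (m (mshift (- w b) (mshift (- w d) f)) * m (Rm a c b d)).
    rewrite -(sum_delta2 b d (fun x y =>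
      m (mshift (- w x) (mshift (- w y) f)) * m (Rm a c x y))).
    apply: eq_bigr => x _; apply: eq_bigr => y _.
    by rewrite act_m actMn act_m !mulrnAl.
  rewrite -genmM mulrC mshift_add.
  rewrite (@shift_Rm f a c b d (- w b - w d) (- w c - w a)); last first.
    by rewrite -!opprD addNr [w a + _]addrC addNr.
  rewrite -mshift_add genmM -(sum_delta2 a c (fun x y => m (Rm x y b d) *
    m (mshift (- w y) (mshift (- w x) f)))).
  apply: eq_bigr => x _; apply: eq_bigr => y _.
  rewrite act_m actMn act_m !mulrnAr eq_sym [c == y]eq_sym mulrnAC.
  by case: eqP => [->|_]; case: eqP => [->|_].
- under eq_bigr do under eq_bigr do rewrite !actD mulrDl.
  under [RHS]eq_bigr do under eq_bigr do rewrite !actD mulrDr.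
  under eq_bigr do rewrite big_split.
  under [RHS]eq_bigr do rewrite big_split.
  by rewrite !big_split IHt IHu.
(* R is carried to the left, first through the factor coming from u, then through the one coming
   from t. *)
- transitivity (\sum_s \sum_z \sum_x \sum_y act s b (act z d t) *
     (act x s (act y z u) * m (Rm a c x y))).
    rewrite -exch4; apply: eq_bigr => x _; apply: eq_bigr => y _.
    rewrite act_act_M mulr_suml; apply: eq_bigr => s _.
    by rewrite mulr_suml; apply: eq_bigr => z _; rewrite mulrA.
  transitivity (\sum_s \sum_z \sum_x \sum_y act s b (act z d t) *
     (m (Rm x y s z) * act c y (act a x u))).
    apply: eq_bigr => s _; apply: eq_bigr => z _.
    under eq_bigr do rewrite -mulr_sumr.
    under [RHS]eq_bigr do rewrite -mulr_sumr.
    by rewrite -!mulr_sumr IHu.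
  transitivity (\sum_s \sum_z \sum_x \sum_y
     (m (Rm s z b d) * act y z (act x s t)) * act c y (act a x u)).
    rewrite exch4 [RHS]exch4; apply: eq_bigr => x _; apply: eq_bigr => y _.
    under eq_bigr do under eq_bigr do rewrite mulrA.
    under eq_bigr do rewrite -mulr_suml.
    under [RHS]eq_bigr do rewrite -mulr_suml.
    by rewrite -!mulr_suml IHt.
  apply: eq_bigr => s _; apply: eq_bigr => z _.
  rewrite act_act_M mulr_sumr exchange_big; apply: eq_bigr => y _.
  by rewrite mulr_sumr; apply: eq_bigr => x _; rewrite mulrA.
Qed.

(** In A^cop the left moment map is f(mu) and the right one is f(lambda). They act by left and right
    multiplication, in both cases with f(mu), since the coefficients of op a x are functions of
    mu. *)
Fixpoint ar_op (t : ar_term V X) (b : A) : A :=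
  match t with
  | TL x y => act x y b
  | Tl f => b * m f
  | Tm f => m f * b
  | T0 => 0
  | T1 => b
  | Tadd t u => ar_op t b + ar_op u b
  | Tmul t u => ar_op t (ar_op u b)
  | Tscale k t => k *: ar_op t b
  end.

Lemma ar_opP t k b c : ar_op t (k *: b + c) = k *: ar_op t b + ar_op t c.
Proof.
elim: t b c => [x y|f|f|||t IHt u IHu|t IHt u IHu|k' t IHt] b c //=.
- exact: actP.
- by rewrite mulrDl scalerAl.
- by rewrite mulrDr scalerAr.
- by rewrite scaler0 addr0.
- by rewrite IHt IHu scalerDr addrACA.
- by rewrite IHu IHt.
- by rewrite IHt scalerDr !scalerA mulrC.
Qed.

Lemma ar_opD t b c : ar_op t (b + c) = ar_op t b + ar_op t c.
Proof. by rewrite -[b]scale1r ar_opP !scale1r. Qed.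
Lemma ar_op0 t : ar_op t 0 = 0.
Proof. by have := ar_opP t (-1) 0 0; rewrite !scaleN1r oppr0 addr0 addNr. Qed.
Lemma ar_opZ t k b : ar_op t (k *: b) = k *: ar_op t b.
Proof. by rewrite -[k *: b]addr0 ar_opP ar_op0 addr0. Qed.

Lemma ar_op_rel t u : ar_rel w Rm t u -> ar_op t = ar_op u.
Proof.
move=> tu; apply/funext => b; elim: tu b => {t u} //=.
- by move=> t u v _ IH _ IH' b; rewrite IH.
- by move=> t t' u u' _ IH _ IH' b; rewrite IH IH'.
- by move=> t t' u u' _ IH _ IH' b; rewrite IH' IH.
- by move=> k t t' _ IH b; rewrite IH.
- by move=> *; rewrite addrA.
- by move=> *; rewrite addrC.
- by move=> *; rewrite add0r.
- by move=> *; rewrite scale0r.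
- by move=> *; rewrite scale1r.
- by move=> *; rewrite scalerA.
- by move=> *; rewrite scalerDl.
- by move=> *; rewrite scalerDr.
- by move=> *; rewrite ar_opD.
- by move=> *; rewrite ar_opZ.
- by move=> *; rewrite genmD mulrDr.
- by move=> f g b; rewrite mulrC genmM mulrA.
- by move=> *; rewrite genmZ scalerAr.
- by move=> *; rewrite genm1 mulr1.
- by move=> *; rewrite genmD mulrDl.
- by move=> *; rewrite genmM mulrA.
- by move=> *; rewrite genmZ scalerAl.
- by move=> *; rewrite genm1 mul1r.
- by move=> f x y b; rewrite act_Mm // mshift_add addNr mshift0.
- by move=> f x y b; rewrite act_mM // mshift_add addNr mshift0.
- by move=> f g b; rewrite mulrA.
- move=> a b c d x0.
  rewrite !(Tsum_morph (phi := fun t => ar_op t x0)) //=.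
  exact: act_act_RLL.
Qed.

Definition op (a b : A) : A := ar_op (repr a) b.

Lemma op_pi t b : op (\pi_A t) b = ar_op t b.
Proof. by rewrite /op (ar_op_rel (ar_reprP w Rm t)). Qed.

Lemma op_L x y b : op (L x y) b = act x y b. Proof. exact: op_pi. Qed.
Lemma op_l f b : op (l f) b = b * m f. Proof. exact: op_pi. Qed.
Lemma op_m f b : op (m f) b = m f * b. Proof. exact: op_pi. Qed.
Lemma op_1 b : op 1 b = b. Proof. by rewrite -AR_pi1 op_pi. Qed.
Lemma opM x y b : op (x * y) b = op x (op y b).
Proof.
by move: x y; apply: arP => t; apply: arP => u; rewrite -AR_piM !op_pi.
Qed.
Lemma opPl k x y b : op (k *: x + y) b = k *: op x b + op y b.
Proof.
by move: x y; apply: arP => t; apply: arP => u; rewrite -AR_piZ -AR_piD !op_pi.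
Qed.
Lemma opDl x y b : op (x + y) b = op x b + op y b.
Proof. by rewrite -[x]scale1r opPl !scale1r. Qed.
Lemma op0l b : op 0 b = 0. Proof. by rewrite -AR_pi0 op_pi. Qed.
Lemma opZl k x b : op (k *: x) b = k *: op x b.
Proof. by rewrite -[k *: x]addr0 opPl op0l addr0. Qed.
Lemma opPr x k b c : op x (k *: b + c) = k *: op x b + op x c.
Proof. exact: ar_opP. Qed.
Lemma opDr x : {morph op x : b c / b + c}.
Proof. exact: ar_opD. Qed.
Lemma op0r x : op x 0 = 0. Proof. exact: ar_op0. Qed.
Lemma opZr x k b : op x (k *: b) = k *: op x b. Proof. exact: ar_opZ. Qed.
Lemma op_sumr x (I : Type) (s : seq I) (F : I -> A) :
  op x (\sum_(k <- s) F k) = \sum_(k <- s) op x (F k).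
Proof. exact: (big_morph _ (opDr x) (op0r x)). Qed.

(** * Operators, moment maps and the bigrading *)

Lemma op_lM a f b : op a (l f * b) = l f * op a b.
Proof.
move: a b; apply: AR_ind => [x y|g|g|x y IHx IHy|x y IHx IHy] b.
- by rewrite !op_L act_lM.
- by rewrite !op_l mulrA.
- by rewrite !op_m !mulrA genl_m.
- by rewrite !opDl IHx IHy mulrDr.
- by rewrite !opM IHy IHx.
Qed.

Lemma op_Ml a f b : op a (b * l f) = op a b * l f.
Proof.
move: a b; apply: AR_ind => [x y|g|g|x y IHx IHy|x y IHx IHy] b.
- by rewrite !op_L act_Ml.
- by rewrite !op_l -!mulrA genl_m.
- by rewrite !op_m mulrA.
- by rewrite !opDl IHx IHy mulrDl.
- by rewrite !opM IHy IHx.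
Qed.

Lemma op_Mm a b f c d :
  AR_deg c d a -> op a (b * m f) = op a b * m (mshift (- c) f).
Proof.
move=> ha; elim: ha b f => {a c d}.
- by move=> x y b f; rewrite !op_L act_Mm.
- by move=> g b f; rewrite !op_l oppr0 mshift0 -!mulrA -!genmM mulrC.
- by move=> g b f; rewrite !op_m oppr0 mshift0 mulrA.
- by move=> c d b f; rewrite !op0l mul0r.
- by move=> c d k x y _ IHx _ IHy b f; rewrite !opPl IHx IHy mulrDl scalerAl.
- move=> c d c' d' x y _ IHx _ IHy b f.
  by rewrite !opM IHy IHx mshift_add opprD.
Qed.

(** R_iz^jy vanishes unless w z = w y + w j - w i, so on L_xy only terms with this right degree
    survive. *)
Lemma act_deg i j p q b :
  AR_deg p q b -> AR_deg p (q + w j - w i) (act i j b : A).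
Proof.
move=> hb; elim: hb i j => {p q b}.
- move=> x y i j; rewrite act_L; apply: AR_deg_sum => z.
  case: (EM (w i + w z = w j + w y)) => [e|/hR ->].
    rewrite [w y + _]addrC -e [w i + _]addrC addrK -[w x]add0r -[w z]add0r.
    by apply: AR_deg_M; [exact: AR_deg_m|exact: AR_deg_L].
  by rewrite genm0 mul0r; exact: AR_deg_0.
- move=> f i j; rewrite act_l; case: eqP => [->|_]; last exact: AR_deg_0.
  by rewrite addrK; exact: AR_deg_l.
- move=> f i j; rewrite act_m; case: eqP => [->|_]; last exact: AR_deg_0.
  by rewrite addrK; exact: AR_deg_m.
- by move=> p q i j; rewrite act0; exact: AR_deg_0.
- by move=> p q k x y _ IHx _ IHy i j; rewrite actP; exact: AR_deg_lin.
- move=> a b c d x y _ IHx _ IHy i j; rewrite actM; apply: AR_deg_sum => z.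
  have -> : b + d + w j - w i = b + w j - w z + (d + w z - w i).
    rewrite [d + w z]addrC -[w z + d - w i]addrA [b + w j - w z + _]addrA subrK.
    by rewrite [RHS]addrA [b + d + _]addrAC.
  exact: AR_deg_M.
Qed.

Lemma op_deg c d p q a b :
  AR_deg c d a -> AR_deg p q b -> AR_deg p (q + d - c) (op a b).
Proof.
move=> ha; elim: ha p q b => {a c d}.
- by move=> x y p q b hb; rewrite op_L; exact: act_deg.
- move=> f p q b hb; rewrite op_l subr0 -[p]addr0.
  by apply: AR_deg_M => //; exact: AR_deg_m.
- move=> f p q b hb; rewrite op_m subr0 addr0 -[p]add0r -[q]add0r.
  by apply: AR_deg_M => //; exact: AR_deg_m.
- by move=> c d p q b _; rewrite op0l; exact: AR_deg_0.
- move=> c d k x y _ IHx _ IHy p q b hb; rewrite opPl.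
  by apply: AR_deg_lin; [exact: IHx|exact: IHy].
- move=> c d c' d' x y _ IHx _ IHy p q b hb; rewrite opM.
  have -> : q + (d + d') - (c + c') = q + d' - c' + d - c.
    rewrite [c + c']addrC opprD addrA [d + d']addrC addrA.
    by rewrite [q + d' - c' + d]addrAC.
  by apply: IHx; exact: IHy.
Qed.

(** * Operators and the coproduct of their index *)

Local Notation P := (halg_pre (AR_halg w Rm)).
Local Notation AA := (tens P P).

Lemma AR_DeltaD (x y : A) : AR_Delta (x + y) = AR_Delta x + AR_Delta y.
Proof. by rewrite -[x]scale1r AR_DeltaP // !scale1r. Qed.

Definition op_pair (b c : A) (p : hpair P P) : A := op (hp_2 p) b * op (hp_1 p) c.

Lemma op_pair_balanced b c : balanced (op_pair b c).
Proof.
split=> [*|*|*|*|f a d e x y hx hfx hy hfy]; rewrite /op_pair /=.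
- by rewrite opDl mulrDr.
- by rewrite opDl mulrDl.
- by rewrite opZl scalerAr.
- by rewrite opZl scalerAl.
- by rewrite !opM op_m op_l mulrA.
Qed.

Lemma tlift_tp (W : lmodType C) (phi : hpair P P -> W) a c b x y
    (hx : AR_deg a c x) (hy : AR_deg c b y) : balanced phi ->
  tlift phi (tp a c b x y) = phi (@HPair R V P P a c b x y hx hy).
Proof. by move=> bphi; rewrite -tpE tlift_pure. Qed.

(* On A^cop the coproduct is flipped, hence the order in [op_pair]. *)
Lemma op_mul a b c : op a (b * c) = tlift (op_pair b c) (AR_Delta a).
Proof.
move: a b c; apply: AR_ind => [x y|f|f|x y IHx IHy|x y IHx IHy] b c.
- have bop := op_pair_balanced b c.
  rewrite AR_DeltaL // tlift_sum // op_L actM; apply: eq_bigr => z _.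
  by rewrite (tlift_tp (AR_deg_L w Rm x z) (AR_deg_L w Rm z y)) // /op_pair !op_L.
- rewrite AR_Deltal // (tlift_tp (AR_deg_l w Rm f) (AR_deg_1 w Rm));
    last exact: op_pair_balanced.
  by rewrite /op_pair /= op_1 !op_l mulrA.
- rewrite AR_Deltam // (tlift_tp (AR_deg_1 w Rm) (AR_deg_m w Rm f));
    last exact: op_pair_balanced.
  by rewrite /op_pair /= op_1 !op_m mulrA.
- rewrite AR_DeltaD //.
  by rewrite tliftD ?opDl ?IHx ?IHy //; exact: op_pair_balanced.
- rewrite opM IHy AR_DeltaM // => {IHy}.
  (* Both sides are linear in the two coproducts, so each is reduced in turn to a pure tensor. *)
  move: (AR_Delta y); apply: tens_ind => [|k q t IH].
    by rewrite tmul0r !tlift0 ?op0r //; exact: op_pair_balanced.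
  have bop := op_pair_balanced b c.
  rewrite tmulDr tmulZr !tliftD // !tliftZ // opPr IH; congr (_ *: _ + _).
  rewrite tlift_pure // {1}/op_pair IHx => {IH IHx}.
  move: (AR_Delta x); apply: tens_ind => [|k' p s IH].
    by rewrite tmul0l !tlift0 //; exact: op_pair_balanced.
  rewrite tmulDl tmulZl tmul_pure !tliftD ?tliftZ ?IH //;
    try exact: op_pair_balanced.
  rewrite !tlift_pure //; last exact: op_pair_balanced.
  by rewrite /op_pair /= !opM.
Qed.

(** * The counit, and the operators in terms of the coproduct of their argument *)

Definition ev (x : A) : M := AR_eps x 1.

Lemma eps_M (x y : A) g : AR_eps (x * y) g = AR_eps x (AR_eps y g).
Proof. by rewrite AR_epsM. Qed.
Lemma eps_D (x y : A) g : AR_eps (x + y) g = AR_eps x g + AR_eps y g.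
Proof. by rewrite -[x]scale1r AR_epsP // !scale1r. Qed.
Lemma eps_0 g : AR_eps (0 : A) g = 0.
Proof. by rewrite -(genl0 w Rm) AR_epsl //= mul0r. Qed.
Lemma eps_Z k (x : A) g : AR_eps (k *: x) g = k *: AR_eps x g.
Proof.
have -> : AR_eps (k *: x) g = k *: AR_eps x g + AR_eps (0 : A) g.
  by rewrite -[k *: x]addr0 AR_epsP.
by rewrite eps_0 addr0.
Qed.
Lemma eps_sum (I : Type) (s : seq I) (F : I -> A) g :
  AR_eps (\sum_(k <- s) F k) g = \sum_(k <- s) AR_eps (F k) g.
Proof.
exact: (big_morph (fun x => AR_eps x g) (fun x y => eps_D x y g) (eps_0 g)).
Qed.
Lemma eps_l f g : AR_eps (l f) g = f * g.
Proof. by rewrite AR_epsl //= mshift0. Qed.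
Lemma eps_m f g : AR_eps (m f) g = f * g.
Proof. by rewrite AR_epsm //= mshift0. Qed.
Lemma eps_L x y g : AR_eps (L x y) g = mshift (- w x) g *+ (x == y).
Proof.
by rewrite AR_epsL //; case: eqP => _ /=; rewrite ?mul1r ?mul0r.
Qed.

(* Commutation with the left moment map stands in for homogeneity, so that it
   applies to op a y with [a] arbitrary. *)
Lemma eps_left c x g : (forall f, l f * x = x * l (mshift c f)) ->
  AR_eps x g = mshift (- c) g * ev x.
Proof.
move=> hx; have := congr1 (fun y => AR_eps y 1) (hx (mshift (- c) g)).
by rewrite !eps_M !eps_l mulr1 mshift_add subrr mshift0.
Qed.

Lemma eps_op c d a y g : AR_deg c d y ->
  AR_eps (op a y) g = mshift (- c) g * ev (op a y).
Proof.
by move=> hy; apply: eps_left => f; rewrite -op_lM (genl_comm f hy) op_Ml.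
Qed.

(** Functions of mu are stable under the operators, which act on them through the counit. This
    yields the axiom <a, 1> = eps(a). *)
Lemma op_genm a g : op a (m g) = m (AR_eps a g).
Proof.
move: a g; apply: AR_ind => [x y|f|f|x y IHx IHy|x y IHx IHy] g.
- rewrite op_L act_m eps_L.
  by case: (x == y); rewrite ?genm0.
- by rewrite op_l eps_l -genmM mulrC.
- by rewrite op_m eps_m genmM.
- by rewrite opDl IHx IHy -genmD eps_D.
- by rewrite opM IHy IHx eps_M.
Qed.

(** The summand of sum mu_r(<a, x''> 1) x', where <a, x''> 1 is itself read off from op a. *)
Definition opK (a : A) (p : hpair P P) : A := m (ev (op a (hp_2 p))) * hp_1 p.

Lemma opK_balanced a : balanced (opK a).
Proof.
split=> [*|*|*|*|f c e d x y hx hfx hy hfy]; rewrite /opK /=.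
- by rewrite mulrDr.
- by rewrite opDr /ev eps_D genmD mulrDl.
- by rewrite scalerAr.
- by rewrite opZr /ev eps_Z genmZ scalerAl.
- by rewrite op_lM /ev eps_M eps_l mulrC genmM mulrA.
Qed.

Lemma ev_Lm y e f : ev (L y e * m f) = mshift (- w y) f *+ (y == e).
Proof. by rewrite /ev eps_M eps_m mulr1 eps_L. Qed.

Lemma ev_lM f x : ev (l f * x) = f * ev x.
Proof. by rewrite /ev eps_M eps_l. Qed.

Lemma ev_mM f x : ev (m f * x) = f * ev x.
Proof. by rewrite /ev eps_M eps_m. Qed.

Lemma LmE k e f : L k e * m f = \sum_y m (ev (L y e * m f)) * L k y.
Proof.
rewrite L_genm -(sum_delta e (fun y => m (mshift (- w y) f) * L k y)).
by apply: eq_bigr => y _; rewrite ev_Lm; case: (y == e); rewrite ?genm0 ?mul0r.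
Qed.

(* The factor m h makes the induction on [a] go through: op (x y) applies op x to
   m(h') L_ky, where a non-homogeneous [x] does not commute with m(h'). *)
Lemma op_Lm a k e h : op a (L k e * m h) =
  \sum_y m (ev (op a (L y e * m h))) * L k y.
Proof.
move: a k e h; apply: AR_ind => [i j|f|f|x y IHx IHy|x y IHx IHy] k e h.
- have E p : act i j (L p e * m h) =
      \sum_z m (Rm i z j e) * (L p z * m (mshift (- w i) h)).
    by rewrite act_Mm act_L mulr_suml; apply: eq_bigr => z _; rewrite mulrA.
  rewrite op_L E; apply: eq_bigr => z _.
  rewrite op_L E L_genm mulrA -genmM /ev eps_sum; congr (m _ * _).
  rewrite -(sum_delta z
    (fun y => Rm i y j e * mshift (- w z) (mshift (- w i) h))).
  by apply: eq_bigr => y _; rewrite -/(ev _) ev_mM ev_Lm mulrnAr eq_sym.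
- rewrite op_l -mulrA -genmM LmE; apply: eq_bigr => y _.
  by rewrite op_l -mulrA -genmM.
- rewrite op_m LmE mulr_sumr; apply: eq_bigr => y _.
  by rewrite op_m ev_mM genmM mulrA.
- rewrite opDl IHx IHy -big_split; apply: eq_bigr => z _ /=.
  by rewrite opDl /ev eps_D genmD mulrDl.
- rewrite opM IHy op_sumr.
  under eq_bigr => y0 _ do
    rewrite (genm_comm _ (AR_deg_L w Rm k y0)) IHx.
  rewrite exchange_big; apply: eq_bigr => z _.
  rewrite -mulr_suml -genm_sum -eps_sum -op_sumr opM [in RHS]IHy.
  congr (m (ev (op x _)) * _); apply: eq_bigr => y0 _.
  by rewrite (genm_comm _ (AR_deg_L w Rm z y0)).
Qed.

(** Recovers the formula that motivated the operators, so that their composition becomes the product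
    axiom in the first argument. The induction on c keeps a arbitrary: in the product case [op_mul]
    splits a, and the hypotheses apply to the two legs of Delta(a). *)
Lemma op_coproduct c a : op a c = tlift (opK a) (AR_Delta c).
Proof.
move: c a; apply: AR_ind => [x y|f|f|x y IHx IHy|x y IHx IHy] a.
- have bK := opK_balanced a.
  rewrite AR_DeltaL // tlift_sum // -[L x y]mulr1 -(genm1 w Rm) op_Lm.
  apply: eq_bigr => z _.
  by rewrite (tlift_tp (AR_deg_L w Rm x z) (AR_deg_L w Rm z y)) // genm1 mulr1.
- rewrite AR_Deltal // (tlift_tp (AR_deg_l w Rm f) (AR_deg_1 w Rm));
    last exact: opK_balanced.
  rewrite /opK /= -[l f]mulr1 op_lM mulr1 -genl_m; congr (_ * _).
  by rewrite -(genm1 w Rm) op_genm /ev eps_m mulr1.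
- rewrite AR_Deltam // (tlift_tp (AR_deg_1 w Rm) (AR_deg_m w Rm f));
    last exact: opK_balanced.
  by rewrite /opK /= mulr1 op_genm /ev eps_m mulr1.
- rewrite AR_DeltaD //.
  by rewrite tliftD ?opDr ?IHx ?IHy //; exact: opK_balanced.
(* The middle degree of p enters twice: as the shift in the counit of op on [hp_2 p], and as the
   shift of a coefficient moved left past [hp_1 p]. The two match. *)
- have key (r p q : hpair P P) :
      m (ev (op_pair (hp_2 p) (hp_2 q) r)) * ((hp_1 p : A) * (hp_1 q : A)) =
      opK (hp_2 r) p * opK (hp_1 r) q.
    rewrite /op_pair /opK /ev eps_M (eps_op _ _ (hp_2P p)) mulrC genmM.
    rewrite -!mulrA; congr (_ * _); rewrite !mulrA; congr (_ * _).
    by rewrite (genm_comm _ (hp_1P p)) mshift_add subrr mshift0.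
  rewrite op_mul AR_DeltaM //.
  (* Unfolding [tlift] over a representative of Delta(a) lets the hypotheses be used term by
     term. *)
  have -> : tlift (op_pair x y) (AR_Delta a) = \sum_(r <- repr (AR_Delta a))
      r.1 *: (tlift (opK (hp_2 r.2)) (AR_Delta x) *
              tlift (opK (hp_1 r.2)) (AR_Delta y)).
    by apply: eq_bigr => r _; rewrite /op_pair IHx IHy.
  have opE b c :
      op a (b * c) = \sum_(r <- repr (AR_Delta a)) r.1 *: op_pair b c r.2.
    exact: op_mul.
  have bK b := opK_balanced b.
  move: (AR_Delta x) (AR_Delta y); apply: tens_ind => [|k p s IHs] t.
    rewrite tmul0l tlift0 // big1 // => r _.
    by rewrite tlift0 // mul0r scaler0.
  rewrite tmulDl tliftD // -IHs tmulZl tliftZ //.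
  rewrite (_ : tlift (opK a) (tmul (pure p) t) = \sum_(r <- repr (AR_Delta a))
    r.1 *: (opK (hp_2 r.2) p * tlift (opK (hp_1 r.2)) t)).
    rewrite scaler_sumr -big_split; apply: eq_bigr => r _ /=.
    rewrite tliftD // tliftZ // tlift_pure // mulrDl scalerDr -scalerAl.
    by rewrite !scalerA mulrC.
  move: t {s IHs}; apply: tens_ind => [|k' q t IHt].
    rewrite tmul0r tlift0 // big1 // => r _.
    by rewrite tlift0 // mulr0 scaler0.
  rewrite tmulDr tliftD // IHt tmulZr tliftZ // tmul_pure tlift_pure //.
  rewrite {1}/opK /= opE /ev eps_sum genm_sum mulr_suml scaler_sumr -big_split.
  apply: eq_bigr => r _ /=.
  rewrite tliftD // tliftZ // tlift_pure // mulrDr scalerDr -scalerAr -key.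
  by rewrite eps_Z genmZ scalerA -scalerAl scalerA mulrC.
Qed.

(** Homogeneous elements span A_R. Inside the induction Q stays quantified, so that the product case
    can use predicates with one factor held fixed. *)
Lemma AR_homog_ind (Q : A -> Prop) :
  (forall x y, Q x -> Q y -> Q (x + y)) ->
  (forall c d x, AR_deg c d x -> Q x) -> forall x, Q x.
Proof.
move=> QD Qh x; move: x Q QD Qh.
apply: AR_ind => [x y|f|f|x y IHx IHy|x y IHx IHy] Q QD Qh.
- exact: Qh (AR_deg_L w Rm x y).
- exact: Qh (AR_deg_l w Rm f).
- exact: Qh (AR_deg_m w Rm f).
- by apply: (QD); [apply: IHx|apply: IHy].
- apply: (IHx (fun x => Q (x * y))) => [x1 x2|c d x' hx].
    by rewrite mulrDl; exact: QD.
  apply: (IHy (fun y => Q (x' * y))) => [y1 y2|c' d' y' hy].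
    by rewrite mulrDr; exact: QD.
  exact: Qh (AR_deg_M hx hy).
Qed.

(** * The pairing defined by the operators, and its axioms *)

Lemma pair_homog c d a b g : AR_deg c d a ->
  ev (op a (b * m g)) = (AR_eps (op a b) * Dterm 1 (- c)) g.
Proof. by move=> ha; rewrite (op_Mm _ _ ha) /ev eps_M eps_m mulr1 /= mul1r. Qed.

(** For a of left degree c the map is eps(op a b) T_{-c}. The general case follows because
    difference operators are closed under sums. *)
Lemma diffop_pair a b : diffop (fun g => ev (op a (b * m g))).
Proof.
move: a; apply: AR_homog_ind => [x y hx hy|c d x hx].
  rewrite (_ : (fun g => _) = fun g => DiffOp hx g + DiffOp hy g).
    exact: diffop_add.
  by apply/funext => g; rewrite opDl /ev eps_D.
rewrite (_ : (fun g => _) = AR_eps (op x b) * Dterm 1 (- c)).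
  exact: Dh_funP.
by apply/funext => g; exact: pair_homog hx.
Qed.

Definition pairing_op (a b : A) : Dh V := DiffOp (diffop_pair a b).

Lemma pairing_opE c d a b : AR_deg c d a ->
  pairing_op a b = AR_eps (op a b) * Dterm 1 (- c).
Proof. by move=> ha; apply: Dh_ext => g; exact: pair_homog ha. Qed.

Lemma eps_deg p q (x : A) : AR_deg p q x -> Dh_deg p q (AR_eps x).
Proof.
elim=> {p q x}.
- move=> x y; rewrite /Dh_deg AR_epsL //.
  case: (x =P y) => [->|_]; first by rewrite eqxx; exists 1.
  by case: eqP => // _; exists 0; rewrite Dterm0.
- by move=> f; rewrite /Dh_deg eqxx AR_epsl // oppr0; exists f.
- by move=> f; rewrite /Dh_deg eqxx AR_epsm // oppr0; exists f.
- move=> p q; have -> : AR_eps (0 : A) = 0.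
    by apply: Dh_ext => g; rewrite eps_0 /= mul0r.
  by rewrite /Dh_deg; case: eqP => // _; exists 0; rewrite Dterm0.
- move=> p q k x y _ + _; rewrite /Dh_deg AR_epsP //; case: eqP => _.
    by move=> [f ->] [g ->]; exists (k *: f + g); rewrite DtermD DtermZ.
  by move=> -> ->; rewrite scaler0 addr0.
- move=> a b c d x y _ + _; rewrite /Dh_deg AR_epsM //.
  case: (a =P b) => [->|_] hx; case: (c =P d) => [->|cd] hy.
  + rewrite eqxx; case: hx hy => f -> [g ->].
    by exists (f * mshift (- b) g); rewrite DtermM opprD.
  + by rewrite hy mulr0; case: eqP => // _; exists 0; rewrite Dterm0.
  + by rewrite hx mul0r; case: eqP => // _; exists 0; rewrite Dterm0.
  + by rewrite hx mul0r; case: eqP => // _; exists 0; rewrite Dterm0.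
Qed.

Lemma op_sum_pure b c g (s : seq (hpair P P)) :
  AR_Delta c = \sum_(i <- s) pure i ->
  op b (c * m g) = \sum_(i <- s) m (ev (op b (hp_2 i * m g))) * hp_1 i.
Proof.
move=> hc; rewrite op_coproduct AR_DeltaM // hc AR_Deltam // tmul_suml.
rewrite tlift_sum; last exact: opK_balanced.
apply: eq_bigr => i _; rewrite -(tpE (AR_deg_1 w Rm) (AR_deg_m w Rm g)) tmul_pure.
rewrite tlift_pure; last exact: opK_balanced.
by rewrite /opK /= mulr1.
Qed.

Local Notation Pcop := (halg_pre (halg_cop (AR_halg w Rm))).

Lemma op_flip_sum_pure a b c (s : seq (hpair Pcop Pcop)) :
  flip (AR_Delta a) = \sum_(i <- s) pure i ->
  op a (b * c) = \sum_(i <- s) op (hp_1 i) b * op (hp_2 i) c.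
Proof.
move=> ha; pose phi (p : hpair Pcop Pcop) : A := op (hp_1 p) b * op (hp_2 p) c.
have bphi : balanced phi.
  split=> *; rewrite /phi /=.
  - by rewrite opDl mulrDl.
  - by rewrite opDl mulrDr.
  - by rewrite opZl scalerAl.
  - by rewrite opZl scalerAr.
  - by rewrite !opM op_l op_m mulrA.
rewrite -(tlift_sum_pure bphi) -ha op_mul.
move: (AR_Delta a); apply: tens_ind => [|k p t IH].
  by rewrite -(scale0r 0) flipZ !tliftZ ?scale0r //; exact: op_pair_balanced.
rewrite flipD flipZ flip_pure !tliftD // ?IH; last exact: op_pair_balanced.
by rewrite !tliftZ // ?tlift_pure //; exact: op_pair_balanced.
Qed.

Lemma is_pairing_op :
  @is_pairing R V (hb_cop (AR_bialg w Rm)) (AR_bialg w Rm) pairing_op.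
Proof.
split.
- by move=> k a a' b; apply: Dh_ext => g /=; rewrite opPl /ev eps_D eps_Z.
- move=> k a b b'; apply: Dh_ext => g /=.
  by rewrite mulrDl -scalerAl opPr /ev eps_D eps_Z.
(* In A_R itself a has bidegree (be, al), so op a b has bidegree (ga, de + al - be), and T_{-be}
   adds be to both degrees. *)
- move=> al be ga de a b ha hb; apply: Dh_degC.
  rewrite (pairing_opE _ ha) [be + _]addrC [al + _]addrC.
  rewrite -[de + al](subrK be); apply: Dh_deg_shift.
  exact: eps_deg (op_deg ha hb).
- move=> f a b; apply: Dh_ext => g /=.
  by rewrite opM op_m ev_mM mshift0.
- move=> f a b; apply: Dh_ext => g /=.
  by rewrite -mulrA op_lM ev_lM mshift0.
- move=> f a b; apply: Dh_ext => g /=.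
  by rewrite opM op_l -mulrA -genmM mulrC mshift0.
- move=> f a b; apply: Dh_ext => g /=.
  by rewrite -mulrA -genmM mshift0.
- move=> a b c s hc; apply: Dh_ext => g; rewrite Dh_sum /=.
  rewrite opM (op_sum_pure _ _ hc) op_sumr /ev eps_sum; apply: eq_bigr => i _.
  (* Moving the coefficient to the right of [hp_1 i] shifts it by [hp_m i]: this is the translation
     in the axiom. *)
  by rewrite (genm_comm _ (hp_1P i)) mul1r.
- move=> a b c s ha; apply: Dh_ext => g; rewrite Dh_sum /=.
  rewrite -mulrA (op_flip_sum_pure _ _ ha) /ev eps_sum; apply: eq_bigr => i _.
  rewrite (op_Mm _ _ (hp_1P i)) mul1r mshift_add addNr mshift0.
  by rewrite !eps_M eps_m mulr1.
- move=> a; apply: Dh_ext => g /=.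
  by rewrite mul1r op_genm /ev eps_m mulr1.
- by move=> b; apply: Dh_ext => g /=; rewrite op_1 /ev eps_M eps_m mulr1.
Qed.

Lemma pairing_op_L i j k e :
  pairing_op (L i j) (L k e) = Dterm (Rm i k j e) (- w i - w k).
Proof.
apply: Dh_ext => g /=.
rewrite op_L act_Mm act_L mulr_suml /ev eps_sum.
rewrite -[RHS](sum_delta k (fun z => Rm i z j e * mshift (- w i - w k) g)).
apply: eq_bigr => z _; rewrite -/(ev _) -mulrA ev_mM ev_Lm mshift_add mulrnAr.
by rewrite eq_sym [- w k - w i]addrC.
Qed.

End Construction.

(** * Properties of an arbitrary pairing *)

Section Pairing.
Context {R : realType} (V : vectType R[i]) (X : finType) (w : X -> V).
Variable Rm : X -> X -> X -> X -> mero V.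
Local Notation C := R[i].
Local Notation M := (mero V).
Local Notation A := (AR w Rm).
Local Notation L := (genL w Rm).
Local Notation l := (genl w Rm).
Local Notation m := (genm w Rm).
Local Notation P := (halg_pre (AR_halg w Rm)).
Local Notation AA := (tens P P).
Hypothesis hR :
  forall x y a b, w x + w y <> w a + w b -> Rm x y a b = 0.
Variable pg : A -> A -> Dh V.
Hypothesis hpg :
  @is_pairing R V (hb_cop (AR_bialg w Rm)) (AR_bialg w Rm) pg.

(** * Linearity, moment maps and degrees *)

Lemma pg_linl k a a' b g : pg (k *: a + a') b g = k *: pg a b g + pg a' b g.
Proof. by rewrite (pairing_linl hpg). Qed.
Lemma pg_linr k a b b' g : pg a (k *: b + b') g = k *: pg a b g + pg a b' g.
Proof. by rewrite (pairing_linr hpg). Qed.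
Lemma pgDl a a' b g : pg (a + a') b g = pg a b g + pg a' b g.
Proof. by rewrite -[a]scale1r pg_linl !scale1r. Qed.
Lemma pgDr a b b' g : pg a (b + b') g = pg a b g + pg a b' g.
Proof. by rewrite -[b]scale1r pg_linr !scale1r. Qed.
Lemma pg0l b g : pg 0 b g = 0.
Proof. by have := pg_linl (-1) 0 0 b g; rewrite scaler0 addr0 scaleN1r addNr. Qed.
Lemma pg0r a g : pg a 0 g = 0.
Proof. by have := pg_linr (-1) a 0 0 g; rewrite scaler0 addr0 scaleN1r addNr. Qed.
Lemma pgZl k a b g : pg (k *: a) b g = k *: pg a b g.
Proof. by rewrite -[k *: a]addr0 pg_linl pg0l addr0. Qed.
Lemma pgZr k a b g : pg a (k *: b) g = k *: pg a b g.
Proof. by rewrite -[k *: b]addr0 pg_linr pg0r addr0. Qed.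
Lemma pg_suml (I : Type) (s : seq I) (F : I -> A) b g :
  pg (\sum_(i <- s) F i) b g = \sum_(i <- s) pg (F i) b g.
Proof.
exact: (big_morph (fun a => pg a b g) (fun a a' => pgDl a a' b g) (pg0l b g)).
Qed.

Lemma pg_mM f a b g : pg (m f * a) b g = f * pg a b g.
Proof. by rewrite (pairing_mll hpg f a b) /= mshift0. Qed.
Lemma pg_lM f a b g : pg a (l f * b) g = f * pg a b g.
Proof. by rewrite (pairing_mlr hpg f a b) /= mshift0. Qed.
Lemma pg_Ml f a b g : pg (a * l f) b g = pg a b (f * g).
Proof. by rewrite (pairing_mrl hpg f a b) /= mshift0. Qed.
Lemma pg_Mm f a b g : pg a (b * m f) g = pg a b (f * g).
Proof. by rewrite (pairing_mrr hpg f a b) /= mshift0. Qed.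

(** The value lies in one component of D_h, so it is zero or of the form h T_s, and h is its value
    at 1. Here s comes from one of the two degrees of that component, in [pg_deg'] from the
    other. *)
Lemma pg_deg c d p q a b g : AR_deg c d a -> AR_deg p q b ->
  pg a b g = pg a b 1 * mshift (- (d + q)) g.
Proof.
move=> ha hb.
have := pairing_deg hpg (ha : @ha_deg _ _ (hb_cop (AR_bialg w Rm)) d c a) hb.
rewrite /Dh_deg; case: eqP => [->|_]; last by move=> ->; rewrite /= !mul0r.
by move=> [f ->] /=; rewrite mshift1 mulr1.
Qed.

Lemma pg_deg' c d p q a b g : AR_deg c d a -> AR_deg p q b ->
  pg a b g = pg a b 1 * mshift (- (c + p)) g.
Proof.
move=> ha hb.
have := pairing_deg hpg (ha : @ha_deg _ _ (hb_cop (AR_bialg w Rm)) d c a) hb.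
rewrite /Dh_deg; case: eqP => _; last by move=> ->; rewrite /= !mul0r.
by move=> [f ->] /=; rewrite mshift1 mulr1.
Qed.

(** * Matrix corepresentations *)

Record corep := Corep {
  cr_idx :> finType;
  cr_wt : cr_idx -> V;
  cr_mx : cr_idx -> cr_idx -> A;
  cr_deg : forall i j, AR_deg (cr_wt i) (cr_wt j) (cr_mx i j);
  cr_Delta : forall i j, AR_Delta (cr_mx i j) =
    \sum_k tp (cr_wt i) (cr_wt k) (cr_wt j) (cr_mx i k) (cr_mx k j);
  cr_eps : forall i j g,
    AR_eps (cr_mx i j) g = mshift (- cr_wt i) g *+ (i == j) }.

Definition corep_pair (e : corep) (i j k : e) : hpair P P :=
  @HPair R V P P (cr_wt i) (cr_wt k) (cr_wt j) (cr_mx i k) (cr_mx k j)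
    (cr_deg i k) (cr_deg k j).

Lemma cr_Delta_pure (e : corep) (i j : e) :
  AR_Delta (cr_mx i j) =
  \sum_(p <- [seq corep_pair i j k | k <- index_enum e]) pure p.
Proof.
rewrite cr_Delta big_map; apply: eq_bigr => k _.
by rewrite -(tpE (cr_deg i k) (cr_deg k j)).
Qed.

(** The coproduct of an entry is a sum of pure tensors of entries, so the product axiom becomes a
    matrix product with shifts in between. *)
Lemma pg_mul_corep (e : corep) (i j : e) a b g :
  pg (a * b) (cr_mx i j) g =
  \sum_k pg a (cr_mx i k) (mshift (cr_wt k) (pg b (cr_mx k j) g)).
Proof.
rewrite (pairing_mull hpg a b (cr_Delta_pure i j)) big_map Dh_sum.
by apply: eq_bigr => k _ /=; rewrite mul1r.
Qed.

Lemma pg_corep_mul (e : corep) (i j : e) b c g :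
  pg (cr_mx i j) (b * c) g =
  \sum_k pg (cr_mx k j) b (mshift (cr_wt k) (pg (cr_mx i k) c g)).
Proof.
have ha : hb_Delta (cr_mx i j : hb_cop (AR_bialg w Rm)) =
    \sum_(p <- [seq hpair_flip (corep_pair i j k) | k <- index_enum e]) pure p.
  rewrite /= cr_Delta_pure !big_map.
  rewrite (big_morph _ (@flipD _ _ _ _) (_ : flip 0 = 0)); last first.
    by rewrite -(scale0r 0) flipZ scale0r.
  by apply: eq_bigr => k _; rewrite flip_pure.
rewrite (pairing_mulr hpg b c ha) big_map Dh_sum.
by apply: eq_bigr => k _ /=; rewrite mul1r.
Qed.

Definition corepL : corep :=
  Corep (AR_deg_L w Rm) (AR_DeltaL hR) (eps_L hR).

Lemma corep1_Delta (i j : unit) :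
  AR_Delta (1 : A) = \sum_(k : unit) tp 0 0 0 (1 : A) 1.
Proof. by rewrite AR_Delta1 // big_const card_unit /= addr0. Qed.

Lemma corep1_eps (i j : unit) g :
  AR_eps (1 : A) g = mshift (- 0) g *+ (i == j).
Proof. by case: i j => -[]; rewrite AR_eps1 //= mul1r oppr0. Qed.

Definition corep1 : corep :=
  @Corep unit (fun=> 0) (fun _ _ => 1) (fun _ _ => AR_deg_1 w Rm)
    corep1_Delta corep1_eps.

Section Product.
Variables e f : corep.
Let wt (i : e * f) := cr_wt i.1 + cr_wt i.2.
Let mx (i j : e * f) := cr_mx i.1 j.1 * cr_mx i.2 j.2.

Lemma corepM_deg i j : AR_deg (wt i) (wt j) (mx i j).
Proof. by apply: AR_deg_M; exact: cr_deg. Qed.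

Lemma corepM_Delta i j :
  AR_Delta (mx i j) = \sum_k tp (wt i) (wt k) (wt j) (mx i k) (mx k j).
Proof.
rewrite AR_DeltaM // !cr_Delta tmul_suml.
under eq_bigr do rewrite tmul_sumr.
rewrite pair_bigA; apply: eq_bigr => -[k k'] _ /=.
rewrite -(tpE (cr_deg i.1 k) (cr_deg k j.1)).
rewrite -(tpE (cr_deg i.2 k') (cr_deg k' j.2)).
rewrite tmul_pure -(tpE (corepM_deg i (k, k')) (corepM_deg (k, k') j)).
exact: pure_ext.
Qed.

Lemma corepM_eps i j g : AR_eps (mx i j) g = mshift (- wt i) g *+ (i == j).
Proof.
rewrite AR_epsM //= !cr_eps mshiftMn -mulrnA mulnb mshift_add -opprD.
by rewrite andbC -pair_eqE.
Qed.

Definition corepM : corep := Corep corepM_deg corepM_Delta corepM_eps.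
End Product.

(** * Exchange relations between corepresentations *)

Lemma sum_swap4 (W : nmodType) (I J K N : finType) (F : I -> J -> K -> N -> W) :
  \sum_x \sum_y \sum_u \sum_v F x y u v = \sum_u \sum_v \sum_x \sum_y F x y u v.
Proof.
rewrite pair_bigA [RHS]pair_bigA /=.
under eq_bigr do rewrite pair_bigA.
under [RHS]eq_bigr do rewrite pair_bigA.
exact: exchange_big.
Qed.

Lemma sum_pair (W : nmodType) (I J : finType) (F : I * J -> W) :
  \sum_p F p = \sum_x \sum_y F (x, y).
Proof. by rewrite pair_bigA; apply: eq_bigr => -[]. Qed.

(* The RLL relation with R_{ac}^{xy} replaced by <e_ax, f_cy> 1. *)
Definition exch (e f : corep) : Prop := forall (a b : e) (c d : f),
  \sum_x \sum_y l (pg (cr_mx a x) (cr_mx c y) 1) * (cr_mx x b * cr_mx y d) =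
  \sum_x \sum_y m (pg (cr_mx x b) (cr_mx y d) 1) * (cr_mx c y * cr_mx a x).

Lemma cr_l (e : corep) (i j : e) f :
  cr_mx i j * l f = l (mshift (- cr_wt i) f) * cr_mx i j.
Proof. by rewrite (genl_comm _ (cr_deg i j)) mshift_add subrr mshift0. Qed.

Lemma cr_m (e : corep) (i j : e) f :
  cr_mx i j * m f = m (mshift (- cr_wt j) f) * cr_mx i j.
Proof. by rewrite (genm_comm _ (cr_deg i j)) mshift_add subrr mshift0. Qed.

Lemma pg_cr (e f : corep) (a x : e) (c y : f) g :
  pg (cr_mx a x) (cr_mx c y) g =
  pg (cr_mx a x) (cr_mx c y) 1 * mshift (- (cr_wt x + cr_wt y)) g.
Proof. exact: pg_deg (cr_deg a x) (cr_deg c y). Qed.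

Lemma pg_cr' (e f : corep) (a x : e) (c y : f) g :
  pg (cr_mx a x) (cr_mx c y) g =
  pg (cr_mx a x) (cr_mx c y) 1 * mshift (- (cr_wt a + cr_wt c)) g.
Proof. exact: pg_deg' (cr_deg a x) (cr_deg c y). Qed.

(** Pairing with 1 is the counit, whose value at 1 on a corepresentation is the identity matrix. *)
Lemma exch_1l f : exch corep1 f.
Proof.
move=> a b c d; rewrite !(big_pred1 tt); try by case.
transitivity (cr_mx c d : A).
  rewrite -[RHS](sum_delta c (fun y => cr_mx y d : A)); apply: eq_bigr => y _.
  rewrite (pairing_1l hpg (cr_mx c y)) /= cr_eps mshift1 eq_sym.
  by case: (y == c); rewrite ?genl0 ?genl1 ?mul0r ?mul1r.
rewrite -[LHS](sum_delta d (fun y => cr_mx c y : A)); apply: eq_bigr => y _.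
rewrite (pairing_1l hpg (cr_mx y d)) /= cr_eps mshift1.
by case: (y == d); rewrite ?genm0 ?genm1 ?mul0r ?mul1r ?mulr1.
Qed.

Lemma exch_1r e : exch e corep1.
Proof.
move=> a b c d.
transitivity (cr_mx a b : A).
  rewrite -[RHS](sum_delta a (fun x => cr_mx x b : A)); apply: eq_bigr => x _.
  rewrite (big_pred1 tt); last by case.
  rewrite (pairing_1r hpg (cr_mx a x)) /= cr_eps mshift1 eq_sym.
  by case: (x == a); rewrite ?genl0 ?genl1 ?mul0r ?mul1r ?mulr1.
rewrite -[LHS](sum_delta b (fun x => cr_mx a x : A)); apply: eq_bigr => x _.
rewrite (big_pred1 tt); last by case.
rewrite (pairing_1r hpg (cr_mx x b)) /= cr_eps mshift1.
by case: (x == b); rewrite ?genm0 ?genm1 ?mul0r ?mul1r.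
Qed.

(** By [pg_mul_corep] the pairing matrix of the product factors into those of e and e'. The entries
    of f are then exchanged with those of e', and afterwards with those of e. *)
Lemma exch_mull e e' f : exch e f -> exch e' f -> exch (corepM e e') f.
Proof.
move=> He He' [a a'] [b b'] c d; rewrite !sum_pair /=.
transitivity (\sum_x \sum_y \sum_x' \sum_k
    l (pg (cr_mx a x) (cr_mx c y) 1) * (cr_mx x b *
      (l (pg (cr_mx a' x') (cr_mx y k) 1) * (cr_mx x' b' * cr_mx k d)))).
  apply: eq_bigr => x _; rewrite [RHS]exchange_big /=; apply: eq_bigr => x' _.
  rewrite [RHS]exchange_big /=; apply: eq_bigr => k _.
  rewrite pg_mul_corep genl_sum mulr_suml; apply: eq_bigr => y _.
  (* What remains is a shift by the weight of x, which disappears when the coefficient passes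
     [cr_mx x b]. *)
  rewrite pg_cr mshift_add opprD subrK genlM -!mulrA; congr (_ * _).
  by rewrite !mulrA cr_l.
transitivity (\sum_x \sum_y \sum_x' \sum_k
    l (pg (cr_mx a x) (cr_mx c y) 1) * (cr_mx x b * cr_mx y k) *
      (m (mshift (cr_wt k) (pg (cr_mx x' b') (cr_mx k d) 1)) * cr_mx a' x')).
  apply: eq_bigr => x _; apply: eq_bigr => y _.
  under eq_bigr do rewrite -!mulr_sumr.
  rewrite -!mulr_sumr He' !mulr_sumr; apply: eq_bigr => x' _.
  rewrite !mulr_sumr; apply: eq_bigr => k _.
  rewrite -!mulrA; congr (_ * (_ * _)).
  by rewrite !mulrA cr_m mshift_add addNr mshift0.
rewrite sum_swap4.
transitivity (\sum_x' \sum_k \sum_x \sum_y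
    m (pg (cr_mx x b) (cr_mx y k) 1) * (cr_mx c y * cr_mx a x) *
      (m (mshift (cr_wt k) (pg (cr_mx x' b') (cr_mx k d) 1)) * cr_mx a' x')).
  apply: eq_bigr => x' _; apply: eq_bigr => k _.
  under eq_bigr do rewrite -mulr_suml.
  under [RHS]eq_bigr do rewrite -mulr_suml.
  by rewrite -!mulr_suml He.
rewrite sum_swap4; apply: eq_bigr => x _; rewrite exchange_big /=.
apply: eq_bigr => x' _; apply: eq_bigr => y _.
rewrite pg_mul_corep genm_sum mulr_suml; apply: eq_bigr => k _.
rewrite [pg _ _ (mshift _ _)]pg_cr' genmM -!mulrA; congr (_ * _).
rewrite !mulrA -[cr_mx c y * _ * _]mulrA cr_m mulrA cr_m.
by rewrite mshift_add opprD addrC.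
Qed.

(** As in [exch_mull], but the coproduct of A^cop is flipped, so the factors come from
    [pg_corep_mul] in reverse order. *)
Lemma exch_mulr e f f' : exch e f -> exch e f' -> exch e (corepM f f').
Proof.
move=> He He' a b [c c'] [d d'].
under eq_bigr do rewrite sum_pair /=.
under [RHS]eq_bigr do rewrite sum_pair /=.
transitivity (\sum_k \sum_y' \sum_x \sum_y
    l (pg (cr_mx k x) (cr_mx c y) 1) * (cr_mx x b * cr_mx y d) *
      (l (mshift (cr_wt k) (pg (cr_mx a k) (cr_mx c' y') 1)) * cr_mx y' d')).
  rewrite [RHS]sum_swap4; apply: eq_bigr => x _; apply: eq_bigr => y _.
  rewrite [RHS]exchange_big /=; apply: eq_bigr => y' _.
  rewrite pg_corep_mul genl_sum mulr_suml; apply: eq_bigr => k _.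
  rewrite pg_cr genlM -!mulrA; congr (_ * _).
  by rewrite !mulrA -[cr_mx x b * _ * _]mulrA cr_l mulrA cr_l !mshift_add opprD.
transitivity (\sum_k \sum_y' \sum_x \sum_y
    m (pg (cr_mx x b) (cr_mx y d) 1) * (cr_mx c y *
      (l (pg (cr_mx a k) (cr_mx c' y') 1) * (cr_mx k x * cr_mx y' d')))).
  apply: eq_bigr => k _; apply: eq_bigr => y' _.
  under eq_bigr do rewrite -mulr_suml.
  rewrite -mulr_suml He mulr_suml; apply: eq_bigr => x _.
  rewrite mulr_suml; apply: eq_bigr => y _.
  rewrite -!mulrA; congr (_ * (_ * _)).
  by rewrite !mulrA cr_l mshift_add addNr mshift0.
rewrite sum_swap4.
transitivity (\sum_x \sum_y \sum_k \sum_y'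
    m (pg (cr_mx x b) (cr_mx y d) 1) * (cr_mx c y *
      (m (pg (cr_mx k x) (cr_mx y' d') 1) * (cr_mx c' y' * cr_mx a k)))).
  apply: eq_bigr => x _; apply: eq_bigr => y _.
  under eq_bigr do rewrite -!mulr_sumr.
  rewrite -!mulr_sumr He' !mulr_sumr; apply: eq_bigr => k _.
  by rewrite !mulr_sumr.
under [LHS]eq_bigr do rewrite exchange_big.
rewrite [LHS]exchange_big; apply: eq_bigr => k _ /=.
rewrite [LHS]exchange_big; apply: eq_bigr => y _ /=.
rewrite [LHS]exchange_big; apply: eq_bigr => y' _ /=.
rewrite pg_corep_mul genm_sum mulr_suml; apply: eq_bigr => x _.
rewrite [pg _ _ (mshift _ _)]pg_cr' mshift_add [cr_wt x + _]addrC opprD subrK.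
by rewrite genmM -!mulrA; congr (_ * _); rewrite !mulrA cr_m.
Qed.

(** The n-th tensor power of [corepL]; its entries are the monomials of length n in the generators
    L_xy. *)
Fixpoint word (n : nat) : corep :=
  if n is n'.+1 then corepM corepL (word n') else corep1.

Lemma exch_word : exch corepL corepL -> forall n k, exch (word n) (word k).
Proof.
move=> HL; elim=> [|n IHn] k; first exact: exch_1l.
apply: exch_mull (IHn k); elim: k => [|k IHk]; first exact: exch_1r.
exact: exch_mulr.
Qed.

(** The commutation relations move every coefficient to the left of the generators, so words span
    A_R over both moment maps. *)
Lemma AR_word_ind (Q : A -> Prop) :
  (forall x y, Q x -> Q y -> Q (x + y)) ->
  (forall f g n (s t : word n), Q (l f * m g * cr_mx s t)) -> forall x, Q x.
Proof.
pose span x := forall Q' : A -> Prop, (forall x y, Q' x -> Q' y -> Q' (x + y)) ->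
  (forall f g n (s t : word n), Q' (l f * m g * cr_mx s t)) -> Q' x.
move=> QD Qw x; suff: span x by apply.
have S1 : span 1.
  move=> Q' _ H; have := H 1 1 0 tt tt.
  by rewrite /= genl1 genm1 !mulr1.
(* Strengthened for the induction on x: left multiplication by x preserves the span of such
   elements. *)
rewrite -[x]mulr1; move: {QD Qw Q} x (1 : A) S1.
apply: AR_ind => [x y|f|f|x y IHx IHy|x y IHx IHy] z Sz Q QD Qw.
- apply: (Sz (fun z => Q (L x y * z))) => [z1 z2|f g n s t].
    by rewrite mulrDr; exact: QD.
  have := Qw (mshift (- w x) f) (mshift (- w y) g) n.+1 (x, s) (y, t).
  by rewrite /= !mulrA L_genl -[_ * L x y * m g]mulrA L_genm mulrA.
- apply: (Sz (fun z => Q (l f * z))) => [z1 z2|f' g n s t].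
    by rewrite mulrDr; exact: QD.
  by rewrite !mulrA -genlM; exact: Qw.
- apply: (Sz (fun z => Q (m f * z))) => [z1 z2|f' g n s t].
    by rewrite mulrDr; exact: QD.
  by rewrite !mulrA -genl_m -[_ * m f * m g]mulrA -genmM; exact: Qw.
- by rewrite mulrDl; apply: (QD); [apply: IHx|apply: IHy].
- by rewrite -mulrA; apply: IHx => //; exact: IHy.
Qed.

(** * The cobraiding identity for arbitrary elements *)

Lemma tlift_bibalanced (W : lmodType C) (phi : hpair P P -> hpair P P -> W) t :
  (forall p, balanced (phi p)) -> (forall q, balanced (phi^~ q)) ->
  balanced (fun p => tlift (phi p) t).
Proof.
move=> bl br; split=> *; rewrite /tlift.
- rewrite -big_split; apply: eq_bigr => q _; rewrite /= -scalerDr.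
  by have [-> _ _ _ _] := br q.2.
- rewrite -big_split; apply: eq_bigr => q _; rewrite /= -scalerDr.
  by have [_ -> _ _ _] := br q.2.
- rewrite scaler_sumr; apply: eq_bigr => q _.
  by have [_ _ -> _ _] := br q.2; rewrite !scalerA mulrC.
- rewrite scaler_sumr; apply: eq_bigr => q _.
  by have [_ _ _ -> _] := br q.2; rewrite !scalerA mulrC.
- apply: eq_bigr => q _; congr (_ *: _).
  have [_ _ _ _ H] := br q.2; exact: H.
Qed.

Definition cob_lhs (p q : hpair P P) : A :=
  l (pg (hp_1 p) (hp_1 q) 1) * ((hp_2 p : A) * (hp_2 q : A)).
Definition cob_rhs (p q : hpair P P) : A :=
  m (pg (hp_2 p) (hp_2 q) 1) * ((hp_1 q : A) * (hp_1 p : A)).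

(** With the next three lemmas, both sides of the cobraiding identity depend only on Delta(a) and
    Delta(b). Here f leaves the pairing shifted by minus the middle degree of p, exactly as when it
    moves left past [hp_2 p]. *)
Lemma cob_lhs_balancedr p : balanced (cob_lhs p).
Proof.
split=> [*|*|*|*|f a c b x y hx hfx hy hfy]; rewrite /cob_lhs /=.
- by rewrite pgDr genlD mulrDl.
- by rewrite !mulrDr.
- by rewrite pgZr genlZ scalerAl.
- by rewrite -!scalerAr.
- rewrite (genm_comm f hx) pg_Mm mulr1.
  rewrite (pg_deg (mshift c f) (hp_1P p) hx) genlM -mulrA; congr (_ * _).
  rewrite mulrA (genl_comm _ (hp_2P p)) !mshift_add opprD.
  by rewrite addrA subrK subrr mshift0 mulrA.
Qed.

Lemma cob_lhs_balancedl q : balanced (cob_lhs^~ q).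
Proof.
split=> [*|*|*|*|f a c b x y hx hfx hy hfy]; rewrite /cob_lhs /=.
- by rewrite pgDl genlD mulrDl.
- by rewrite mulrDl mulrDr.
- by rewrite pgZl genlZ scalerAl.
- by rewrite -scalerAl -scalerAr.
- by rewrite pg_mM mulrC genlM -!mulrA.
Qed.

Lemma cob_rhs_balancedr p : balanced (cob_rhs p).
Proof.
split=> [*|*|*|*|f a c b x y hx hfx hy hfy]; rewrite /cob_rhs /=.
- by rewrite mulrDl mulrDr.
- by rewrite pgDr genmD mulrDl.
- by rewrite -scalerAl -scalerAr.
- by rewrite pgZr genmZ scalerAl.
- by rewrite pg_lM [in RHS]mulrC genmM -!mulrA.
Qed.

Lemma cob_rhs_balancedl q : balanced (cob_rhs^~ q).
Proof.
split=> [*|*|*|*|f a c b x y hx hfx hy hfy]; rewrite /cob_rhs /=.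
- by rewrite !mulrDr.
- by rewrite pgDl genmD mulrDl.
- by rewrite -!scalerAr.
- by rewrite pgZl genmZ scalerAl.
- rewrite (genl_comm f hy) pg_Ml mulr1.
  rewrite (pg_deg' (mshift c f) hy (hp_2P q)) genmM -mulrA; congr (_ * _).
  rewrite [RHS]mulrA (genm_comm _ (hp_1P q)) !mshift_add [c + _]addrC opprD.
  by rewrite addrA subrK subrr mshift0 mulrA.
Qed.

(** The cobraiding identity without a choice of decompositions; in this form it is additive in a and
    b and can be tested on words. *)
Definition exch_elt (a b : A) : Prop :=
  tlift (fun p => tlift (cob_lhs p) (AR_Delta b)) (AR_Delta a) =
  tlift (fun p => tlift (cob_rhs p) (AR_Delta b)) (AR_Delta a).

Lemma deg_lcr f (e : corep) (i j : e) :
  AR_deg (cr_wt i) (cr_wt j) (l f * cr_mx i j).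
Proof.
rewrite -[cr_wt i]add0r -[cr_wt j]add0r.
by apply: AR_deg_M; [exact: AR_deg_l|exact: cr_deg].
Qed.

Lemma deg_mcr f (e : corep) (i j : e) :
  AR_deg (cr_wt i) (cr_wt j) (m f * cr_mx i j).
Proof.
rewrite -[cr_wt i]add0r -[cr_wt j]add0r.
by apply: AR_deg_M; [exact: AR_deg_m|exact: cr_deg].
Qed.

Lemma Delta_lm_corep f g (e : corep) (s t : e) :
  AR_Delta (l f * m g * cr_mx s t) =
  \sum_k pure (@HPair R V P P (cr_wt s) (cr_wt k) (cr_wt t) (l f * cr_mx s k)
    (m g * cr_mx k t) (deg_lcr f s k) (deg_mcr g k t)).
Proof.
rewrite !AR_DeltaM // AR_Deltal // AR_Deltam // cr_Delta tmul_sumr.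
apply: eq_bigr => k _.
rewrite -(tpE (AR_deg_l w Rm f) (AR_deg_1 w Rm)).
rewrite -(tpE (AR_deg_1 w Rm) (AR_deg_m w Rm g)) -(tpE (cr_deg s k) (cr_deg k t)).
by rewrite !tmul_pure; apply: pure_ext; rewrite /= ?addr0 ?add0r ?mulr1 ?mul1r.
Qed.

Lemma exch_elt_corep (e e' : corep) f g (s t : e) f' g' (u v : e') :
  exch e e' ->
  exch_elt (l f * m g * cr_mx s t) (l f' * m g' * cr_mx u v).
Proof.
move=> H; rewrite /exch_elt !Delta_lm_corep.
have sum_tlift (phi : hpair P P -> hpair P P -> A) I J (F : I -> hpair P P)
    (G : J -> hpair P P) (r : seq I) (r' : seq J) :
    (forall p, balanced (phi p)) -> (forall q, balanced (phi^~ q)) ->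
    tlift (fun p => tlift (phi p) (\sum_(j <- r') pure (G j)))
      (\sum_(i <- r) pure (F i)) =
    \sum_(i <- r) \sum_(j <- r') phi (F i) (G j).
  move=> bl br; rewrite tlift_sum; last exact: tlift_bibalanced.
  apply: eq_bigr => i _; rewrite tlift_pure; last exact: tlift_bibalanced.
  by rewrite tlift_sum //; apply: eq_bigr => j _; rewrite tlift_pure.
rewrite (sum_tlift cob_lhs); [|exact: cob_lhs_balancedr|exact: cob_lhs_balancedl].
rewrite (sum_tlift cob_rhs); [|exact: cob_rhs_balancedr|exact: cob_rhs_balancedl].
(* The functions in front of the two words combine into this factor on both sides, leaving the
   exchange relation. *)
pose c := l (f' * mshift (- cr_wt u) f) * m (g * mshift (- cr_wt t) g').
transitivity (c * \sum_x \sum_y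
    l (pg (cr_mx s x) (cr_mx u y) 1) * (cr_mx x t * cr_mx y v)).
  rewrite mulr_sumr; apply: eq_bigr => x _.
  rewrite mulr_sumr; apply: eq_bigr => y _; rewrite /cob_lhs /=.
  rewrite pg_lM (genl_comm f (cr_deg s x)) pg_Ml mulr1.
  rewrite (pg_cr' _ _ _ _ (mshift _ f)) mshift_add opprD addrAC addNr add0r.
  have -> : m g * cr_mx x t * (m g' * cr_mx y v) =
      m (g * mshift (- cr_wt t) g') * (cr_mx x t * cr_mx y v).
    by rewrite genmM -!mulrA; congr (_ * _); rewrite !mulrA cr_m.
  rewrite /c -!mulrA [m _ * (l _ * _)]mulrA -genl_m -mulrA [RHS]mulrA -genlM.
  by rewrite -[in RHS]mulrA [mshift _ f * _]mulrC.
rewrite H mulr_sumr; apply: eq_bigr => x _.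
rewrite mulr_sumr; apply: eq_bigr => y _; rewrite /cob_rhs /=.
rewrite pg_mM (genm_comm g' (cr_deg y v)) pg_Mm mulr1.
rewrite (pg_cr _ _ _ _ (mshift _ g')) mshift_add opprD subrK.
have -> : l f' * cr_mx u y * (l f * cr_mx s x) =
    l (f' * mshift (- cr_wt u) f) * (cr_mx u y * cr_mx s x).
  by rewrite genlM -!mulrA; congr (_ * _); rewrite !mulrA cr_l.
rewrite /c genl_m -!mulrA [l _ * (m _ * _)]mulrA genl_m -mulrA [LHS]mulrA -genmM.
by rewrite -mulrA [mshift _ g' * _]mulrC.
Qed.

Lemma exch_eltP : exch corepL corepL -> forall a b, exch_elt a b.
Proof.
move=> HL.
apply: AR_word_ind => [x y Hx Hy b|f g n s t].
  rewrite /exch_elt AR_DeltaD // !tliftD ?Hx ?Hy //; apply: tlift_bibalanced;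
    do [exact: cob_lhs_balancedr|exact: cob_lhs_balancedl
       |exact: cob_rhs_balancedr|exact: cob_rhs_balancedl].
apply: AR_word_ind => [x y Hx Hy|f' g' k u v]; last first.
  by apply: exch_elt_corep; exact: exch_word.
rewrite /exch_elt AR_DeltaD //.
rewrite (tlift_funD (phi := fun p => tlift (cob_lhs p) (AR_Delta x))
                    (psi := fun p => tlift (cob_lhs p) (AR_Delta y))); last first.
  by move=> p; rewrite tliftD //; exact: cob_lhs_balancedr.
rewrite Hx Hy; apply/esym/tlift_funD => p.
by rewrite tliftD //; exact: cob_rhs_balancedr.
Qed.

Lemma is_cobraiding_pg : exch corepL corepL ->
  @is_cobraiding R V (AR_bialg w Rm) pg.
Proof.
move=> HL; split=> // a b s t ha hb.
have := exch_eltP HL a b; rewrite /exch_elt.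
have -> : AR_Delta a = \sum_(i <- s) pure i by [].
have -> : AR_Delta b = \sum_(i <- t) pure i by [].
do 2!(rewrite tlift_sum_pure; last by
  apply: tlift_bibalanced; do [exact: cob_lhs_balancedr|exact: cob_lhs_balancedl
       |exact: cob_rhs_balancedr|exact: cob_rhs_balancedl]).
move=> H; transitivity (\sum_(i <- s) tlift (cob_lhs i) (\sum_(j <- t) pure j)).
  by apply: eq_bigr => i _; rewrite tlift_sum_pure //; exact: cob_lhs_balancedr.
rewrite H; apply: eq_bigr => i _.
by rewrite tlift_sum_pure //; exact: cob_rhs_balancedr.
Qed.

(** * The Yang-Baxter equation from a pairing given by R on generators *)

Hypothesis hL :
  forall i j k e, pg (L i j) (L k e) = Dterm (Rm i k j e) (- w i - w k).

Lemma exch_L : exch corepL corepL.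
Proof.
move=> a b c d.
under eq_bigr do under eq_bigr do rewrite hL /= mshift1 mulr1.
under [RHS]eq_bigr do under eq_bigr do rewrite hL /= mshift1 mulr1.
exact: AR_RLL.
Qed.

Lemma pg_LL x b y d k e g : pg (L x b * L y d) (L k e) g =
  (\sum_z Rm x k b z * mshift (- w b) (Rm y z d e)) *
    mshift (- (w x + w y + w k)) g.
Proof.
rewrite (@pg_mul_corep corepL k e) mulr_suml; apply: eq_bigr => z _ /=.
rewrite !hL /= !mshiftM !mshift_add mulrA; congr (_ * mshift _ g).
  (* The axioms give the shift w z - w x - w k, which equals -w b wherever R_xk^bz is nonzero. *)
  rewrite -(@shift_Rm _ _ _ w Rm hR _ x k b z (- w b)) //.
  by rewrite addKr addrAC -opprD addNr add0r.
by rewrite [- w y - w z]addrC addrA addrK -!opprD addrAC.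
Qed.

Lemma pg_ybe a c k b d e : ybe_lhs w Rm a c k b d e = ybe_rhs w Rm a c k b d e.
Proof.
have := congr1 (fun x => pg x (L k e) 1) (AR_RLL w Rm a b c d).
rewrite !pg_suml.
under eq_bigr do rewrite pg_suml.
under [X in _ = X -> _]eq_bigr do rewrite pg_suml.
(* In A^cop functions of lambda leave the pairing on the right, so R(lambda) first moves past L_xb
   L_yd. Of the two resulting shifts only -w k survives. *)
under eq_bigr => x _ do under eq_bigr => y _ do
  rewrite (genl_comm _ (deg_LL w Rm x b y d)) pg_Ml mulr1 pg_LL mshift_add
          opprD addrAC addNr add0r.
under [X in _ = X -> _]eq_bigr do under eq_bigr do
  rewrite pg_mM pg_LL mshift1 mulr1.
rewrite /ybe_lhs /ybe_rhs rotate_sum3 [X in _ -> _ = X]rotate_sum3 => H.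
transitivity (\sum_x \sum_y (\sum_z Rm x k b z * mshift (- w b) (Rm y z d e)) *
    mshift (- w k) (Rm a c x y)).
  apply: eq_bigr => x _; apply: eq_bigr => y _.
  by rewrite -mulr_sumr mulrC.
rewrite {}H; apply: eq_bigr => x _; apply: eq_bigr => y _.
by rewrite mulr_sumr; apply: eq_bigr => z _; rewrite mulrC -mulrA.
Qed.
End Pairing.

Theorem corollary3p20 (R : realType) (V : vectType R[i]) (X : finType)
    (w : X -> V) (Rm : X -> X -> X -> X -> mero V)
    (hRm : forall x y a b, w x + w y <> w a + w b -> Rm x y a b = 0) :
  let A := AR_bialg w Rm in
  let L := genL w Rm in
  let pairing_by_R (pg : hb_cop A -> A -> Dh V) :=
    is_pairing pg /\
    forall i j k l, pg (L i j) (L k l) = Dterm (Rm i k j l) (- w i - w k) in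
  ((exists pg, pairing_by_R pg) <-> QDYBE w Rm) /\
  (forall pg, pairing_by_R pg -> is_cobraiding pg).
Proof.
move=> A L pairing_by_R; split; last first.
  by move=> pg [hpg hL]; exact: (is_cobraiding_pg (hR := hRm) hpg (exch_L hL)).
split=> [[pg [hpg hL]]|/QDYBE_entries hYB].
  apply/QDYBE_entries => i p q j b d; exact: (pg_ybe hRm hpg hL).
exists (pairing_op hRm hYB); split; first exact: is_pairing_op.
exact: pairing_op_L.
Qed.
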